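(* Let $L,T>0$ and let $\alpha(s)=(x(s),0,z(s))$, $s\in[0,L]$, be a smooth, non-closed, simple curve in the plane $y=0$ of $\mathbb{R}^3$, parametrized with respect to its arc length, with $$x(L-s)=-x(s),\qquad z(L-s)=z(s),\qquad s\in\left[0,\tfrac{L}{2}\right].$$ Let $\varphi(s,t)=\alpha(s)+t(0,-1,0)$ for $(s,t)\in(0,L)\times(0,T)$, let $\nu=\dfrac{\varphi_s\times\varphi_t}{\|\varphi_s\times\varphi_t\|}$, and let $$D=\left\{\varphi(s,t)+r\,\nu(s,t):\ (s,t)\in(0,L)\times(0,T),\ r\in(0,\delta)\right\}.$$ Suppose that the curvature $k(s)=-\varphi_{ss}\cdot\nu=x'(s)z''(s)-z'(s)x''(s)$ of $\alpha$ is concave in $[0,L]$ and let $\delta>0$ be such that $1+\delta k(s)>0$ in $[0,L]$. If $D$ is simply connected and $\mu_1^{odd}(D)$ is the smallest nontrivial Neumann eigenvalue of $D$ having a corresponding eigenfunction that is odd with respect to the plane $x=0$, then $$\mu_1^{odd}(D)\ge B\,\frac{\pi^2}{L^2},\qquad\text{where}\quad B=\min_{(r,s)\in[0,\delta]\times[0,L]}\frac{1}{(1+rk(s))^2}.$$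
   Context: For a bounded, connected, Lipschitz domain $D\subset\mathbb{R}^3$, the Neumann eigenvalues of $D$ are the numbers $\mu$ for which the problem $-\Delta u=\mu u$ in $D$, $\partial u/\partial\mathbf{n}=0$ on $\partial D$ (with $\mathbf{n}$ the exterior unit normal) has a nonzero solution (an eigenfunction); nontrivial means nonzero. All functions are real-valued. Odd with respect to the plane $x=0$ means $u(-x,y,z)=-u(x,y,z)$. Explicitly, $\nu(s,t)=(z'(s),0,-x'(s))$. *)

(* Defs.v *)
From HB Require Import structures.
From mathcomp Require Import all_boot all_order all_algebra.
From mathcomp Require Import all_classical all_reals all_analysis.

Set Implicit Arguments.
Unset Strict Implicit.
Unset Printing Implicit Defensive.

Import Order.TTheory GRing.Theory Num.Theory.
Import numFieldNormedType.Exports.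

Local Open Scope classical_set_scope.
Local Open Scope ring_scope.

Definition is_minimum (R : realType) (A : set R) (m : R) : Prop :=
  A m /\ lbound A m.

(* The library norm on a product is the max norm: it yields the usual topology
   of [R^3] but not the Euclidean length, which is [norm3]. *)

Notation R3 R := (R * R * R)%type.

Definition dot3 (R : realType) (a b : R3 R) : R :=
  a.1.1 * b.1.1 + a.1.2 * b.1.2 + a.2 * b.2.

Definition norm3 (R : realType) (a : R3 R) : R := Num.sqrt (dot3 a a).

Definition cross3 (R : realType) (a b : R3 R) : R3 R :=
  (a.1.2 * b.2 - a.2 * b.1.2,
   a.2 * b.1.1 - a.1.1 * b.2,
   a.1.1 * b.1.2 - a.1.2 * b.1.1).

Definition basis3 (R : realType) (i : 'I_3) : R3 R :=
  ((i == 0%N :> nat)%:R, (i == 1%N :> nat)%:R, (i == 2%N :> nat)%:R).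

(* [measurableTypeR R] is [R] with its Borel sets; the three-fold product
   sigma-algebra is the Borel sigma-algebra of [R3 R]. *)
Definition vol3 (R : realType) :
    {measure set (measurableTypeR R * measurableTypeR R * measurableTypeR R)
       -> \bar R} :=
  ((@lebesgue_measure R \x @lebesgue_measure R) \x @lebesgue_measure R)%E.

Definition path_connected (R : realType) (D : set (R3 R)) : Prop :=
  D !=set0 /\
  forall p q, D p -> D q ->
    exists c : R -> R3 R,
      [/\ {within `[0, 1], continuous c},
          (forall t, t \in `[0, 1] -> D (c t)), c 0 = p & c 1 = q].

Definition loops_contractible (R : realType) (D : set (R3 R)) : Prop :=
  forall c : R -> R3 R,
    {within `[0, 1], continuous c} ->
    (forall t, t \in `[0, 1] -> D (c t)) -> c 0 = c 1 ->
    exists H : R * R -> R3 R,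
      [/\ {within `[0, 1] `*` `[0, 1], continuous H},
          (forall a t, a \in `[0, 1] -> t \in `[0, 1] -> D (H (a, t))),
          (forall t, t \in `[0, 1] -> H (0, t) = c t),
          (forall t, t \in `[0, 1] -> H (1, t) = c 0) &
          (forall a, a \in `[0, 1] -> H (a, 0) = c 0 /\ H (a, 1) = c 0)].

Definition simply_connected (R : realType) (D : set (R3 R)) : Prop :=
  path_connected D /\ loops_contractible D.

Definition smooth3 (R : realType) (f : R3 R -> R) : Prop :=
  forall (l : seq 'I_3) (p : R3 R),
    differentiable (foldr (fun i g => 'D_(basis3 R i) g) f l) p.

Definition test_function (R : realType) (D : set (R3 R)) (f : R3 R -> R) :
    Prop :=
  smooth3 f /\
  exists K : set (R3 R),
    [/\ compact K, K `<=` D & forall p, ~ K p -> f p = 0].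

Definition square_integrable (R : realType) (D : set (R3 R)) (u : R3 R -> R) :
    Prop :=
  measurable_fun (D : set (measurableTypeR R * measurableTypeR R *
                           measurableTypeR R)) u /\
  (vol3 R).-integrable D (fun p => (u p ^+ 2)%:E).

Definition weak_partial (R : realType) (D : set (R3 R)) (i : 'I_3)
    (u g : R3 R -> R) : Prop :=
  forall f, test_function D f ->
    \int[vol3 R]_(p in D) (u p * 'D_(basis3 R i) f p) =
    - \int[vol3 R]_(p in D) (g p * f p).

Definition H1_with_gradient (R : realType) (D : set (R3 R)) (u : R3 R -> R)
    (G : 'I_3 -> R3 R -> R) : Prop :=
  square_integrable D u /\
  forall i, square_integrable D (G i) /\ weak_partial D i u (G i).

(* A Lipschitz boundary has no normal along its edges, so [- Laplacian u = mu u]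
   in [D], [du/dn = 0] on the boundary of [D] is understood weakly, as usual:
   the boundary condition is the natural one, obtained by testing against all of
   [H^1(D)]. Functions are identified almost everywhere. *)
Definition neumann_eigenfunction (R : realType) (D : set (R3 R)) (mu : R)
    (u : R3 R -> R) : Prop :=
  ~ {ae vol3 R, forall p, D p -> u p = 0} /\
  exists G, H1_with_gradient D u G /\
    forall v V, H1_with_gradient D v V ->
      \sum_(i < 3) \int[vol3 R]_(p in D) (G i p * V i p) =
      mu * \int[vol3 R]_(p in D) (u p * v p).

Definition odd_in_x (R : realType) (D : set (R3 R)) (u : R3 R -> R) : Prop :=
  {ae vol3 R, forall p, D p -> u (- p.1.1, p.1.2, p.2) = - u p}.

Definition odd_neumann_spectrum (R : realType) (D : set (R3 R)) : set R :=
  [set mu | mu <> 0 /\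
     exists u, neumann_eigenfunction D mu u /\ odd_in_x D u].

(* A smooth function on a closed interval is the restriction of one that is
   smooth on the line, so curves are given by smooth functions on [R]; only
   their restriction to the parameter interval matters. *)
Definition smooth1 (R : realType) (f : R -> R) : Prop :=
  forall n s, derivable (derive1n n f) s 1.

Lemma derive1_triple (R : realType) (f g h : R -> R) (s : R) :
  derivable f s 1 -> derivable g s 1 -> derivable h s 1 ->
  derive1 (fun u => (f u, g u, h u)) s = (derive1 f s, derive1 g s, derive1 h s).
Proof.
move=> /derivable1_diffP df /derivable1_diffP dg /derivable1_diffP dh.
have dfg := differentiable_pair df dg.
have dfgh := differentiable_pair dfg dh.
by rewrite !derive1E !deriveE// diff_pair//= diff_pair.
Qed.

Section Tube.
Variables (R : realType) (x z : R -> R).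

Definition alpha (s : R) : R3 R := (x s, 0, z s).

Definition phi (s t : R) : R3 R := alpha s + t *: ((0, -1, 0) : R3 R).

Definition nu (s t : R) : R3 R :=
  let n := cross3 (derive1 (phi ^~ t) s) (derive1 (phi s) t) in (norm3 n)^-1 *: n.

Definition curvature (s : R) : R :=
  derive1 x s * derive1n 2 z s - derive1 z s * derive1n 2 x s.

Definition tube (L T delta : R) : set (R3 R) :=
  [set p | exists s t r,
     [/\ s \in `]0, L[, t \in `]0, T[, r \in `]0, delta[ &
         p = phi s t + r *: nu s t]].

Lemma phiE s t : phi s t = (x s, - t, z s).
Proof.
rewrite /phi /alpha.
have -> : t *: ((0, -1, 0) : R3 R) = (0, - t, 0).
  by congr (_, _, _); rewrite /= /GRing.scale/= ?mulr0// mulrN1.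
by congr (_, _, _); rewrite /= ?addr0 ?add0r.
Qed.

Lemma derive1_phi_s s t : derivable x s 1 -> derivable z s 1 ->
  derive1 (phi ^~ t) s = (derive1 x s, 0, derive1 z s).
Proof.
move=> dx dz.
have -> : phi ^~ t = fun u => (x u, cst (- t) u, z u).
  by apply/funext => u; rewrite phiE.
by rewrite derive1_triple// derive1_cst.
Qed.

Lemma derive1_phi_t s t : derive1 (phi s) t = (0, -1, 0).
Proof.
have -> : phi s = fun u => (cst (x s) u, (- @id R) u, cst (z s) u).
  by apply/funext => u; rewrite phiE.
have di : derivable (@id R) t 1 by exact: derivable_id.
have dN : derivable (- @id R) t 1 by exact: derivableN.
rewrite derive1_triple//.
by rewrite !derive1_cst derive1E deriveN// derive_id.
Qed.

Lemma derive1_alpha s : derivable x s 1 -> derivable z s 1 ->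
  derive1 alpha s = (derive1 x s, 0, derive1 z s).
Proof.
move=> dx dz.
have -> : alpha = fun u => (x u, cst 0 u, z u) by [].
by rewrite derive1_triple// derive1_cst.
Qed.

(* For an arc-length parametrization the normal is the expected one, and the
   curvature is minus the normal component of the second [s]-derivative. *)
Lemma nuE s t : derivable x s 1 -> derivable z s 1 ->
  norm3 (derive1 alpha s) = 1 -> nu s t = (derive1 z s, 0, - derive1 x s).
Proof.
move=> dx dz; rewrite /nu derive1_phi_s// derive1_phi_t derive1_alpha//.
have -> : cross3 (derive1 x s, 0, derive1 z s) (0, -1, 0) =
          (derive1 z s, 0, - derive1 x s).
  by rewrite /cross3/= !mulr0 !mulrN !mulr1 opprK add0r subrr subr0.
rewrite /norm3 /dot3/= mulrNN mulr0 !addr0 addrC => ->.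
by rewrite invr1 scale1r.
Qed.


Lemma curvatureE s t : smooth1 x -> smooth1 z ->
  norm3 (derive1 alpha s) = 1 ->
  curvature s = - dot3 (derive1n 2 (phi ^~ t) s) (nu s t).
Proof.
move=> sx sz n1.
have dx u : derivable x u 1 by exact: (sx 0%N).
have dz u : derivable z u 1 by exact: (sz 0%N).
rewrite (nuE _ (dx s) (dz s) n1) /=.
have -> : derive1 (phi ^~ t) =
    fun u => (derive1 x u, cst 0 u, derive1 z u).
  by apply/funext => u; rewrite derive1_phi_s.
rewrite derive1_triple//; [|exact: (sx 1%N)|exact: (sz 1%N)].
rewrite /dot3/= /curvature mulr0 addr0 mulrN opprB.
by rewrite mulrC [X in _ - X]mulrC.
Qed.

End Tube.

(* Main.v *)
(** The tube carries coordinates [(s, r, y)] in which [p = alpha s + r nu s],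
    shifted by [y] along the second axis, and the Jacobian is [J = 1 + r k s].
    They are injective: loops of [D] have winding number zero around points
    outside [D], while an overlap of the planar strip would have to turn around
    the centre of curvature of an end of the curve, which lies outside [D] because
    osculating circles of an arc of monotone curvature are nested.

    Let [tau] be the unit tangent field along [s], [X s = (pi / L) cot (pi s / L)]
    and [lambda = B pi ^ 2 / L ^ 2]. For a test function [psi] and
    [h = div (psi tau)], integrating the divergence of [psi ^ 2 (X / J) tau] gives
    [lambda * int psi ^ 2 <= int h ^ 2]: this uses the Riccati equation for [X] and
    [X * k' >= 0], which holds as [k] is concave and symmetric. An odd [u] is an
    [L^2] limit of such [h], since an odd function of [s] with compact support has
    a compactly supported primitive. As [int u h = - int psi (grad u . tau)],
    Cauchy-Schwarz yields [lambda * int u ^ 2 <= int |grad u| ^ 2 = mu int u ^ 2]. *)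

Require Import Defs.
From HB Require Import structures.
From mathcomp Require Import all_boot all_order all_algebra.
From mathcomp Require Import all_classical all_reals all_analysis.
From mathcomp Require Import measurable_realfun ring lra.

Set Implicit Arguments.
Unset Strict Implicit.
Unset Printing Implicit Defensive.

Import Order.TTheory GRing.Theory Num.Theory.
Import numFieldNormedType.Exports.

Local Open Scope classical_set_scope.
Local Open Scope ring_scope.

(** Nothing in the definition of [tube] makes the coordinates well defined, so injectivity must be
    extracted from the topology before any analysis. Negative curvature at the ends is the hard
    case: the half curve may then spiral, whereas for [k >= 0] it turns by less than [pi].

    The inequality is dualized because [weak_partial] only sees compactly supported functions: a
    bound for [u], whose boundary values are out of reach, becomes a Dirichlet inequality for [psi].
    On a straight strip the extremal odd function is [cos (pi s / L)] and its derivative is a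
    multiple of [sin (pi s / L)]. The field [X] is the logarithmic derivative of that sine, which
    explains its Riccati equation; its poles at [0] and [L] are invisible to [psi].

    All integrals stay Cartesian, without change of variables. The coordinates enter through the
    gradients of [cs] and [cr], which are [tau / J] and the normal; divergences integrate to zero by
    Fubini. As [tau] is divergence free, [div (psi tau)] is the [s]-derivative of [psi] over [J].
    Hence [u * J] is what gets approximated and integrated in [s]; it is odd because [J] is
    symmetric. *)

Section real_calculus.
Variable R : realType.
Implicit Types (f g : R -> R) (x a b c : R).

Lemma is_deriveC x c : is_derive x 1 (fun=> c : R) 0.
Proof. exact: is_derive_cst. Qed.

Lemma is_deriveI x : is_derive x 1 (fun t : R => t) 1.
Proof. exact: is_derive_id. Qed.

Lemma is_deriveD_fun f g x a b : is_derive x 1 f a -> is_derive x 1 g b ->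
  is_derive x 1 (fun t => f t + g t) (a + b).
Proof. by move=> ? ?; exact: is_deriveD. Qed.

Lemma is_deriveN_fun f x a : is_derive x 1 f a ->
  is_derive x 1 (fun t => - f t) (- a).
Proof. by move=> ?; exact: is_deriveN. Qed.

Lemma is_deriveM_fun f g x a b : is_derive x 1 f a -> is_derive x 1 g b ->
  is_derive x 1 (fun t => f t * g t) (f x * b + g x * a).
Proof. by move=> ? ?; exact: is_deriveM. Qed.

Lemma is_deriveX_fun f n x a : is_derive x 1 f a ->
  is_derive x 1 (fun t => f t ^+ n.+1) (n.+1%:R * f x ^+ n * a).
Proof.
move=> fa; have := @is_deriveX R _ f n.+1 x 1 a fa.
rewrite (_ : f ^+ n.+1 = fun t => f t ^+ n.+1)//.
by apply/funext => t; rewrite exprfctE.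
Qed.

Lemma is_deriveV_fun f x a : f x != 0 -> is_derive x 1 f a ->
  is_derive x 1 (fun t => (f t)^-1) (- (f x) ^- 2 * a).
Proof.
move=> fx0 fa; have df : derivable f x 1 by [].
apply: (@DeriveDef R R R x 1 (fun t => (f t)^-1)).
  exact: derivableV.
by rewrite deriveV// derive_val.
Qed.

Lemma is_derive_comp_fun f g x a b : is_derive (g x) 1 f a ->
  is_derive x 1 g b -> is_derive x 1 (fun t => f (g t)) (a * b).
Proof. by move=> ? ?; exact: is_derive1_comp. Qed.

Lemma is_derive_sin_fun f x a : is_derive x 1 f a ->
  is_derive x 1 (fun t => sin (f t)) (cos (f x) * a).
Proof. by move=> ?; exact: is_derive_comp_fun. Qed.

Lemma is_derive_cos_fun f x a : is_derive x 1 f a ->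
  is_derive x 1 (fun t => cos (f t)) (- sin (f x) * a).
Proof. by move=> ?; exact: is_derive_comp_fun. Qed.

Lemma is_derive_within f (df : R -> R) a b :
  (forall s, a <= s <= b -> is_derive s 1 f (df s)) ->
  {within `[a, b], continuous f}.
Proof.
move=> h; apply: derivable_within_continuous => s.
by rewrite in_itv/= => /h [].
Qed.

Lemma derive_ndecr f (df : R -> R) a b :
  (forall s, a <= s <= b -> is_derive s 1 f (df s)) ->
  (forall s, a < s < b -> 0 <= df s) -> a <= b -> f a <= f b.
Proof.
move=> h hp; rewrite le_eqVlt => /predU1P[->//|ab].
have [||c cab e] := @MVT R f df a b ab.
- by move=> s; rewrite in_itv/= => /andP[? ?]; apply: h; lra.
- exact: is_derive_within h.
rewrite -subr_ge0 e mulr_ge0 ?subr_ge0 ?(ltW ab)//.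
by apply: hp; move: cab; rewrite in_itv.
Qed.

Lemma derive_incr f (df : R -> R) a b :
  (forall s, a <= s <= b -> is_derive s 1 f (df s)) ->
  (forall s, a < s < b -> 0 < df s) -> a < b -> f a < f b.
Proof.
move=> h hp ab.
have [||c cab e] := @MVT R f df a b ab.
- by move=> s; rewrite in_itv/= => /andP[? ?]; apply: h; lra.
- exact: is_derive_within h.
rewrite -subr_gt0 e mulr_gt0 ?subr_gt0//.
by apply: hp; move: cab; rewrite in_itv.
Qed.

Lemma IVT_itv f a b v : a <= b -> {within `[a, b], continuous f} ->
  f a <= v <= f b \/ f b <= v <= f a -> exists2 c, a <= c <= b & f c = v.
Proof.
move=> ab cf h; have [|c cab <-] := @IVT R f a b v ab cf.
  by case: h => /andP[h1 h2]; rewrite ge_min le_max h1 h2 ?orbT.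
by exists c => //; move: cab; rewrite in_itv.
Qed.

End real_calculus.

Ltac derive_step := first
  [ eassumption
  | apply is_deriveC | apply is_deriveI
  | apply is_deriveD_fun | apply is_deriveN_fun
  | apply is_deriveX_fun | apply is_deriveM_fun
  | apply is_derive_sin_fun | apply is_derive_cos_fun
  | apply is_deriveV_fun ].
Ltac derive_tac := eapply is_derive_eq; [repeat derive_step|].

(** * Winding of contractible loops *)

Section winding.
Variable R : realType.

(** Composing with this retraction turns maps that are continuous only within the unit interval or
    square into globally continuous ones. *)
Definition clamp01 (t : R) := Num.max 0 (Num.min t 1).

Lemma clamp01_itv t : 0 <= clamp01 t <= 1.
Proof. by rewrite /clamp01 le_max lexx ge_max ler01 ge_min lexx orbT. Qed.

Lemma clamp01_id t : 0 <= t <= 1 -> clamp01 t = t.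
Proof.
by move=> /andP[t0 t1]; rewrite /clamp01 (min_idPl t1) (max_idPr t0).
Qed.

Lemma continuous_clamp01 : continuous clamp01.
Proof.
move=> t; have c0 : {for t, continuous (cst 0 : R -> R^o)} by exact: cvg_cst.
have c1 : {for t, continuous (cst 1 : R -> R^o)} by exact: cvg_cst.
have ci : {for t, continuous (id : R -> R^o)} by exact: cvg_id.
exact: (continuous_max c0 (continuous_min ci c1)).
Qed.

Lemma continuous_comp_within (T U V : topologicalType) (B : set U) (f : T -> U)
    (g : U -> V) : {within B, continuous g} -> continuous f ->
  (forall t, B (f t)) -> continuous (g \o f).
Proof.
move=> /subspace_continuousP cg cf fB t W /= nW.
have h : nbhs (f t) (fun y => B y -> W (g y)) by exact: (cg (f t) (fB t) W nW).
have h' : nbhs t (fun u => B (f u) -> W (g (f u))) by exact: (cf t _ h).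
by apply: filterS h' => u; apply; exact: fB.
Qed.

Lemma continuous_pair (T U V : topologicalType) (f : T -> U) (g : T -> V) :
  continuous f -> continuous g -> continuous (fun t => (f t, g t)).
Proof.
by move=> cf cg t; apply: cvg_pair; [exact: cf|exact: cg].
Qed.

Lemma polar_form (x z : R) : 0 < x ^+ 2 + z ^+ 2 ->
  exists a, exists2 rho, 0 < rho & x = rho * cos a /\ z = rho * sin a.
Proof.
move=> h; pose rho := Num.sqrt (x ^+ 2 + z ^+ 2).
have rho0 : 0 < rho by rewrite sqrtr_gt0.
have rhoE : rho ^+ 2 = x ^+ 2 + z ^+ 2 by rewrite sqr_sqrtr// ltW.
have xb : -1 <= x / rho <= 1.
  by rewrite ler_pdivlMr// ler_pdivrMr//; apply/andP; split; nra.
have cE : rho * cos (acos (x / rho)) = x.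
  by rewrite acosK ?in_itv//= mulrC divfK// gt_eqF.
have sE : (rho * sin (acos (x / rho))) ^+ 2 = z ^+ 2.
  have := cos2Dsin2 (acos (x / rho)) => cs.
  have : (rho * cos (acos (x / rho))) ^+ 2 + (rho * sin (acos (x / rho))) ^+ 2 = rho ^+ 2.
    by rewrite !exprMn -mulrDr cs mulr1.
  by rewrite cE rhoE => /addrI.
move/eqP: sE; rewrite eqf_sqr => /orP[|] /eqP sE.
  by exists (acos (x / rho)), rho.
by exists (- acos (x / rho)), rho => //; rewrite cosN sinN mulrN sE opprK cE.
Qed.

(** A continuous polar angle always exists for a loop that avoids the origin; [A 0 = A 1] is what
    says that the winding number is zero. *)
Definition angle_along (hx hz A : R -> R) := continuous A /\ A 0 = A 1 /\
  forall t, 0 <= t <= 1 -> exists2 rho, 0 < rho &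
    hx t = rho * cos (A t) /\ hz t = rho * sin (A t).

(** The inner product [d] is positive, so the oriented angle from [v] to [w] is the arctangent of
    the cross product [c] over [d]. It is continuous, and it vanishes at both ends, where [v] and
    [w] agree. *)
Lemma angle_along_step (vx vz wx wz A : R -> R) :
  continuous vx -> continuous vz -> continuous wx -> continuous wz ->
  (forall t, 0 < vx t * wx t + vz t * wz t) ->
  (forall t, t = 0 \/ t = 1 -> vx t = wx t /\ vz t = wz t) ->
  angle_along vx vz A -> exists A', angle_along wx wz A'.
Proof.
move=> cvx cvz cwx cwz pos e [cA [A01 hA]].
pose d t := vx t * wx t + vz t * wz t.
pose c t := vx t * wz t - vz t * wx t.
exists (fun t => A t + atan (c t / d t)); split; [|split].
- move=> t; apply: cvgD; first exact: cA.
  apply: continuous_comp; last exact: continuous_atan.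
  apply: cvgM; first apply: cvgB; first by apply: cvgM; [exact: cvx|exact: cwz].
    by apply: cvgM; [exact: cvz|exact: cwx].
  apply: cvgV; first by rewrite gt_eqF//; exact: pos.
  by apply: cvgD; apply: cvgM; [exact: cvx|exact: cwx|exact: cvz|exact: cwz].
- have c0 t : t = 0 \/ t = 1 -> c t = 0.
    by move=> /e[h1 h2]; rewrite /c h1 h2 mulrC subrr.
  by rewrite (c0 0 (or_introl erefl)) (c0 1 (or_intror erefl)) !mul0r A01.
move=> t /hA[rho rho0 [ex ez]].
set phi := atan _.
have cphi : 0 < cos phi.
  by apply: cos_gt0_pihalf; rewrite atan_gtNpi2 atan_ltpi2.
have sphi : sin phi = c t / d t * cos phi.
  by rewrite -[c t / d t]atanK -/phi /tan divfK// gt_eqF.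
have d0 : 0 < d t by exact: pos.
have dn : d t != 0 by rewrite gt_eqF.
have rn : rho != 0 by rewrite gt_eqF.
have cn : cos phi != 0 by rewrite gt_eqF.
(* [d t] is the product of the lengths of [v] and [w] and of [cos phi], so the witness is the length
   of [w]. *)
exists (d t / (rho * cos phi)); first by rewrite divr_gt0// mulr_gt0.
have cs := cos2Dsin2 (A t).
rewrite cosD sinD sphi; split.
  transitivity (wx t * (cos (A t) ^+ 2 + sin (A t) ^+ 2)); first by rewrite cs mulr1.
  have -> : d t / (rho * cos phi) * (cos (A t) * cos phi - sin (A t) * (c t / d t * cos phi))
      = (d t * cos (A t) - c t * sin (A t)) / rho by field; rewrite dn rn cn.
  by rewrite /d /c ex ez; field.
transitivity (wz t * (cos (A t) ^+ 2 + sin (A t) ^+ 2)); first by rewrite cs mulr1.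
have -> : d t / (rho * cos phi) * (sin (A t) * cos phi + cos (A t) * (c t / d t * cos phi))
      = (d t * sin (A t) + c t * cos (A t)) / rho by field; rewrite dn rn cn.
by rewrite /d /c ex ez; field.
Qed.

(** A Lebesgue number: the inner product of the vectors at [p] and [q] is positive on the diagonal,
    hence near it, and uniformly so because the square is compact. *)
Lemma uniform_acute (hx hz : R * R -> R) : continuous hx -> continuous hz ->
  (forall p, 0 < hx p ^+ 2 + hz p ^+ 2) ->
  exists2 e : R, 0 < e & forall p : R * R, (`[0, 1] `*` `[0, 1]) p ->
    forall q : R * R,
    ball p e q -> 0 < hx p * hx q + hz p * hz q.
Proof.
move=> cx cz pos.
have K : compact (`[0, 1] `*` `[0, 1] : set (R * R)).
  by apply: compact_setX; exact: segment_compact.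
move/compact_near_coveringP: K => K.
pose P (e : R) p := forall q, ball p e q -> 0 < hx p * hx q + hz p * hz q.
have KP : \forall e \near (0:R)^'+, `[0, 1] `*` `[0, 1] `<=` P e.
  apply: K.
  move=> x _.
  pose g (pq : (R * R) * (R * R)) := hx pq.1 * hx pq.2 + hz pq.1 * hz pq.2.
  have cg : {for (x, x), continuous g}.
    by apply: cvgD; apply: cvgM; apply: continuous_comp;
      (exact: cvg_fst || exact: cvg_snd || exact: cx || exact: cz).
  have g0 : 0 < g (x, x) by rewrite /g/= -!expr2.
  have := cg _ (lt_nbhsr g0).
  rewrite /fmap/= => -[[/= B1 B2] [/nbhs_ballP[r1 /= r10 hr1] /nbhs_ballP[r2 /= r20 hr2]] hB].
  exists (ball x (Num.min r1 (r2 / 2)), [set e : R | e <= r2 / 2]) => /=.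
    split; first by apply: nbhsx_ballx; rewrite lt_min r10/= divr_gt0.
    by apply: nbhs_right_le; rewrite divr_gt0.
  move=> [p e]/= [px er2] q pq.
  apply: (hB (p, q)); split => /=.
    by apply: hr1; apply: le_ball px; rewrite ge_min lexx.
  apply: hr2; have -> : r2 = r2 / 2 + r2 / 2 by rewrite -splitr.
  apply: (ball_triangle (y := p)); first by apply: le_ball px; rewrite ge_min lexx orbT.
  exact: le_ball pq.
near (0:R)^'+ => e; exists e => // p Kp.
have : `[0, 1] `*` `[0, 1] `<=` P e by near: e.
exact.
Unshelve. all: by end_near. Qed.

(* Along the homotopy, steps shorter than the uniform bound of [uniform_acute]
   keep the position vectors of successive loops at an acute angle, so an arctangent
   transports a continuous angle from the constant loop back to [a = 0]. *)
Lemma contraction_angle (hx hz : R * R -> R) (vx vz : R) :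
  continuous hx -> continuous hz ->
  (forall p, 0 < hx p ^+ 2 + hz p ^+ 2) ->
  (forall a t, a \in `[0, 1] -> t = 0 \/ t = 1 -> hx (a, t) = vx /\ hz (a, t) = vz) ->
  (forall t, hx (1, t) = vx /\ hz (1, t) = vz) ->
  (forall a t, hx (a, t) = hx (a, clamp01 t) /\ hz (a, t) = hz (a, clamp01 t)) ->
  exists A, angle_along (fun t => hx (0, t)) (fun t => hz (0, t)) A.
Proof.
move=> cx cz pos hend h1 hcl.
have [e e0 he] := uniform_acute cx cz pos.
have cpair a : continuous (fun t : R => (a, t) : R * R).
  exact: continuous_pair (fun t => cvg_cst a) (fun t => cvg_id).
pose Q a := exists A, angle_along (fun t => hx (a, t)) (fun t => hz (a, t)) A.
have Q1 : Q 1.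
  have := pos (1, 0); have [-> ->] := h1 0 => /polar_form[a [rho rho0 [ex ez]]].
  exists (cst a); split; first by move=> t; exact: cvg_cst.
  split=> // t _; exists rho => //.
  by have [-> ->] := h1 t.
have Qstep a b : 0 <= a <= 1 -> 0 <= b <= 1 -> `|a - b| < e -> Q a -> Q b.
  move=> ha hb ab [A hA].
  apply: (@angle_along_step (fun t => hx (a, t)) (fun t => hz (a, t))
          (fun t => hx (b, t)) (fun t => hz (b, t)) A) => //.
  - by move=> t; apply: continuous_comp; [exact: cpair|exact: cx].
  - by move=> t; apply: continuous_comp; [exact: cpair|exact: cz].
  - by move=> t; apply: continuous_comp; [exact: cpair|exact: cx].
  - by move=> t; apply: continuous_comp; [exact: cpair|exact: cz].
  - move=> t; have [-> ->] := hcl a t; have [-> ->] := hcl b t.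
    apply: he; first by split; rewrite /= in_itv/= ?clamp01_itv.
    by split => //; exact: ballxx.
  - move=> t ht; have [|-> ->] := @hend a t _ ht; first by rewrite in_itv.
    by have [|-> ->] := @hend b t _ ht; first by rewrite in_itv.
suff Qn (n : nat) : forall b, 0 <= b <= 1 -> 1 - b < n%:R * e -> Q b.
  have [n hn] : exists n : nat, 1 < n%:R * e.
    exists (Num.truncn (e^-1)).+1; rewrite -ltr_pdivrMr// div1r.
    have ei : 0 <= e^-1 by rewrite invr_ge0 ltW.
    by have /andP[] := truncn_itv ei.
  by apply: (Qn n); rewrite ?lexx ?ler01// subr0.
elim: n => [|n IH] b hb; first by rewrite mul0r; lra.
rewrite -[n.+1]addn1 natrD mulrDl mul1r => hbn.
have [bn|bn] := ltP (1 - b) (n%:R * e); first exact: IH.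
have ne0 : 0 <= n%:R * e by rewrite mulr_ge0// ltW.
case: n IH hbn bn ne0 => [|n] IH hbn bn ne0.
  by apply: (Qstep 1 b) Q1 => //; rewrite ?ler01 ?lexx// ger0_norm; lra.
(* The step has to exceed [1 - b - n.+1%:R * e] to reach the induction hypothesis and to stay below
   [e] for [Qstep]; it is the mean of these two bounds. *)
pose b' := b + (1 - b - n.+1%:R * e + e) / 2.
have n1 : e <= n.+1%:R * e by rewrite -[X in X <= _]mul1r ler_wpM2r ?ler1n ?ltW.
have hb' : 0 <= b' <= 1 by rewrite /b'; lra.
apply: (Qstep b' b) => //; last by apply: IH => //; rewrite /b'; lra.
by rewrite /b' addrC addKr ger0_norm; lra.
Qed.

(** The set [D] misses the whole line through [(px, pz)] parallel to the second axis, so the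
    projection of a contracting homotopy to the other two coordinates misses a point of the
    plane. *)
Lemma loop_winding (D : set (R3 R)) (c : R -> R3 R) (px pz : R) :
  loops_contractible D -> {within `[0, 1], continuous c} ->
  (forall t, t \in `[0, 1] -> D (c t)) -> c 0 = c 1 ->
  (forall p, D p -> p.1.1 = px -> p.2 = pz -> False) ->
  exists A, angle_along (fun t => (c t).1.1 - px) (fun t => (c t).2 - pz) A.
Proof.
move=> Dc cc cD c01 hp.
have [H [cH HD H0 H1 Hend]] := Dc c cc cD c01.
pose q (p : R * R) := (clamp01 p.1, clamp01 p.2).
have cq : continuous q.
  apply: continuous_pair => p; apply: continuous_comp;
    (exact: cvg_fst || exact: cvg_snd || exact: continuous_clamp01).
have qK p : (`[0, 1] `*` `[0, 1]) (q p) by split; rewrite /= in_itv/= clamp01_itv.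
have cHq : continuous (H \o q) by exact: continuous_comp_within cH cq qK.
have cl t : clamp01 t \in `[0, 1] by rewrite in_itv/= clamp01_itv.
have [||||||A hA] := @contraction_angle (fun p => (H (q p)).1.1 - px)
    (fun p => (H (q p)).2 - pz) ((c 0).1.1 - px) ((c 0).2 - pz).
- move=> p; apply: cvgB; last exact: cvg_cst.
  apply: (@cvg_comp _ _ _ (H \o q) (fun v : R3 R => v.1.1)); first exact: cHq.
  by apply: (@continuous_comp _ _ _ fst fst); [exact: cvg_fst|exact: cvg_fst].
- move=> p; apply: cvgB; last exact: cvg_cst.
  apply: (@cvg_comp _ _ _ (H \o q) (fun v : R3 R => v.2)); first exact: cHq.
  exact: cvg_snd.
- move=> p; rewrite lt_neqAle addr_ge0 ?sqr_ge0// andbT eq_sym.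
  apply/negP; rewrite paddr_eq0 ?sqr_ge0// !sqrf_eq0 !subr_eq0 => /andP[/eqP ex /eqP ez].
  by apply: (hp (H (q p))) => //; apply: HD.
- move=> a t ha ht; rewrite /q/=.
  have [h0 h1] := Hend a ha.
  rewrite (clamp01_id ha).
  by case: ht => ->; rewrite clamp01_id ?lexx ?ler01// ?h0 ?h1.
- by move=> t; rewrite /q/= (@clamp01_id 1) ?ler01 ?lexx// H1.
- by move=> a t; rewrite /q/= (@clamp01_id (clamp01 t)) ?clamp01_itv.
exists A; case: hA => cA [A01 hA]; split=> //; split=> // t ht.
have [rho rho0] := hA t ht; rewrite /q/= (@clamp01_id 0) ?ler01 ?lexx// clamp01_id//.
by rewrite H0 ?in_itv//; exists rho.
Qed.
End winding.

(** * Injectivity of the normal coordinates *)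

Section tube_geometry.
Variables (R : realType) (X Z th k dk : R -> R) (L delta : R).
Hypotheses (L_gt0 : 0 < L) (delta_gt0 : 0 < delta).
Hypothesis dX : forall s : R, 0 <= s <= L -> is_derive s 1 X (cos (th s)).
Hypothesis dZ : forall s : R, 0 <= s <= L -> is_derive s 1 Z (sin (th s)).
Hypothesis dth : forall s : R, 0 <= s <= L -> is_derive s 1 th (k s).
Hypothesis dk_k : forall s : R, 0 <= s <= L -> is_derive s 1 k (dk s).
Hypothesis k_mono : forall s t : R, 0 <= s -> s <= t -> t <= L / 2 -> k s <= k t.
Hypothesis dk_ge0 : forall s : R, 0 < s < L / 2 -> 0 <= dk s.
Hypothesis th_mid : th (L / 2) = 0.
Hypothesis X_mid : X (L / 2) = 0.
Hypothesis X_lt0 : forall s : R, 0 <= s < L / 2 -> X s < 0.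
Hypothesis Jd_gt0 : forall s : R, 0 <= s <= L -> 0 < 1 + delta * k s.

Definition tubeX s r := X s + r * sin (th s).
Definition tubeZ s r := Z s - r * cos (th s).

Lemma jacobian_gt0 s r : 0 <= s <= L -> 0 <= r <= delta -> 0 < 1 + r * k s.
Proof.
move=> hs /andP[r0 rd]; have := Jd_gt0 hs.
by have [k0|k0] := leP 0 (k s); nra.
Qed.

(** The quantity [sin (th s) - c * X s] is constant on a circle of curvature [c]. In the
    applications [c] is the curvature where [cos (th s)] changes sign; as [k] is monotone, both
    factors of the derivative then change sign together. *)
Lemma pendulum_mono (c a b : R) : 0 <= a -> a <= b -> b <= L ->
  (forall s, a < s < b -> 0 <= (k s - c) * cos (th s)) ->
  - c * X a + sin (th a) <= - c * X b + sin (th b).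
Proof.
move=> a0 ab bL h.
apply: (@derive_ndecr R (fun s => - c * X s + sin (th s))
  (fun s => (k s - c) * cos (th s)) a b) => // s hs.
have hs' : 0 <= s <= L by lra.
have d1 := dX hs'; have d2 := dth hs'.
by derive_tac; rewrite /=; ring.
Qed.

Lemma th_cont a b : 0 <= a -> b <= L -> {within `[a, b], continuous th}.
Proof. by move=> a0 bL; apply: (@is_derive_within R th k) => s hs; apply: dth; lra. Qed.

Lemma th_ndecr a b : 0 <= a -> a <= b -> b <= L ->
  (forall s, a < s < b -> 0 <= k s) -> th a <= th b.
Proof.
move=> a0 ab bL h; apply: (@derive_ndecr R th k) => // s hs.
by apply: dth; lra.
Qed.

Lemma th_nincr a b : 0 <= a -> a <= b -> b <= L ->
  (forall s, a < s < b -> k s <= 0) -> th b <= th a.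
Proof.
move=> a0 ab bL h; rewrite -lerN2.
apply: (@derive_ndecr R (fun s => - th s) (fun s => - k s)) => // s hs.
  have hs' : 0 <= s <= L by lra.
  by have d1 := dth hs'; derive_tac.
by rewrite oppr_ge0; apply: h.
Qed.

(** Otherwise the angle is [- pi] at some [a] and [- pi / 2] at a later [b]; [pendulum_mono] with
    the curvature at [b] then gives [0 <= k b * X a], while [X a < 0]. *)
Lemma th_gtNpi s : 0 <= s <= L / 2 -> (s < L / 2 -> 0 <= k s) -> - pi < th s.
Proof.
move=> /andP[s0 sL] ks; have pi0 := pi_gt0 R.
move: sL; rewrite le_eqVlt => /predU1P[->|sL]; first by rewrite th_mid; lra.
rewrite ltNge; apply/negP => ths.
have {}ks := ks sL.
have mono a b : s <= a -> a <= b -> b <= L / 2 -> th a <= th b.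
  move=> sa ab bL; apply: th_ndecr; [lra|lra|lra|move=> t tab].
  by apply: le_trans ks _; apply: k_mono; lra.
have [||a /andP[sa aL] tha] := @IVT_itv R th s (L / 2) (- pi) (ltW sL).
- by apply: th_cont; lra.
- by left; rewrite th_mid; lra.
have [||b /andP[ab bL] thb] := @IVT_itv R th a (L / 2) (- (pi / 2)) aL.
- by apply: th_cont; lra.
- by left; rewrite th_mid tha; lra.
have aL' : a < L / 2.
  by move: aL; rewrite le_eqVlt => /predU1P[ae|//]; move: tha; rewrite ae th_mid; lra.
have kb0 : 0 <= k b by apply: le_trans ks _; apply: k_mono; lra.
have := @pendulum_mono (k b) a (L / 2) _ _ _ _.
rewrite th_mid X_mid sin0 tha sinN sinpi.
have Xa : X a < 0 by apply: X_lt0; lra.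
have H : forall t, a < t < L / 2 -> 0 <= (k t - k b) * cos (th t).
  move=> t /andP[at_ tL]; have [tb|bt] := leP t b.
  - have tha' : - pi <= th t by rewrite -tha; apply: mono; lra.
    have thb' : th t <= - (pi / 2) by rewrite -thb; apply: mono; lra.
    have kt : k t <= k b by apply: k_mono; lra.
    have : cos (th t) <= 0.
      rewrite -[th t]opprK cosN -[- th t](subrK pi) cosDpi oppr_le0.
      by apply: cos_ge0_pihalf; lra.
    by nra.
  - have thb' : - (pi / 2) <= th t by rewrite -thb; apply: mono; lra.
    have tha' : th t <= 0 by rewrite -th_mid; apply: mono; lra.
    have kt : k b <= k t by apply: k_mono; lra.
    have : 0 <= cos (th t) by apply: cos_ge0_pihalf; lra.
    by nra.
move=> /(_ _ _ _ H) h; have {h} h := h ltac:(lra) ltac:(lra) ltac:(lra).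
(* The borderline case: if [k b = 0] then [k <= 0] before [b], and the angle cannot rise from [- pi]
   to [- pi / 2]. *)
have kbE : k b = 0 by nra.
have : th b <= th a.
  apply: th_nincr => [||| t tab]; [lra|lra|lra|].
  by rewrite -kbE; apply: k_mono; lra.
by rewrite tha thb; lra.
Qed.

(* [q s] is half the curvature times the power of [(px, pz)] with respect to the
   osculating circle of the offset curve at [s], so zero curvature is allowed. *)
Lemma kneser (e px pz a b : R) : 0 <= e <= delta -> 0 <= a -> a <= b -> b <= L / 2 ->
  let q (s : R) := k s / (1 + e * k s) / 2 *
               ((px - tubeX s e) ^+ 2 + (pz - tubeZ s e) ^+ 2) +
             ((px - tubeX s e) * sin (th s) - (pz - tubeZ s e) * cos (th s)) in
  is_true (q a <= q b).
Proof.
move=> he a0 ab bL q.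
(* The factor [dk s / (1 + e * k s) ^+ 2] is the derivative of the curvature of the offset curve;
   the terms from the moving point and from the rotating frame cancel. *)
apply: (@derive_ndecr R q (fun s => dk s / (1 + e * k s) ^+ 2 / 2 *
               ((px - tubeX s e) ^+ 2 + (pz - tubeZ s e) ^+ 2))) => // s hs.
  have hs' : 0 <= s <= L by lra.
  have J0 := jacobian_gt0 hs' he.
  have d1 := dX hs'; have d2 := dth hs'; have d3 := dZ hs'; have d4 := dk_k hs'.
  rewrite /q /tubeX /tubeZ; derive_tac; first by rewrite gt_eqF.
  have J1 : 1 + e * k s != 0 by rewrite gt_eqF.
  by field.
have hs' : 0 <= s <= L by lra.
have J0 := jacobian_gt0 hs' he.
have := @dk_ge0 s ltac:(lra) => dk0.
apply: mulr_ge0; last by rewrite addr_ge0 ?sqr_ge0.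
by rewrite !divr_ge0 ?exprn_ge0 ?(ltW J0).
Qed.

Lemma sin_gt0_lobe (w : R) : 0 < w -> 0 < sin w ->
  exists n : nat, pi *+ 2 *+ n < w < pi *+ 2 *+ n + pi.
Proof.
move=> w0 sw; have pi0 := pi_gt0 R.
have p2 : 0 < pi *+ 2 :> R by rewrite mulrn_wgt0.
have w20 : 0 <= w / (pi *+ 2) by rewrite divr_ge0 ?ltW.
set n := Num.trunc (w / (pi *+ 2)).
have /andP[h1 h2] : n%:R <= w / (pi *+ 2) < n.+1%:R.
  by rewrite /n truncn_itv.
rewrite ler_pdivlMr// mulr_natl in h1.
rewrite ltr_pdivrMr// mulr_natl mulrS in h2.
exists n.
have sE : sin (w - pi *+ 2 *+ n) = sin w.
  by rewrite -[in RHS](subrK (pi *+ 2 *+ n) w) (periodicn (@sinD2pi R)).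
set y := w - pi *+ 2 *+ n in sE.
have y0 : y != 0 by apply: contraTneq sw => y0; rewrite -sE y0 sin0 ltxx.
have y1 : 0 <= y by rewrite subr_ge0.
have y2 : y < pi.
  rewrite ltNge; apply/negP => py.
  have : 0 <= sin (y - pi).
    by apply: sin_ge0_pi; rewrite subr_ge0 py /= lerBlDl -mulr2n ltW// ltrBlDr.
  by rewrite -[y in sin y](subrK pi) sinDpi in sE; rewrite -sE in sw; lra.
have {}y0 : 0 < y by rewrite lt_neqAle eq_sym y0.
by rewrite -subr_gt0 -/y y0 /= -ltrBlDl.
Qed.

(** * The spiral before [s0], of curvature at most zero, and the arc after it *)

Variable s0 : R.
Hypothesis s0_bd : 0 <= s0 <= L / 2.
Hypothesis k_le0 : forall s : R, k 0 < 0 -> 0 <= s <= s0 -> k s <= 0.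
Hypothesis k_ge0 : forall s, s0 <= s < L / 2 -> 0 <= k s.
Hypothesis s0_case : (k 0 < 0) || (s0 == 0).

Lemma th_arc s : s0 <= s <= L / 2 -> - pi < th s.
Proof.
have L0 := L_gt0; have d0 := delta_gt0; have sb := s0_bd.
by move=> h; apply: th_gtNpi => [|sL]; [lra|apply: k_ge0; lra]. Qed.

Lemma th_arc_ndecr s t : s0 <= s -> s <= t -> t <= L / 2 -> th s <= th t.
Proof.
have L0 := L_gt0; have d0 := delta_gt0; have sb := s0_bd.
move=> h1 h2 h3; apply: th_ndecr => [|||u hu]; [lra|lra|lra|].
by apply: k_ge0; lra.
Qed.

Lemma th_arc_le0 s : s0 <= s <= L / 2 -> th s <= 0.
Proof.
have L0 := L_gt0; have d0 := delta_gt0; have sb := s0_bd.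
by move=> /andP[h1 h2]; rewrite -th_mid; apply: th_arc_ndecr; lra. Qed.

Lemma th_spiral_nincr (s t : R) : k 0 < 0 -> 0 <= s -> s <= t -> t <= s0 -> th t <= th s.
Proof.
have L0 := L_gt0; have d0 := delta_gt0; have sb := s0_bd.
move=> k0 h1 h2 h3; apply: th_nincr => [|||u hu]; [lra|lra|lra|].
by apply: k_le0 => //; lra.
Qed.

Lemma sin_le0_Npi (w : R) : - pi <= w <= 0 -> sin w <= 0.
Proof.
have L0 := L_gt0; have d0 := delta_gt0; have sb := s0_bd.
by move=> h; rewrite -[w]opprK sinN oppr_le0; apply: sin_ge0_pi; lra. Qed.

(** Divided by [- c > 0], the last inequality says that the circle of curvature [c] tangent at [s]
    has its centre in [X <= 0]. It comes from [pendulum_mono] between [s] and the point [a] where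
    the spiral has unwound to a multiple of a full turn, since [X a <= 0]. *)
Lemma lobe (s : R) : 0 <= s < L / 2 -> 0 < sin (th s) ->
  s < s0 /\ exists c, [/\ k s <= c, c < 0 & - c * X s + sin (th s) <= 0].
Proof.
have L0 := L_gt0; have d0 := delta_gt0; have sb := s0_bd.
move=> hs ss; have pi0 := pi_gt0 R.
have ss0 : s < s0.
  rewrite ltNge; apply/negP => h.
  have := @sin_le0_Npi (th s); have := @th_arc s ltac:(lra).
  by have := @th_arc_le0 s ltac:(lra); lra.
have k0 : k 0 < 0 by case/orP: s0_case => // /eqP; lra.
split=> //.
have ths : 0 < th s.
  rewrite ltNge; apply/negP => h.
  have h1 := @th_spiral_nincr s s0 k0 ltac:(lra) ltac:(lra) (lexx _).
  have h2 := @th_arc s0 ltac:(lra).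
  by have := @sin_le0_Npi (th s); lra.
have [n /andP[n1 n2]] := sin_gt0_lobe ths ss.
set base := pi *+ 2 *+ n in n1 n2.
have base0 : 0 <= base by rewrite /base mulrn_wge0// mulrn_wge0// ltW.
have cosb y : cos (y + base) = cos y by rewrite (periodicn (@cosD2pi R)).
have [||a /andP[sa as0] tha] := @IVT_itv R th s s0 base (ltW ss0).
- by apply: th_cont; lra.
- by right; have := @th_arc_le0 s0 ltac:(lra); lra.
have sa' : s < a.
  by rewrite lt_neqAle sa andbT; apply: contraTneq n1 => ->; rewrite tha ltxx.
have mono u v : s <= u -> u <= v -> v <= a -> th v <= th u.
  by move=> ? ? ?; apply: th_spiral_nincr => //; lra.
(* [b] is where the tangent becomes vertical, or [s] itself when that direction is already passed;
   either way the cosine is nonpositive before [b] and nonnegative after it. *)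
have [b /andP[shb ba] [hb1 hb2]] : exists2 b, s <= b <= a &
   (forall t, s < t < b -> base + pi / 2 <= th t) /\
   (forall t, b < t < a -> th t <= base + pi / 2).
  have [h|h] := leP (base + pi / 2) (th s).
    have [||b /andP[shb ba] thb] := @IVT_itv R th s a (base + pi / 2) sa.
    - by apply: th_cont; lra.
    - by right; rewrite tha; lra.
    exists b; first by lra.
    by split=> t ht; rewrite -thb; apply: mono; lra.
  exists s; first by lra.
  split=> t ht; first by lra.
  by have := @mono s t ltac:(lra) ltac:(lra) ltac:(lra); lra.
have kb0 : k b <= 0 by apply: k_le0 => //; lra.
have Xa : X a <= 0.
  have [aL|aL] := ltP a (L / 2); first by apply/ltW/X_lt0; lra.
  by rewrite (_ : a = L / 2) ?X_mid//; lra.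
have := @pendulum_mono (k b) s a ltac:(lra) sa ltac:(lra).
have H : forall t, s < t < a -> 0 <= (k t - k b) * cos (th t).
  move=> t /andP[st ta].
  have t1 := @mono s t ltac:(lra) ltac:(lra) ltac:(lra).
  have t2 := @mono t a ltac:(lra) ltac:(lra) ltac:(lra).
  have [tb|bt|->] := ltgtP t b; last by rewrite subrr mul0r.
  - have h1 := hb1 t ltac:(lra).
    have kt : k t <= k b by apply: k_mono; lra.
    have : cos (th t) <= 0.
      rewrite -[th t](subrK base) cosb -[_ - _](subrK pi) cosDpi oppr_le0.
      by apply: cos_ge0_pihalf; lra.
    by nra.
  - have h1 := hb2 t ltac:(lra).
    have kt : k b <= k t by apply: k_mono; lra.
    have : 0 <= cos (th t).
      by rewrite -[th t](subrK base) cosb; apply: cos_ge0_pihalf; lra.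
    by nra.
move=> /(_ H); rewrite tha -[base]add0r (periodicn (@sinD2pi R)) sin0 => h.
exists (k b); split.
- by apply: k_mono; lra.
- by rewrite lt_neqAle kb0 andbT; apply/eqP => e; rewrite e in h; lra.
- by nra.
Qed.

(** With its mirror image this puts the two halves of the strip on opposite sides of [X = 0], so an
    overlap can only occur inside one half. Where the normal points to the right, [lobe] gives a
    centre with [X <= 0] that the offset [r] does not reach. *)
Lemma tubeX_lt0 (s r : R) : 0 <= s < L / 2 -> 0 <= r <= delta -> tubeX s r < 0.
Proof.
have L0 := L_gt0; have d0 := delta_gt0; have sb := s0_bd.
move=> hs hr; have Xs := X_lt0 hs; rewrite /tubeX.
have [ss|ss] := leP (sin (th s)) 0; first by nra.
have [_ [c [kc c0 h]]] := lobe hs ss.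
have J0 := @jacobian_gt0 s r ltac:(lra) hr.
have J1 : 0 < 1 + r * c by nra.
have : 0 < sin (th s) * (1 + r * c) by rewrite mulr_gt0.
by nra.
Qed.

Section hole.
Hypothesis k0_lt0 : k 0 < 0.
(* The centre of curvature at the end [s = 0]. *)
Definition eyeX := X 0 - (k 0)^-1 * sin (th 0).
Definition eyeZ := Z 0 + (k 0)^-1 * cos (th 0).

Lemma delta_lt_radius : delta < - (k 0)^-1.
Proof.
have k0 := k0_lt0.
have L0 := L_gt0; have d0 := delta_gt0; have sb := s0_bd.
have J0 := @Jd_gt0 0 ltac:(lra).
have : delta * - k 0 < 1 by lra.
by rewrite -ltr_pdivlMr ?oppr_gt0// div1r invrN.
Qed.

Lemma eyeX_le0 : eyeX <= 0.
Proof.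
have k0 := k0_lt0.
have L0 := L_gt0; have d0 := delta_gt0; have sb := s0_bd.
have Xs := @X_lt0 0 ltac:(lra); rewrite /eyeX.
have i0 : (k 0)^-1 < 0 by rewrite invr_lt0.
have [ss|ss] := leP (sin (th 0)) 0; first by nra.
have [_ [c [kc c0 h]]] := @lobe 0 ltac:(lra) ss.
have : (- k 0) * (X 0 - (k 0)^-1 * sin (th 0)) = - k 0 * X 0 + sin (th 0).
  by field; rewrite lt_eqF.
by nra.
Qed.

(** Apply [kneser] to the offset curve at distance [delta]. For the eye its quantity at [0] is half
    of the end's radius of curvature minus [delta], which is positive; at [s] the quadratic term is
    nonpositive because [k s <= 0], so the normal component alone has to be large. *)
Lemma eye_spiral (s : R) : 0 <= s <= s0 ->
  delta < (eyeX - X s) * sin (th s) - (eyeZ - Z s) * cos (th s).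
Proof.
have L0 := L_gt0; have d0 := delta_gt0; have sb := s0_bd.
move=> hs; have dr := delta_lt_radius.
have J0 := @Jd_gt0 0 ltac:(lra).
have Js := @Jd_gt0 s ltac:(lra).
have ks : k s <= 0 by apply: k_le0.
have := @kneser delta eyeX eyeZ 0 s ltac:(lra) ltac:(lra) ltac:(lra) ltac:(lra).
have cs := cos2Dsin2 (th 0).
have cs' := cos2Dsin2 (th s).
rewrite /=; set b := (X in _ -> _ < X).
have k00 : k 0 != 0 by rewrite lt_eqF.
have J00 : 1 + delta * k 0 != 0 by rewrite gt_eqF.
have -> : k 0 / (1 + delta * k 0) / 2 * ((eyeX - tubeX 0 delta) ^+ 2 +
    (eyeZ - tubeZ 0 delta) ^+ 2) + ((eyeX - tubeX 0 delta) * sin (th 0) -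
    (eyeZ - tubeZ 0 delta) * cos (th 0)) = (- (k 0)^-1 - delta) / 2.
  rewrite /eyeX /eyeZ /tubeX /tubeZ.
  transitivity ((- (k 0)^-1 - delta) / 2 * (cos (th 0) ^+ 2 + sin (th 0) ^+ 2)).
    by field; rewrite J00 k00.
  by rewrite cs mulr1.
have -> : (eyeX - tubeX s delta) * sin (th s) - (eyeZ - tubeZ s delta) * cos (th s)
     = b - delta.
  transitivity (b - delta * (cos (th s) ^+ 2 + sin (th s) ^+ 2)).
    by rewrite /b /tubeX /tubeZ; ring.
  by rewrite cs' mulr1.
set w := (_ ^+ 2 + _).
have w0 : 0 <= w by rewrite addr_ge0 ?sqr_ge0.
have : k s / (1 + delta * k s) / 2 * w <= 0.
  by rewrite mulr_le0_ge0// mulr_le0_ge0// mulr_le0_ge0 ?invr_ge0// ltW.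
by lra.
Qed.
End hole.

(** The angle on the arc exceeds [th s0] by less than [pi], so the arc never crosses back over the
    tangent line at [s0]. *)
Lemma arc_below s : s0 <= s <= L / 2 ->
  (X s - X s0) * sin (th s0) - (Z s - Z s0) * cos (th s0) <= 0.
Proof.
have L0 := L_gt0; have d0 := delta_gt0; have sb := s0_bd.
move=> /andP[h1 h2].
have := @derive_ndecr R (fun t => - ((X t - X s0) * sin (th s0) - (Z t - Z s0) * cos (th s0)))
  (fun t => sin (th t - th s0)) s0 s.
rewrite /= !subrr !mul0r subrr oppr0 oppr_ge0; apply => //.
- move=> t ht; have ht' : 0 <= t <= L by lra.
  have d1 := dX ht'; have d2 := dZ ht'; derive_tac.
  by rewrite sinB; ring.
- move=> t ht; apply: sin_ge0_pi.
  have t1 := @th_arc_le0 t ltac:(lra).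
  have t2 := @th_arc s0 ltac:(lra).
  have t3 := @th_arc_ndecr s0 t ltac:(lra) ltac:(lra) ltac:(lra).
  by lra.
Qed.

(** Together with [arc_below], the tangent line at [s0] separates the strip over the spiral from the
    arc. The quantity of [kneser] for [e = 0] is [r * (1 + r * k s / 2)] at the foot [s], and at
    [s0] its quadratic term is nonpositive. *)
Lemma spiral_above s r : 0 <= s <= s0 -> 0 < r <= delta -> k 0 < 0 ->
  0 < (tubeX s r - X s0) * sin (th s0) - (tubeZ s r - Z s0) * cos (th s0).
Proof.
have L0 := L_gt0; have d0 := delta_gt0; have sb := s0_bd.
move=> hs hr k0.
have J0 := @jacobian_gt0 s r ltac:(lra) ltac:(lra).
have ks0 : k s0 <= 0 by apply: k_le0 => //; lra.
have := @kneser 0 (tubeX s r) (tubeZ s r) s s0 ltac:(lra) ltac:(lra) ltac:(lra) ltac:(lra).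
have cs := cos2Dsin2 (th s).
rewrite /= !mul0r !addr0 !divr1 /tubeX /tubeZ !mul0r !addr0 !subr0.
have -> : k s / 2 * ((X s + r * sin (th s) - X s) ^+ 2 +
    (Z s - r * cos (th s) - Z s) ^+ 2) +
    ((X s + r * sin (th s) - X s) * sin (th s) -
     (Z s - r * cos (th s) - Z s) * cos (th s)) = r * (1 + r * k s / 2).
  transitivity ((r * (1 + r * k s / 2)) * (cos (th s) ^+ 2 + sin (th s) ^+ 2)).
    by field.
  by rewrite cs mulr1.
set w := (_ ^+ 2 + _).
have w0 : 0 <= w by rewrite addr_ge0 ?sqr_ge0.
have : k s0 / 2 * w <= 0 by rewrite mulr_le0_ge0//; lra.
have : 0 < r * (1 + r * k s / 2) by rewrite mulr_gt0//; lra.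
by lra.
Qed.

(** * Overlaps of the strip and winding around the eye *)

Hypothesis symX : forall s : R, 0 <= s <= L -> X (L - s) = - X s.
Hypothesis symZ : forall s : R, 0 <= s <= L -> Z (L - s) = Z s.
Hypothesis symth : forall s : R, 0 <= s <= L -> th (L - s) = - th s.
Hypothesis loop_lift : forall px pz : R,
  (forall s r : R, 0 < s < L -> 0 < r < delta ->
     tubeX s r = px -> tubeZ s r = pz -> False) ->
  forall s1 r1 s2 r2 : R, 0 < s1 < L -> 0 < r1 < delta ->
    0 < s2 < L -> 0 < r2 < delta ->
    tubeX s1 r1 = tubeX s2 r2 -> tubeZ s1 r1 = tubeZ s2 r2 ->
  exists A : R -> R, [/\ {within `[0, 1], continuous A}, A 0 = A 1 &
    forall t : R, 0 <= t <= 1 -> exists2 rho : R, 0 < rho &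
      tubeX (s1 + t * (s2 - s1)) (r1 + t * (r2 - r1)) - px = rho * cos (A t) /\
      tubeZ (s1 + t * (s2 - s1)) (r1 + t * (r2 - r1)) - pz = rho * sin (A t)].

Lemma tube_symX s r : 0 <= s <= L -> tubeX (L - s) r = - tubeX s r.
Proof. by move=> hs; rewrite /tubeX symX// symth// sinN; ring. Qed.

Lemma tube_symZ s r : 0 <= s <= L -> tubeZ (L - s) r = tubeZ s r.
Proof. by move=> hs; rewrite /tubeZ symZ// symth// cosN. Qed.

Lemma tube_inj_r s r1 r2 :
  tubeX s r1 = tubeX s r2 -> tubeZ s r1 = tubeZ s r2 -> r1 = r2.
Proof.
rewrite /tubeX /tubeZ => /addrI h1 /addrI /oppr_inj h2.
have := cos2Dsin2 (th s).
move: (cos (th s)) (sin (th s)) h1 h2 => c d h1 h2 cd.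
have -> : r1 = r1 * c * c + r1 * d * d by rewrite -[LHS]mulr1 -cd; ring.
by rewrite h1 h2 -[RHS]mulr1 -cd; ring.
Qed.

(** Measure along the direction of angle [m]. For fixed [r] this coordinate increases with [s], as
    every tangent is within a quarter turn of [m]. Changing [r] moves it in opposite directions at
    the two ends because [m] lies between the end angles, so one order of the two moves always gives
    a strict increase. *)
Lemma narrow_disjoint (m s1 r1 s2 r2 : R) : 0 <= s1 -> s1 < s2 -> s2 <= L ->
  0 <= r1 <= delta -> 0 <= r2 <= delta ->
  (forall t, s1 <= t <= s2 -> - (pi / 2) < th t - m < pi / 2) ->
  (th s1 <= m <= th s2) || (th s2 <= m <= th s1) ->
  tubeX s1 r1 = tubeX s2 r2 -> tubeZ s1 r1 = tubeZ s2 r2 -> False.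
Proof.
move=> s10 s12 s2L hr1 hr2 hm hm12 eX eZ.
pose d s r := tubeX s r * cos m + tubeZ s r * sin m.
have incr r : 0 <= r <= delta -> d s1 r < d s2 r.
  move=> hr; apply: (@derive_incr R (d ^~ r)
    (fun s => (1 + r * k s) * cos (th s - m))) => // t ht.
    have ht' : 0 <= t <= L by lra.
    have d1 := dX ht'; have d2 := dZ ht'; have d3 := dth ht'.
    rewrite /d /tubeX /tubeZ; derive_tac.
    by rewrite cosB; ring.
  rewrite mulr_gt0//; first by apply: jacobian_gt0; lra.
  by apply: cos_gt0_pihalf; apply: hm; lra.
have dr s r r' : d s r' - d s r = (r' - r) * sin (th s - m).
  by rewrite sinB /d /tubeX /tubeZ; ring.
have e : d s1 r1 = d s2 r2 by rewrite /d eX eZ.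
have sin_sg s : s1 <= s <= s2 ->
    (0 <= th s - m -> 0 <= sin (th s - m)) /\ (th s - m <= 0 -> sin (th s - m) <= 0).
  move=> /hm h; split=> h'; first by apply: sin_ge0_pi; lra.
  by apply: sin_le0_Npi; lra.
have [p1 n1] := @sin_sg s1 ltac:(lra).
have [p2 n2] := @sin_sg s2 ltac:(lra).
have i1 := incr _ hr1; have i2 := incr _ hr2.
have e1 := dr s1 r1 r2; have e2 := dr s2 r1 r2.
case/orP: hm12 => /andP[h1 h2].
  have {n1 p1}n1 := n1 ltac:(lra); have {n2 p2}p2 := p2 ltac:(lra).
  by have [rr|rr] := leP r1 r2; nra.
have {n1 p1}p1 := p1 ltac:(lra); have {n2 p2}n2 := n2 ltac:(lra).
by have [rr|rr] := leP r1 r2; nra.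
Qed.

(** In polar coordinates about the eye, with angle [A], this reads [0 < sin (A - th')], so the
    tangent angle controls the polar angle up to half a turn. Past [s0] the direction is frozen,
    which [arc_below] permits. *)
Lemma eye_side s r : k 0 < 0 -> 0 <= s <= L / 2 -> 0 <= r <= delta ->
  let th' := th (Num.min s s0) in
  (tubeX s r - eyeX) * sin th' - (tubeZ s r - eyeZ) * cos th' < 0.
Proof.
have L0 := L_gt0; have d0 := delta_gt0; have sb := s0_bd.
move=> k0 hs hr; have [ss|ss] := leP s s0 => /=.
  have h := @eye_spiral k0 s ltac:(lra).
  have cs := cos2Dsin2 (th s).
  have -> : (tubeX s r - eyeX) * sin (th s) - (tubeZ s r - eyeZ) * cos (th s) =
      r * (cos (th s) ^+ 2 + sin (th s) ^+ 2) -
      ((eyeX - X s) * sin (th s) - (eyeZ - Z s) * cos (th s)).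
    by rewrite /tubeX /tubeZ; ring.
  by rewrite cs; lra.
have h := @eye_spiral k0 s0 ltac:(lra).
have h' := @arc_below s ltac:(lra).
have -> : (tubeX s r - eyeX) * sin (th s0) - (tubeZ s r - eyeZ) * cos (th s0) =
    r * cos (th s - th s0) + ((X s - X s0) * sin (th s0) - (Z s - Z s0) * cos (th s0))
    - ((eyeX - X s0) * sin (th s0) - (eyeZ - Z s0) * cos (th s0)).
  by rewrite cosB /tubeX /tubeZ; ring.
have := cos_le1 (th s - th s0).
by move: hr => /andP[hr1 hr2] c1; nra.
Qed.

(** [eye_side] excludes the left half; the right half lies in [X > 0] by symmetry, and the eye does
    not. *)
Lemma eye_hole s r : k 0 < 0 -> 0 < s < L -> 0 < r < delta ->
  tubeX s r = eyeX -> tubeZ s r = eyeZ -> False.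
Proof.
have L0 := L_gt0; have d0 := delta_gt0; have sb := s0_bd.
move=> k0 hs hr eX eZ; have [sL|sL] := leP s (L / 2).
  have := @eye_side s r k0 ltac:(lra) ltac:(lra).
  by rewrite /= eX eZ !subrr !mul0r subrr ltxx.
have := @tubeX_lt0 (L - s) r ltac:(lra) ltac:(lra).
rewrite tube_symX; last lra.
by rewrite eX; have := eyeX_le0 k0; lra.
Qed.

Lemma cont_th (s : R) : 0 <= s <= L -> {for s, continuous th}.
Proof.
by move=> /dth [h _]; apply: differentiable_continuous; apply/derivable1_diffP.
Qed.

(** Along the loop the polar angle about the eye minus the tangent angle keeps a positive sine,
    hence stays in one interval of length [pi]. The polar angle returns to its initial value, so the
    two tangent angles differ by less than [pi]. *)
Lemma angle_close (s1 r1 s2 r2 : R) : k 0 < 0 ->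
  0 < s1 <= L / 2 -> 0 < r1 < delta -> 0 < s2 <= L / 2 -> 0 < r2 < delta ->
  tubeX s1 r1 = tubeX s2 r2 -> tubeZ s1 r1 = tubeZ s2 r2 ->
  - pi < th (Num.min s1 s0) - th (Num.min s2 s0) < pi.
Proof.
have L0 := L_gt0; have d0 := delta_gt0; have sb := s0_bd.
move=> k0 hs1 hr1 hs2 hr2 eX eZ.
have [|||A [cA A01 hA]] := @loop_lift eyeX eyeZ _ s1 r1 s2 r2 _ hr1 _ hr2 eX eZ.
- by move=> s r hs hr; exact: eye_hole.
- lra.
- lra.
pose P t := s1 + t * (s2 - s1).
pose D t := A t - th (Num.min (P t) s0).
have hP t : 0 <= t <= 1 -> 0 <= P t <= L / 2 by move=> ht; rewrite /P; nra.
have hr t : 0 <= t <= 1 -> 0 <= r1 + t * (r2 - r1) <= delta by move=> ht; nra.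
have sD t : 0 <= t <= 1 -> 0 < sin (D t).
  move=> ht; have [rho rho0 [eA1 eA2]] := hA t ht.
  have := @eye_side (P t) (r1 + t * (r2 - r1)) k0 (hP t ht) (hr t ht).
  rewrite /= eA1 eA2 => h.
  have : 0 < rho * sin (D t) by rewrite /D sinB; lra.
  by rewrite pmulr_rgt0.
have cD : {within `[0, 1], continuous D}.
  move=> t; apply: continuousB; first exact: cA.
  move: t; apply: continuous_in_subspaceT => t; rewrite inE/= in_itv/= => ht.
  apply: continuous_comp; last first.
    by apply: cont_th; have := hP t ht; rewrite /Num.min; case: ifP => _; lra.
  apply: continuous_min; last exact: cvg_cst.
  by apply: cvgD; [exact: cvg_cst|apply: cvgM; [exact: cvg_id|exact: cvg_cst]].
have D0E : D 0 = A 0 - th (Num.min s1 s0) by rewrite /D /P mul0r addr0.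
have D1E : D 1 = A 0 - th (Num.min s2 s0).
  by rewrite /D /P mul1r (addrC s1) subrK -A01.
have sD0 := sD 0 ltac:(lra).
have pi0 := pi_gt0 R.
apply/andP; split; rewrite ltNge; apply/negP => h.
  have [|t ht e] := @IVT_itv R D 0 1 (D 0 - pi) ler01 cD; first by right; lra.
  have := sD t ht; rewrite e.
  by rewrite -[D 0](subrK pi) sinDpi in sD0; lra.
have [|t ht e] := @IVT_itv R D 0 1 (D 0 + pi) ler01 cD; first by left; lra.
by have := sD t ht; rewrite e sinDpi; lra.
Qed.

(** The task is to find the direction [m] of [narrow_disjoint]. If both points lie on the arc, or
    both on the spiral, the total turning is below [pi] and the mean of the end angles works; in the
    mixed case the smallest angle is [th s0]. *)
Lemma tube_disjoint_left (s1 r1 s2 r2 : R) :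
  0 < s1 -> s1 < s2 -> s2 <= L / 2 -> 0 < r1 < delta -> 0 < r2 < delta ->
  tubeX s1 r1 = tubeX s2 r2 -> tubeZ s1 r1 = tubeZ s2 r2 -> False.
Proof.
have L0 := L_gt0; have d0 := delta_gt0; have sb := s0_bd; have pi0 := pi_gt0 R.
move=> s10 s12 s2L hr1 hr2 eX eZ.
suff [m [hm hm12]] : exists m,
    (forall t, s1 <= t <= s2 -> - (pi / 2) < th t - m < pi / 2) /\
    (th s1 <= m <= th s2) || (th s2 <= m <= th s1).
  by apply: (@narrow_disjoint m s1 r1 s2 r2) => //; lra.
have [s01|s10'] := leP s0 s1.
  exists ((th s1 + th s2) / 2).
  have a1 := @th_arc s1 ltac:(lra).
  have a2 := @th_arc_le0 s2 ltac:(lra).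
  have a3 := @th_arc_ndecr s1 s2 ltac:(lra) ltac:(lra) ltac:(lra).
  split=> [t ht|]; last by lra.
  have := @th_arc_ndecr s1 t ltac:(lra) ltac:(lra) ltac:(lra).
  by have := @th_arc_ndecr t s2 ltac:(lra) ltac:(lra) ltac:(lra); lra.
have k0 : k 0 < 0 by case/orP: s0_case => // /eqP; lra.
have := @angle_close s1 r1 s2 r2 k0 ltac:(lra) hr1 ltac:(lra) hr2 eX eZ.
rewrite (min_idPl (ltW s10')) => hc.
have [s20|s02] := leP s2 s0.
  rewrite (min_idPl s20) in hc.
  exists ((th s1 + th s2) / 2).
  have a3 := @th_spiral_nincr s1 s2 k0 ltac:(lra) ltac:(lra) ltac:(lra).
  split=> [t ht|]; last by lra.
  have := @th_spiral_nincr s1 t k0 ltac:(lra) ltac:(lra) ltac:(lra).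
  by have := @th_spiral_nincr t s2 k0 ltac:(lra) ltac:(lra) ltac:(lra); lra.
rewrite (min_idPr (ltW s02)) in hc.
have b1 := @th_spiral_nincr s1 s0 k0 ltac:(lra) ltac:(lra) (lexx _).
have b2 := @th_arc_ndecr s0 s2 (lexx _) ltac:(lra) ltac:(lra).
have hmax t : s1 <= t <= s2 -> th s0 <= th t /\ (th t <= th s1 \/ th t <= th s2).
  move=> ht; have [ts|st] := leP t s0.
    have := @th_spiral_nincr s1 t k0 ltac:(lra) ltac:(lra) ltac:(lra).
    have := @th_spiral_nincr t s0 k0 ltac:(lra) ltac:(lra) ltac:(lra).
    by move=> ? ?; split; [lra|left].
  have := @th_arc_ndecr s0 t ltac:(lra) ltac:(lra) ltac:(lra).
  have := @th_arc_ndecr t s2 ltac:(lra) ltac:(lra) ltac:(lra).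
  by move=> ? ?; split; [lra|right].
(* If the arc turns by at least [pi / 2] after [s0], its normal points back across the tangent line
   at [s0]; the point over [s2] then lies on the wrong side of that line for [spiral_above]. *)
have [h2|h2] := leP (th s0 + pi / 2) (th s2).
  exfalso.
  have := @spiral_above s1 r1 ltac:(lra) ltac:(lra) k0.
  have a1 := @arc_below s2 ltac:(lra).
  have -> : (tubeX s1 r1 - X s0) * sin (th s0) - (tubeZ s1 r1 - Z s0) * cos (th s0) =
    ((X s2 - X s0) * sin (th s0) - (Z s2 - Z s0) * cos (th s0)) +
    r2 * cos (th s2 - th s0).
    by rewrite eX eZ cosB /tubeX /tubeZ; ring.
  have t0 := @th_arc s0 ltac:(lra).
  have t2 := @th_arc_le0 s2 ltac:(lra).
  have : cos (th s2 - th s0) <= 0.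
    rewrite -[th s2 - th s0](subrK pi) cosDpi oppr_le0.
    by apply: cos_ge0_pihalf; lra.
  by case/andP: hr2 => r20 _ cs; nra.
have [h12|h12] := leP (th s1) (th s2).
  exists (th s2); split; last by lra.
  by move=> t /hmax; lra.
(* [m] must lie between [th s2] and [th s1] and within a quarter turn of the largest angle [th s1]
   and of the smallest [th s0]; [lo] and [hi] collect these bounds, and their mean makes the strict
   ones strict. *)
pose lo := Num.max (th s2) (th s1 - pi / 2).
pose hi := Num.min (th s1) (th s0 + pi / 2).
have [l1 l2] : th s2 <= lo /\ th s1 - pi / 2 <= lo by rewrite /lo !le_max !lexx orbT.
have [u1 u2] : hi <= th s1 /\ hi <= th s0 + pi / 2 by rewrite /hi !ge_min !lexx orbT.
have lh : lo < hi by rewrite /lo /hi gt_max !lt_min; lra.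
exists ((lo + hi) / 2); split; last by lra.
by move=> t /hmax; lra.
Qed.

Lemma tube_inj_s0 (s1 r1 s2 r2 : R) :
  0 < s1 < L -> 0 < r1 < delta -> 0 < s2 < L -> 0 < r2 < delta ->
  tubeX s1 r1 = tubeX s2 r2 -> tubeZ s1 r1 = tubeZ s2 r2 -> s1 = s2 /\ r1 = r2.
Proof.
have L0 := L_gt0; have d0 := delta_gt0.
move=> hs1 hr1 hs2 hr2 eX eZ.
suff s12 : s1 = s2 by split => //; apply: (@tube_inj_r s2); rewrite -?eX -?eZ s12.
wlog s12 : s1 r1 s2 r2 hs1 hr1 hs2 hr2 eX eZ / s1 < s2.
  move=> H; have [h|h|//] := ltgtP s1 s2; first exact: (H s1 r1 s2 r2).
  by apply/esym; exact: (H s2 r2 s1 r1).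
exfalso; have [h2|h2] := leP s2 (L / 2).
  by apply: (@tube_disjoint_left s1 r1 s2 r2) => //; lra.
have [h1|h1] := leP (L / 2) s1.
  apply: (@tube_disjoint_left (L - s2) r2 (L - s1) r1) => //; try lra.
    by rewrite !tube_symX ?eX//; lra.
  by rewrite !tube_symZ ?eZ//; lra.
have := @tubeX_lt0 s1 r1 ltac:(lra) ltac:(lra).
have := @tubeX_lt0 (L - s2) r2 ltac:(lra) ltac:(lra).
by rewrite tube_symX; lra.
Qed.

End tube_geometry.

(** * Tools for derivatives on a closed interval *)

Section antiderivative.
Variable R : realType.

Lemma antiderivative_from (f : R -> R) (a : R) : continuous f ->
  exists F : R -> R, forall s, a < s -> is_derive s 1 F (f s).
Proof.
move=> cf; exists (fun s => (\int[@lebesgue_measure R]_(t in `[a, s]) f t)%R) => s as_.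
have fi : lebesgue_measure.-integrable `[a, s + 1] (EFin \o f).
  apply: continuous_compact_integrable; first exact: segment_compact.
  exact: continuous_subspaceT.
have [|dF FE] := continuous_FTC1_closed _ fi as_ (cf s); first by rewrite ltrDl.
by rewrite -FE derive1E; apply/derivableP.
Qed.

Lemma derive_const (f : R -> R) (a b : R) :
  (forall s, a <= s <= b -> is_derive s 1 f 0) ->
  forall s t, a <= s <= b -> a <= t <= b -> f s = f t.
Proof.
move=> h.
have H s t : a <= s -> s <= t -> t <= b -> f s = f t.
  move=> as_ st tb; apply/eqP; rewrite eq_le; apply/andP; split.
    by apply: (@derive_ndecr R f (cst 0)) => // u hu; apply: h; lra.
  rewrite -lerN2; apply: (@derive_ndecr R (fun u => - f u) (fun=> - 0)) => // u hu.
    by have d := h u ltac:(lra); derive_tac.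
move=> s t hs ht; have [st|ts] := leP s t; first by apply: H; lra.
by apply/esym; apply: H; lra.
Qed.

(** The hypotheses on the curve hold on [[0, L]] only, while derivatives are two-sided: identities
    are differentiated inside and carried to the ends by this lemma. *)
Lemma continuous_closed_ext (f g : R -> R) (a b : R) : a < b ->
  continuous f -> continuous g -> (forall s, a < s < b -> f s = g s) ->
  forall s, a <= s <= b -> f s = g s.
Proof.
move=> ab cf cg h s hs.
have [|n] := boolP (a < s < b); first exact: h.
apply/eqP; rewrite -subr_eq0; apply/negP => /negP n0.
pose d t := f t - g t.
have cd : {for s, continuous d} by apply: cvgB; [exact: cf|exact: cg].
have e0 : 0 < `|d s| by rewrite normr_gt0.
have /cvgrPdist_lt/(_ _ e0) := cd.
move=> /nbhs_ballP[e /= e0' he].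
have [t [ht tab]] : exists t, ball s e t /\ a < t < b.
  pose m := Num.min (e / 2) ((b - a) / 2).
  have [m1 m2] : m <= e / 2 /\ m <= (b - a) / 2 by rewrite /m !ge_min !lexx orbT.
  have m0 : 0 < m by rewrite lt_min; lra.
  have [sa|sa] := eqVneq s a.
    exists (s + m); rewrite -ball_normE/= opprD addrA subrr sub0r normrN gtr0_norm//.
    by split; lra.
  have sb : s = b.
    apply/eqP; apply: contraNT n => sb; rewrite !lt_neqAle (eq_sym a) sa sb/=; lra.
  exists (s - m); rewrite -ball_normE/= opprB addrCA subrr addr0 gtr0_norm//.
  by split; lra.
by have := he t ht; rewrite /d (h t tab) subrr subr0 ltxx.
Qed.
End antiderivative.

Section smooth.
Variable R : realType.

Lemma smooth1_is_derive (f : R -> R) (n : nat) (s : R) : smooth1 f ->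
  is_derive s 1 (derive1n n f) (derive1n n.+1 f s).
Proof. by move=> sf; rewrite derive1nS derive1E; apply/derivableP; exact: sf. Qed.

Lemma is_derive_continuous (f : R -> R) (s a : R) : is_derive s 1 f a ->
  {for s, continuous f}.
Proof.
by move=> [h _]; apply: differentiable_continuous; apply/derivable1_diffP.
Qed.

Lemma smooth1_continuous (f : R -> R) (n : nat) : smooth1 f -> continuous (derive1n n f).
Proof. by move=> sf s; apply: is_derive_continuous (smooth1_is_derive n s sf). Qed.

Lemma derive1_near_eq (f g : R -> R) (s a b : R) : (\forall t \near s, f t = g t) ->
  is_derive s 1 f a -> is_derive s 1 g b -> a = b.
Proof.
move=> fg fa gb; have := near_eq_is_derive fg fa.
by move=> [_ <-]; have [_ <-] := gb.
Qed.

Lemma is_derive_quotient (f : R -> R) (s df e : R) : is_derive s 1 f df -> 0 < e ->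
  exists2 d : R, 0 < d & forall u : R, u != 0 -> `|u| < d ->
    `|(f (s + u) - f s) / u - df| < e.
Proof.
move=> [dd <-] e0; have := dd; rewrite /derivable => /cvgrPdist_lt/(_ e e0).
rewrite near_withinE => /nbhs_ballP[d /= d0 hd]; exists d => // u u0 ud.
have := hd u; rewrite -ball_normE/= sub0r normrN => /(_ ud u0).
rewrite -['D_1 f s]/(lim _) distrC.
by rewrite /GRing.scale/= mulr1 (addrC u) (mulrC u^-1).
Qed.

Lemma derive_ge0_incr (f : R -> R) (df s b : R) : s < b -> is_derive s 1 f df ->
  (forall t, s <= t <= b -> f s <= f t) -> 0 <= df.
Proof.
move=> sb dd h; rewrite leNgt; apply/negP => df0.
have [|d d0 hd] := is_derive_quotient dd (_ : 0 < - df); first by lra.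
pose u := Num.min (d / 2) (b - s).
have [u1 u2] : u <= d / 2 /\ u <= b - s by rewrite /u !ge_min !lexx orbT.
have u0 : 0 < u by rewrite lt_min; lra.
have := hd u; rewrite gt_eqF// gtr0_norm// => /(_ isT ltac:(lra)).
rewrite ltr_norml => /andP[_ q].
have : 0 <= (f (s + u) - f s) / u.
  by apply: divr_ge0; [rewrite subr_ge0; apply: h; lra|exact: ltW].
by lra.
Qed.
End smooth.

(** * The curve: symmetry, tangent angle and injectivity of its offsets *)

Section curve.
Variables (R : realType) (L delta : R) (xd zd : nat -> R -> R).
Hypotheses (L_gt0 : 0 < L) (delta_gt0 : 0 < delta).
Hypothesis dx : forall n (s : R), is_derive s 1 (xd n) (xd n.+1 s).
Hypothesis dz : forall n (s : R), is_derive s 1 (zd n) (zd n.+1 s).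
Hypothesis unit_speed : forall s : R, 0 <= s <= L -> xd 1 s ^+ 2 + zd 1 s ^+ 2 = 1.
Hypothesis simple : forall s t : R, 0 <= s <= L -> 0 <= t <= L -> s < t ->
  xd 0 s = xd 0 t -> zd 0 s = zd 0 t -> s = 0 /\ t = L.
Hypothesis nonclosed : xd 0 0 = xd 0 L -> zd 0 0 = zd 0 L -> False.
Hypothesis symmetric : forall s : R, 0 <= s <= L / 2 ->
  xd 0 (L - s) = - xd 0 s /\ zd 0 (L - s) = zd 0 s.

Definition kappa s := xd 1 s * zd 2 s - zd 1 s * xd 2 s.
Definition dkappa s := xd 1 s * zd 3 s - zd 1 s * xd 3 s.

Hypothesis concave : forall p s t : R, 0 <= p <= 1 -> 0 <= s <= L -> 0 <= t <= L ->
  p * kappa s + (1 - p) * kappa t <= kappa (p * s + (1 - p) * t).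
Hypothesis Jdelta_gt0 : forall s : R, 0 <= s <= L -> 0 < 1 + delta * kappa s.

Lemma xd_cont n : continuous (xd n).
Proof. by move=> s; exact: is_derive_continuous (dx n s). Qed.

Lemma zd_cont n : continuous (zd n).
Proof. by move=> s; exact: is_derive_continuous (dz n s). Qed.

Lemma unit_speed_orth (s : R) : 0 <= s <= L -> xd 1 s * xd 2 s + zd 1 s * zd 2 s = 0.
Proof.
apply: (@continuous_closed_ext R (fun s => xd 1 s * xd 2 s + zd 1 s * zd 2 s) (cst 0) 0 L) => //.
- by move=> t; apply: cvgD; apply: cvgM; (exact: xd_cont || exact: zd_cont).
- by move=> t; exact: cvg_cst.
move=> t tL.
have d1 := dx 1 t; have d2 := dz 1 t.
have d : is_derive t 1 (fun s => xd 1 s ^+ 2 + zd 1 s ^+ 2)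
   (2 * xd 1 t ^+ 1 * xd 2 t + 2 * zd 1 t ^+ 1 * zd 2 t) by derive_tac.
have : 2 * xd 1 t ^+ 1 * xd 2 t + 2 * zd 1 t ^+ 1 * zd 2 t = 0.
  apply: (derive1_near_eq _ d (is_deriveC t 1)).
  have : t \in `]0, L[ by rewrite in_itv.
  move=> /near_in_itvoo; apply: filterS => u; rewrite in_itv/= => hu.
  by apply: unit_speed; lra.
by rewrite !expr1 /=; lra.
Qed.

Lemma curve_x2 (s : R) : 0 <= s <= L -> xd 2 s = - (kappa s * zd 1 s).
Proof.
move=> hs; have u := unit_speed hs; have o := unit_speed_orth hs; rewrite /kappa.
have -> : (xd 1 s * zd 2 s - zd 1 s * xd 2 s) * zd 1 s = xd 1 s *
  (xd 1 s * xd 2 s + zd 1 s * zd 2 s) - xd 2 s * (xd 1 s ^+ 2 + zd 1 s ^+ 2) by ring.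
by rewrite o u; ring.
Qed.

Lemma curve_z2 (s : R) : 0 <= s <= L -> zd 2 s = kappa s * xd 1 s.
Proof.
move=> hs; have u := unit_speed hs; have o := unit_speed_orth hs; rewrite /kappa.
have -> : (xd 1 s * zd 2 s - zd 1 s * xd 2 s) * xd 1 s = - zd 1 s *
  (xd 1 s * xd 2 s + zd 1 s * zd 2 s) + zd 2 s * (xd 1 s ^+ 2 + zd 1 s ^+ 2) by ring.
by rewrite o u; ring.
Qed.

Lemma is_derive_kappa (s : R) : is_derive s 1 kappa (dkappa s).
Proof.
have d1 := dx 1 s; have d2 := dz 1 s; have d3 := dx 2 s; have d4 := dz 2 s.
by rewrite /kappa /dkappa; derive_tac; ring.
Qed.

Lemma kappa_cont : continuous kappa.
Proof. by move=> s; apply: is_derive_continuous (is_derive_kappa s). Qed.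

Lemma symm (s : R) : 0 <= s <= L -> xd 0 (L - s) = - xd 0 s /\ zd 0 (L - s) = zd 0 s.
Proof.
move=> hs; have [h|h] := leP s (L / 2); first by apply: symmetric; lra.
have [|] := @symmetric (L - s); first by lra.
by rewrite opprB addrC subrK => -> ->; rewrite opprK.
Qed.

Lemma reflect_derive (f : nat -> R -> R) (n : nat) (e : R) :
  (forall m (s : R), is_derive s 1 (f m) (f m.+1 s)) ->
  (forall s : R, 0 <= s <= L -> f n (L - s) = e * f n s) ->
  forall s : R, 0 <= s <= L -> f n.+1 (L - s) = - e * f n.+1 s.
Proof.
move=> df h.
have cf m : continuous (f m) by move=> s; exact: is_derive_continuous (df m s).
apply: continuous_closed_ext => //.
- move=> s; apply: continuous_comp; last exact: cf.
  by apply: cvgB; [exact: cvg_cst|exact: cvg_id].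
- by move=> s; apply: cvgM; [exact: cvg_cst|exact: cf].
move=> s hs; have d1 := df n s; have d2 := df n (L - s).
have dl : is_derive s 1 (fun t : R => L - t) (0 - 1) by derive_tac.
have d3 := @is_derive_comp_fun R (f n) (fun t : R => L - t) s _ _ d2 dl.
have d4 : is_derive s 1 (fun t => e * f n t) (e * f n.+1 s + f n s * 0) by derive_tac.
have : f n.+1 (L - s) * (0 - 1) = e * f n.+1 s + f n s * 0.
  apply: (derive1_near_eq _ d3 d4).
  have : s \in `]0, L[ by rewrite in_itv.
  move=> /near_in_itvoo; apply: filterS => u; rewrite in_itv/= => hu.
  by apply: h; lra.
by lra.
Qed.

Lemma reflect_x1 (s : R) : 0 <= s <= L -> xd 1 (L - s) = xd 1 s.
Proof.
move=> hs; rewrite (@reflect_derive xd 0 (- 1))// ?opprK ?mul1r// => t ht.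
by rewrite mulN1r; exact: (symm ht).1.
Qed.

Lemma reflect_z1 (s : R) : 0 <= s <= L -> zd 1 (L - s) = - zd 1 s.
Proof.
move=> hs; rewrite (@reflect_derive zd 0 1)// ?mulN1r// => t ht.
by rewrite mul1r; exact: (symm ht).2.
Qed.

Lemma kappa_reflect (s : R) : 0 <= s <= L -> kappa (L - s) = kappa s.
Proof.
move=> hs; rewrite /kappa reflect_x1// reflect_z1//.
rewrite (@reflect_derive xd 1 1)//; last by move=> t ht; rewrite mul1r reflect_x1.
rewrite (@reflect_derive zd 1 (-1))//; last by move=> t ht; rewrite mulN1r reflect_z1.
by ring.
Qed.

(** [t] is a convex combination of [s] and its mirror point [L - s], where [kappa] takes the same
    value, so concavity gives the bound. *)
Lemma kappa_ndecr (s t : R) : 0 <= s -> s <= t -> t <= L / 2 -> kappa s <= kappa t.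
Proof.
have L0 := L_gt0; move=> s0 st tL.
have [sE|sL] := eqVneq s (L / 2); first by rewrite (_ : t = s)//; lra.
have {}sL : s < L / 2 by rewrite lt_neqAle sL; lra.
have p0 : 0 < L - s - s by lra.
pose p := (t - s) / (L - s - s).
have hp : 0 <= p <= 1.
  by rewrite /p ler_pdivlMr// ler_pdivrMr// mul0r mul1r; lra.
have := @concave p (L - s) s hp ltac:(lra) ltac:(lra).
rewrite kappa_reflect; last by lra.
have -> : p * (L - s) + (1 - p) * s = t by rewrite /p; field; rewrite gt_eqF//; lra.
by lra.
Qed.

Lemma dkappa_ge0 (s : R) : 0 < s < L / 2 -> 0 <= dkappa s.
Proof.
move=> hs; apply: (@derive_ge0_incr R kappa (dkappa s) s (L / 2)); [lra|exact: is_derive_kappa|].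
by move=> t ht; apply: kappa_ndecr; lra.
Qed.

Lemma dkappa_le0 (s : R) : L / 2 < s < L -> dkappa s <= 0.
Proof.
move=> hs; have dl : is_derive (L - s) 1 (fun t : R => L - t) (0 - 1) by derive_tac.
have dk : is_derive (L - (L - s)) 1 kappa (dkappa s).
  by rewrite opprB addrC subrK; exact: is_derive_kappa.
have d := @is_derive_comp_fun R kappa (fun t : R => L - t) (L - s) _ _ dk dl.
have := @derive_ge0_incr R _ _ (L - s) (L / 2) _ d _.
move=> h; have {}h := h ltac:(lra).
have H t : L - s <= t <= L / 2 -> kappa (L - (L - s)) <= kappa (L - t).
  move=> ht; rewrite (@kappa_reflect (L - s)); last lra.
  rewrite (@kappa_reflect t); last lra.
  by apply: kappa_ndecr; lra.
by have := h H; lra.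
Qed.

Lemma z1_mid : zd 1 (L / 2) = 0.
Proof.
have L0 := L_gt0; have := @reflect_z1 (L / 2) ltac:(lra).
have -> : L - L / 2 = L / 2 by field.
by lra.
Qed.

Lemma x_mid : xd 0 (L / 2) = 0.
Proof.
have L0 := L_gt0; have [] := @symm (L / 2) ltac:(lra).
have -> : L - L / 2 = L / 2 by field.
by lra.
Qed.

(** By symmetry the tangent at the middle is horizontal, so [e] is a sign. Multiplying both
    coordinates by [e] is the identity or a half turn; it preserves the curvature and makes the
    tangent angle at the middle zero. *)
Let e := xd 1 (L / 2).

Lemma sqr_e : e * e = 1.
Proof.
have L0 := L_gt0; have := @unit_speed (L / 2) ltac:(lra).
by rewrite z1_mid expr0n/= addr0 expr2.
Qed.

(** With [th] a primitive of the curvature, the components [u] and [w] of the tangent in the frame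
    rotated by [th] have derivative zero and keep their values at the middle. No branch of an
    inverse function has to be chosen. *)
Lemma tangent_angle : exists th : R -> R, [/\
  forall s, 0 <= s <= L -> is_derive s 1 th (kappa s), th (L / 2) = 0,
  forall s, 0 <= s <= L -> e * xd 1 s = cos (th s) &
  forall s, 0 <= s <= L -> e * zd 1 s = sin (th s)].
Proof.
have L0 := L_gt0; have e2 := sqr_e.
(* The base point [-1] leaves [[0, L]] strictly to its right, where the primitive has two-sided
   derivatives. *)
have [F hF] := antiderivative_from (-1) kappa_cont.
pose th s := F s - F (L / 2).
have dth s : 0 <= s <= L -> is_derive s 1 th (kappa s).
  move=> hs; have d := hF s ltac:(lra).
  by apply: is_derive_eq (is_deriveD_fun d (is_deriveC s (- F (L / 2)))) _; rewrite addr0.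
have thm : th (L / 2) = 0 by rewrite /th subrr.
pose u s := xd 1 s * cos (th s) + zd 1 s * sin (th s).
pose w s := zd 1 s * cos (th s) - xd 1 s * sin (th s).
have du s : 0 <= s <= L -> is_derive s 1 u 0.
  move=> hs; have d1 := dx 1 s; have d2 := dz 1 s; have d3 := dth s hs.
  by rewrite /u; derive_tac; rewrite curve_x2// curve_z2//; ring.
have dw s : 0 <= s <= L -> is_derive s 1 w 0.
  move=> hs; have d1 := dx 1 s; have d2 := dz 1 s; have d3 := dth s hs.
  by rewrite /w; derive_tac; rewrite curve_x2// curve_z2//; ring.
have uE s : 0 <= s <= L -> u s = e.
  move=> hs; rewrite (@derive_const R u 0 L du s (L / 2))//; last by lra.
  by rewrite /u thm cos0 sin0 mulr0 addr0 mulr1.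
have wE s : 0 <= s <= L -> w s = 0.
  move=> hs; rewrite (@derive_const R w 0 L dw s (L / 2))//; last by lra.
  by rewrite /w thm cos0 sin0 mulr0 subr0 mulr1 z1_mid.
exists th; split=> // s hs; have cs := cos2Dsin2 (th s).
  have -> : xd 1 s = u s * cos (th s) - w s * sin (th s).
    transitivity (xd 1 s * (cos (th s) ^+ 2 + sin (th s) ^+ 2)); first by rewrite cs mulr1.
    by rewrite /u /w; ring.
  by rewrite uE// wE// mul0r subr0 mulrA e2 mul1r.
have -> : zd 1 s = u s * sin (th s) + w s * cos (th s).
  transitivity (zd 1 s * (cos (th s) ^+ 2 + sin (th s) ^+ 2)); first by rewrite cs mulr1.
  by rewrite /u /w; ring.
by rewrite uE// wE// mul0r addr0 mulrA e2 mul1r.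
Qed.

(** A zero would make the curve meet its mirror point, which simplicity and non-closedness forbid.
    The constant sign is read off just before the middle, where the derivative is [e * e = 1]. *)
Lemma left_half (s : R) : 0 <= s < L / 2 -> e * xd 0 s < 0.
Proof.
have L0 := L_gt0; have e2 := sqr_e; move=> hs.
have nz t : 0 <= t < L / 2 -> e * xd 0 t <> 0.
  move=> ht /eqP; rewrite mulf_eq0 => /orP[/eqP e0|/eqP xt].
    by move: e2; rewrite e0 mul0r => /esym/eqP; rewrite oner_eq0.
  have [h1 h2] := @symm t ltac:(lra).
  have [||] := @simple t (L - t) ltac:(lra) ltac:(lra) ltac:(lra).
  - by rewrite h1 xt oppr0.
  - by rewrite h2.
  move=> t0 _; apply: nonclosed.
    by move: h1 xt; rewrite t0 subr0 => -> ->; rewrite oppr0.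
  by move: h2; rewrite t0 subr0.
have [t [ht xt]] : exists t, s < t < L / 2 /\ e * xd 0 t < 0.
  have d1 := dx 0 (L / 2).
  have d : is_derive (L / 2) 1 (fun t => e * xd 0 t) (e * e + xd 0 (L / 2) * 0) by derive_tac.
  have [|d0 d00 hd] := is_derive_quotient d (_ : 0 < 1); first by [].
  pose u := Num.min (d0 / 2) ((L / 2 - s) / 2).
  have [u1 u2] : u <= d0 / 2 /\ u <= (L / 2 - s) / 2 by rewrite /u !ge_min !lexx orbT.
  have u0 : 0 < u by rewrite lt_min; lra.
  exists (L / 2 - u); split; first by lra.
  have := hd (- u); rewrite oppr_eq0 gt_eqF// normrN gtr0_norm// => /(_ isT ltac:(lra)).
  rewrite x_mid mulr0 subr0 e2 mul0r addr0 ltr_norml => /andP[q _].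
  have {}q : 0 < e * xd 0 (L / 2 - u) / - u by lra.
  by move: q; rewrite invrN mulrN oppr_gt0 pmulr_llt0// invr_gt0.
have [//|h] := ltP (e * xd 0 s) 0.
have cx : {within `[s, t], continuous (fun t => e * xd 0 t)}.
  by apply: continuous_subspaceT => u; apply: cvgM; [exact: cvg_cst|exact: xd_cont].
have [||u hu xu] := @IVT_itv R (fun t => e * xd 0 t) s t 0 _ cx; [lra|right; lra|].
by exfalso; apply: (nz u) => //; lra.
Qed.

Lemma pivot_exists : exists s0 : R, [/\ 0 <= s0 <= L / 2,
  forall s : R, kappa 0 < 0 -> 0 <= s <= s0 -> kappa s <= 0,
  forall s : R, s0 <= s < L / 2 -> 0 <= kappa s & (kappa 0 < 0) || (s0 == 0)].
Proof.
have L0 := L_gt0; have [k0|k0] := ltP (kappa 0) 0; last first.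
  exists 0; split; first lra.
  - by move=> s; lra.
  - by move=> s hs; apply: le_trans k0 _; apply: kappa_ndecr; lra.
  - by rewrite eqxx.
have [km|km] := leP (kappa (L / 2)) 0.
  exists (L / 2); split => //; first lra.
  - by move=> s _ hs; apply: le_trans km; apply: kappa_ndecr; lra.
  - by move=> s; lra.
have [||s0 hs0 ks0] := @IVT_itv R kappa 0 (L / 2) 0 ltac:(lra).
- by apply: continuous_subspaceT; exact: kappa_cont.
- by left; lra.
exists s0; split => //.
- by move=> s _ hs; rewrite -ks0; apply: kappa_ndecr; lra.
- by move=> s hs; rewrite -ks0; apply: kappa_ndecr; lra.
Qed.

Definition offX s r := xd 0 s + r * zd 1 s.
Definition offZ s r := zd 0 s - r * xd 1 s.

Hypothesis loop_angle : forall px pz : R,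
  (forall s r : R, 0 < s < L -> 0 < r < delta ->
     offX s r = px -> offZ s r = pz -> False) ->
  forall s1 r1 s2 r2 : R, 0 < s1 < L -> 0 < r1 < delta ->
    0 < s2 < L -> 0 < r2 < delta ->
    offX s1 r1 = offX s2 r2 -> offZ s1 r1 = offZ s2 r2 ->
  exists A, angle_along
    (fun t => offX (s1 + t * (s2 - s1)) (r1 + t * (r2 - r1)) - px)
    (fun t => offZ (s1 + t * (s2 - s1)) (r1 + t * (r2 - r1)) - pz) A.

Theorem offset_injective (s1 r1 s2 r2 : R) :
  0 < s1 < L -> 0 < r1 < delta -> 0 < s2 < L -> 0 < r2 < delta ->
  offX s1 r1 = offX s2 r2 -> offZ s1 r1 = offZ s2 r2 -> s1 = s2 /\ r1 = r2.
Proof.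
move=> hs1 hr1 hs2 hr2 eX eZ; have L0 := L_gt0; have e2 := sqr_e.
have [th [dth th_mid cE sE]] := tangent_angle.
have [s0 [s0_bd k_le0 k_ge0 s0_case]] := pivot_exists.
pose X s := e * xd 0 s; pose Z s := e * zd 0 s.
have dX (s : R) : 0 <= s <= L -> is_derive s 1 X (cos (th s)).
  move=> hs; rewrite -cE//; have d1 := dx 0 s.
  by rewrite /X; derive_tac; rewrite mulr0 addr0.
have dZ (s : R) : 0 <= s <= L -> is_derive s 1 Z (sin (th s)).
  move=> hs; rewrite -sE//; have d1 := dz 0 s.
  by rewrite /Z; derive_tac; rewrite mulr0 addr0.
have oX s r : 0 <= s <= L -> tubeX X th s r = e * offX s r.
  by move=> hs; rewrite /tubeX /X /offX -sE//; ring.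
have oZ s r : 0 <= s <= L -> tubeZ Z th s r = e * offZ s r.
  by move=> hs; rewrite /tubeZ /Z /offZ -cE//; ring.
have ecancel u v : e * u = v -> u = e * v by move=> <-; rewrite mulrA e2 mul1r.
apply: (@tube_inj_s0 R X Z th kappa dkappa L delta L_gt0 delta_gt0 dX dZ dth _ _ _
  th_mid _ _ Jdelta_gt0 s0 s0_bd k_le0 k_ge0 s0_case) => //.
- by move=> s _; exact: is_derive_kappa.
- exact: kappa_ndecr.
- exact: dkappa_ge0.
- by rewrite /X x_mid mulr0.
- exact: left_half.
- by move=> s hs; rewrite /X (symm hs).1 mulrN.
- by move=> s hs; rewrite /Z (symm hs).2.
- move=> s hs.
  have dl : is_derive s 1 (fun t : R => L - t) (0 - 1) by derive_tac.
  have D t : 0 <= t <= L -> is_derive t 1 (fun u => th (L - u) + th u) 0.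
    move=> ht; have dt : is_derive t 1 (fun t : R => L - t) (0 - 1) by derive_tac.
    have d1 := @is_derive_comp_fun R th (fun t : R => L - t) t _ _ (dth (L - t) ltac:(lra)) dt.
    apply: is_derive_eq (is_deriveD_fun d1 (dth t ht)) _.
    by rewrite kappa_reflect//; ring.
  have := @derive_const R _ 0 L D s (L / 2) hs ltac:(lra).
  have -> : L - L / 2 = L / 2 by field.
  by rewrite th_mid; lra.
- move=> px pz hp u1 v1 u2 v2 hu1 hv1 hu2 hv2 eX' eZ'.
  have [|||A [cA [A01 hA]]] := @loop_angle (e * px) (e * pz) _ u1 v1 u2 v2 hu1 hv1 hu2 hv2.
  + move=> s r hs hr h1 h2; apply: (hp s r hs hr).
      by rewrite oX; [rewrite h1 mulrA e2 mul1r|lra].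
    by rewrite oZ; [rewrite h2 mulrA e2 mul1r|lra].
  + by move: eX'; rewrite !oX; [|lra|lra] => /ecancel ->; rewrite mulrA e2 mul1r.
  + by move: eZ'; rewrite !oZ; [|lra|lra] => /ecancel ->; rewrite mulrA e2 mul1r.
  have e0 : e <> 0 by move=> e0; move: e2; rewrite e0 mul0r => /esym/eqP; rewrite oner_eq0.
  (* For [e < 0] the normalized loop is the original one turned by half a turn, so its polar angle
     is shifted by [pi]. *)
  have [en|ep] := ltP e 0.
    exists (fun t => A t + pi); split.
    * by move=> t; apply: cvgD; [exact: continuous_subspaceT|exact: cvg_cst].
    * by rewrite A01.
    move=> t ht; have [rho rho0 [h1 h2]] := hA t ht.
    have hst : 0 <= u1 + t * (u2 - u1) <= L by nra.
    exists (- e * rho); first by rewrite mulr_gt0// oppr_gt0.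
    rewrite cosDpi sinDpi oX// oZ//; split.
      rewrite (_ : _ - px = e * (offX (u1 + t * (u2 - u1)) (v1 + t * (v2 - v1)) - e * px)).
        by rewrite h1; ring.
      by rewrite -{1}[px]mul1r -e2; ring.
    rewrite (_ : _ - pz = e * (offZ (u1 + t * (u2 - u1)) (v1 + t * (v2 - v1)) - e * pz)).
      by rewrite h2; ring.
    by rewrite -{1}[pz]mul1r -e2; ring.
  have {}ep : 0 < e by rewrite lt_neqAle ep andbT eq_sym; apply/eqP.
  exists A; split=> //; first exact: continuous_subspaceT.
  move=> t ht; have [rho rho0 [h1 h2]] := hA t ht.
  have hst : 0 <= u1 + t * (u2 - u1) <= L by nra.
  exists (e * rho); first by rewrite mulr_gt0.
  rewrite oX// oZ//; split.
    rewrite (_ : _ - px = e * (offX (u1 + t * (u2 - u1)) (v1 + t * (v2 - v1)) - e * px)).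
      by rewrite h1; ring.
    by rewrite -{1}[px]mul1r -e2; ring.
  rewrite (_ : _ - pz = e * (offZ (u1 + t * (u2 - u1)) (v1 + t * (v2 - v1)) - e * pz)).
    by rewrite h2; ring.
  by rewrite -{1}[pz]mul1r -e2; ring.
- by rewrite !oX ?eX//; lra.
- by rewrite !oZ ?eZ//; lra.
Qed.

End curve.

(** * Smooth functions of one variable *)

Section smooth_functions.
Variable R : realType.
Implicit Types f g : R -> R.

(** The recursion peels off the innermost derivative, so closure under products and substitutions
    follows by induction on the order with the functions generalized. *)
Fixpoint Ck (n : nat) f : Prop :=
  (forall s : R, derivable f s 1) /\ (if n is m.+1 then Ck m (derive1 f) else True).

Lemma smooth1P f : smooth1 f <-> forall n, Ck n f.
Proof.
split=> [sf n|cf n s].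
  elim: n f sf => [|n IH] f sf; first by split=> // s; exact: (sf 0%N).
  split; first by move=> s; exact: (sf 0%N).
  by apply: IH => m s; have := sf m.+1 s; rewrite derive1Sn.
elim: n f cf => [|n IH] f cf; first by have [] := cf 0%N.
by rewrite derive1Sn; apply: IH => m; have [] := cf m.+1.
Qed.

Lemma CkS n f : Ck n.+1 f -> Ck n f.
Proof.
elim: n f => [|n IH] f [h1 h2]; first by split.
by split=> //; exact: IH.
Qed.

Lemma derive1_val f df : (forall s : R, is_derive s 1 f (df s)) -> derive1 f = df.
Proof. by move=> h; apply/funext => s; rewrite derive1E; have [_ ->] := h s. Qed.

Lemma derivable_is_derive f (s : R) : derivable f s 1 -> is_derive s 1 f (derive1 f s).
Proof. by move=> h; rewrite derive1E; exact/derivableP. Qed.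

Lemma CkP n f df : (forall s : R, is_derive s 1 f (df s)) -> Ck n df -> Ck n.+1 f.
Proof.
move=> h c; split; first by move=> s; have [] := h s.
by rewrite (derive1_val h).
Qed.

Lemma Ck_cst n c : Ck n (fun=> c).
Proof.
elim: n c => [|n IH] c; first by split=> // s; exact: derivable_cst.
by apply: (@CkP _ _ (fun=> 0)) => // s; exact: is_deriveC.
Qed.

Lemma CkD n f g : Ck n f -> Ck n g -> Ck n (fun s => f s + g s).
Proof.
elim: n f g => [|n IH] f g [h1 h2] [k1 k2].
  split; last exact: I.
  move=> s; have [hd _] := is_deriveD_fun (derivable_is_derive (h1 s)) (derivable_is_derive (k1 s)).
  exact: hd.
apply: (@CkP _ _ (fun s => derive1 f s + derive1 g s)); last exact: IH.
by move=> s; apply: is_deriveD_fun; exact: derivable_is_derive.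
Qed.

Lemma CkM n f g : Ck n f -> Ck n g -> Ck n (fun s => f s * g s).
Proof.
elim: n f g => [|n IH] f g cf cg; have [h1 h2] := cf; have [k1 k2] := cg.
  split; last exact: I.
  move=> s; have [hd _] := is_deriveM_fun (derivable_is_derive (h1 s)) (derivable_is_derive (k1 s)).
  exact: hd.
apply: (@CkP _ _ (fun s => f s * derive1 g s + g s * derive1 f s)).
  by move=> s; apply: is_deriveM_fun; exact: derivable_is_derive.
by apply: CkD; apply: IH => //; exact: CkS.
Qed.

Lemma Ck_id n : Ck n (fun s => s).
Proof.
case: n => [|n]; first by split=> // s; exact: derivable_id.
by apply: (@CkP _ _ (fun=> 1)); exact: Ck_cst.
Qed.

Lemma Ck_affine n f a b : Ck n f -> Ck n (fun s => f (a + b * s)).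
Proof.
have da (s : R) : is_derive s 1 (fun s => a + b * s) b.
  apply: is_derive_eq (is_deriveD_fun (is_deriveC s a)
    (is_deriveM_fun (is_deriveC s b) (is_deriveI s))) _.
  by rewrite mulr0 addr0 add0r mulr1.
elim: n f => [|n IH] f [h1 h2].
  split; last exact: I.
  move=> s; have [hd _] := @is_derive_comp_fun R f (fun s => a + b * s) s _ _
    (derivable_is_derive (h1 (a + b * s))) (da s).
  exact: hd.
apply: (@CkP _ _ (fun s => derive1 f (a + b * s) * b)).
  move=> s.
  exact: (@is_derive_comp_fun R f (fun s => a + b * s) s _ _
    (derivable_is_derive (h1 (a + b * s))) (da s)).
by apply: CkM; [exact: IH|exact: Ck_cst].
Qed.

Lemma smooth1_cst c : smooth1 (fun=> c : R).
Proof. by apply/smooth1P => n; exact: Ck_cst. Qed.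

Lemma smooth1_id : smooth1 (fun s : R => s).
Proof. by apply/smooth1P => n; exact: Ck_id. Qed.

Lemma smooth1D f g : smooth1 f -> smooth1 g -> smooth1 (fun s => f s + g s).
Proof. by move=> /smooth1P cf /smooth1P cg; apply/smooth1P => n; exact: CkD. Qed.

Lemma smooth1M f g : smooth1 f -> smooth1 g -> smooth1 (fun s => f s * g s).
Proof. by move=> /smooth1P cf /smooth1P cg; apply/smooth1P => n; exact: CkM. Qed.

Lemma smooth1_affine f a b : smooth1 f -> smooth1 (fun s => f (a + b * s)).
Proof. by move=> /smooth1P cf; apply/smooth1P => n; exact: Ck_affine. Qed.

Lemma smooth1_derive1 f : smooth1 f -> smooth1 (derive1 f).
Proof. by move=> sf n s; have := sf n.+1 s; rewrite derive1Sn. Qed.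

Lemma smooth1_is_derive1 f (s : R) : smooth1 f -> is_derive s 1 f (derive1 f s).
Proof. by move=> sf; apply: derivable_is_derive; exact: (sf 0%N). Qed.

Lemma smooth1_antiderivative F f : (forall s : R, is_derive s 1 F (f s)) -> smooth1 f -> smooth1 F.
Proof.
move=> dF /smooth1P cf; apply/smooth1P => -[|n].
  by split=> // s; have [] := dF s.
exact: CkP dF (cf n).
Qed.

(* The powers of [1 / t] make the family closed under differentiation. *)
Definition flat (n : nat) (t : R) : R := if 0 < t then t ^- n * expR (- t^-1) else 0.

Lemma expR_ge_pow (u : R) n : 0 <= u -> u ^+ n / n`!%:R <= expR u.
Proof.
move=> u0; case: n => [|n].
  by rewrite expr0 fact0 divr1 (le_trans _ (expR_ge1Dx u))// lerDl.
by apply: le_trans (expR_ge1Dxn n u0); rewrite lerDr.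
Qed.

(** The term of degree [n + 2] of the exponential series beats the pole and leaves a factor
    [t ^+ 2], which makes the difference quotient at [0] tend to zero. *)
Lemma flat_le n (t : R) : 0 < t -> `|flat n t| <= n.+2`!%:R * t ^+ 2.
Proof.
move=> t0; rewrite /flat t0 ger0_norm; last first.
  by rewrite mulr_ge0 ?expR_ge0// invr_ge0 exprn_ge0// ltW.
have := @expR_ge_pow t^-1 n.+2; rewrite invr_ge0 ltW// => /(_ isT).
have f0 : 0 < n.+2`!%:R :> R by rewrite ltr0n fact_gt0.
rewrite ler_pdivrMr// => h.
rewrite expRN ler_pdivrMr ?expR_gt0//.
have -> : t ^- n = t ^+ 2 * t^-1 ^+ n.+2.
  have tn : t != 0 by rewrite gt_eqF.
  by rewrite exprVn !exprS; field; rewrite tn expf_neq0.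
rewrite (_ : n.+2`!%:R * t ^+ 2 * expR t^-1 = t ^+ 2 * (expR t^-1 * n.+2`!%:R)); last by ring.
by rewrite ler_wpM2l ?sqr_ge0.
Qed.

Lemma is_derive_flat n (t : R) : is_derive t 1 (flat n) (flat n.+2 t - n%:R * flat n.+1 t).
Proof.
have [t0|t0|->] := ltgtP t 0.
- have e : \forall u \near t, (fun=> 0 : R) u = flat n u.
    near=> u; rewrite /flat ltNge (_ : u <= 0 = true)//.
    by apply/ltW; near: u; exact: lt_nbhsl.
  rewrite /flat ltNge ltW//= mulr0 subr0.
  by apply: (near_eq_is_derive e); exact: is_deriveC.
- have e : \forall u \near t, u ^- n * expR (- u^-1) = flat n u.
    near=> u; rewrite /flat (_ : 0 < u = true)//.
    by near: u; exact: lt_nbhsr.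
  apply: (near_eq_is_derive e).
  have tn : t != 0 by rewrite gt_eqF.
  have d1 : is_derive t 1 (fun u : R => - u^-1) (t ^- 2).
    by derive_tac => //; rewrite mulr1 opprK.
  have d2 := @is_derive_comp_fun R expR (fun u : R => - u^-1) t _ _ (is_derive_expR (- t^-1)) d1.
  rewrite /flat t0; case: n {e} => [|n].
    have e (u : R) : u ^- 0 * expR (- u^-1) = expR (- u^-1) by rewrite expr0 invr1 mul1r.
    rewrite (_ : (fun u => _) = fun u => expR (- u^-1)); last by apply/funext.
    by apply: is_derive_eq d2 _; rewrite mul0r subr0 mulrC.
  have d3 : is_derive t 1 (fun u : R => (u ^+ n.+1)^-1)
     (- (t ^+ n.+1) ^- 2 * (n.+1%:R * t ^+ n * 1)).
    by derive_tac => //; rewrite expf_neq0.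
  apply: is_derive_eq (is_deriveM_fun d3 d2) _.
  rewrite !exprS; field.
  by rewrite tn expf_neq0.
have fE : flat n 0 = 0 by rewrite /flat ltxx.
rewrite {2 3}/flat ltxx mulr0 subr0.
have q (e : R) : 0 < e -> \forall h \near 0^', `|0 - h^-1 *: ((flat n \o shift 0) (h *: 1) - flat n 0)| < e.
  move=> e0; rewrite near_withinE; near=> h => h0.
  rewrite sub0r normrN fE subr0/= addr0 /GRing.scale/= mulr1.
  have [hp|hn] := ltP 0 h; last first.
    by rewrite /flat ifF ?mulr0 ?normr0//; apply/negbTE; rewrite -leNgt.
  rewrite normrM; apply: le_lt_trans (_ : `|h^-1| * (n.+2`!%:R * h ^+ 2) < _).
    by rewrite ler_wpM2l// flat_le.
  have -> : `|h^-1| * (n.+2`!%:R * h ^+ 2) = n.+2`!%:R * h.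
    by rewrite ger0_norm ?invr_ge0 ?ltW//; field; rewrite gt_eqF.
  have f0 : 0 < n.+2`!%:R :> R by rewrite ltr0n fact_gt0.
  rewrite mulrC -ltr_pdivlMr//.
  by near: h; apply: lt_nbhsl; rewrite divr_gt0.
have c : h^-1 *: ((flat n \o shift 0) (h *: 1) - flat n 0) @[h --> 0^'] --> (0 : R).
  by apply/cvgrPdist_lt => e e0; exact: q.
apply: DeriveDef; first by apply/cvg_ex; exists 0.
exact/cvg_lim.
Unshelve. all: by end_near. Qed.

Lemma smooth1_flat n : smooth1 (flat n).
Proof.
apply/smooth1P => m; elim: m n => [|m IH] n.
  by split=> // s; have [] := is_derive_flat n s.
apply: (CkP (is_derive_flat n)).
rewrite (_ : (fun t => _) = fun t => flat n.+2 t + (- n%:R) * flat n.+1 t).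
  by apply: CkD => //; apply: CkM => //; exact: Ck_cst.
by apply/funext => t; rewrite mulNr.
Qed.

Definition bump (a b s : R) : R := flat 0 (s - a) * flat 0 (b - s).

Lemma flat0_itv t : 0 <= flat 0 t <= 1.
Proof.
rewrite /flat; case: ifP => [t0|]; last by rewrite lexx ler01.
rewrite expr0 invr1 mul1r expR_ge0/=.
by rewrite -[X in _ <= X]expR0 ler_expR oppr_le0 invr_ge0 ltW.
Qed.

Lemma smooth1_bump a b : smooth1 (bump a b).
Proof.
apply: smooth1M.
  rewrite (_ : (fun s => _) = fun s => flat 0 (- a + 1 * s)); first exact/smooth1_affine/smooth1_flat.
  by apply/funext => s; rewrite mul1r addrC.
rewrite (_ : (fun s => _) = fun s => flat 0 (b + (-1) * s)); first exact/smooth1_affine/smooth1_flat.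
by apply/funext => s; rewrite mulN1r.
Qed.

Lemma bump_itv a b s : 0 <= bump a b s <= 1.
Proof.
have /andP[h1 h2] := flat0_itv (s - a); have /andP[k1 k2] := flat0_itv (b - s).
by rewrite /bump mulr_ge0//= mulr_ile1.
Qed.

Lemma bump_gt0 a b s : a < s < b -> 0 < bump a b s.
Proof.
move=> /andP[h1 h2]; rewrite /bump /flat !subr_gt0 h1 h2.
by rewrite expr0 invr1 !mul1r mulr_gt0 ?expR_gt0.
Qed.

Lemma bump_eq0 a b s : ~~ (a < s < b) -> bump a b s = 0.
Proof.
rewrite negb_and -!leNgt /bump /flat => /orP[h|h].
  by rewrite (_ : 0 < s - a = false) ?mul0r// subr_gt0 ltNge h.
by rewrite (_ : 0 < b - s = false) ?mulr0// subr_gt0 ltNge h.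
Qed.

End smooth_functions.

(** * Gradients in space *)

Section gradient.
Variable R : realType.
Implicit Types (f g : R3 R -> R) (p q v : R3 R).

Definition lin3 (a b c : R) (v : R3 R) : R := a * v.1.1 + b * v.1.2 + c * v.2.

Lemma lin3_is_linear a b c : linear (lin3 a b c : R3 R -> R).
Proof. by move=> k u v; rewrite /lin3/= /GRing.scale/=; ring. Qed.

HB.instance Definition _ a b c :=
  GRing.isLinear.Build R (R3 R) R _ (lin3 a b c) (lin3_is_linear a b c).

Lemma cont_fst1 p : {for p, continuous (fun v : R3 R => v.1.1)}.
Proof. by apply: (@continuous_comp _ _ _ fst fst); [exact: cvg_fst|exact: cvg_fst]. Qed.

Lemma cont_fst2 p : {for p, continuous (fun v : R3 R => v.1.2)}.
Proof. by apply: (@continuous_comp _ _ _ fst snd); [exact: cvg_fst|exact: cvg_snd]. Qed.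

Lemma cont_snd p : {for p, continuous (fun v : R3 R => v.2)}.
Proof. exact: cvg_snd. Qed.

Lemma lin3_continuous a b c : continuous (lin3 a b c).
Proof.
move=> p; apply: cvgD; first apply: cvgD.
- by apply: cvgM; [exact: cvg_cst|exact: cont_fst1].
- by apply: cvgM; [exact: cvg_cst|exact: cont_fst2].
- by apply: cvgM; [exact: cvg_cst|exact: cont_snd].
Qed.

(** Relational in the manner of [is_derive]: differentiability travels with the value, so the rules
    below compose without side conditions. *)
Definition grad3 f p (a b c : R) :=
  differentiable f p /\ forall v, 'd f p v = lin3 a b c v.

Lemma norm3_ge p : [/\ `|p.1.1| <= `|p|, `|p.1.2| <= `|p| & `|p.2| <= `|p|].
Proof.
have -> : `|p| = Num.max (Num.max `|p.1.1| `|p.1.2|) `|p.2| by [].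
split.
- by rewrite !le_max lexx.
- by rewrite !le_max lexx orbT.
- by rewrite !le_max lexx !orbT.
Qed.

(* A Caratheodory-type criterion: increments that are combinations of the
   coordinate increments with continuous coefficients. *)
Lemma grad3_caratheodory f p (c0 c1 c2 : R3 R -> R) :
  {for p, continuous c0} -> {for p, continuous c1} -> {for p, continuous c2} ->
  (\forall q \near p, f q - f p = c0 q * (q.1.1 - p.1.1) + c1 q * (q.1.2 - p.1.2)
     + c2 q * (q.2 - p.2)) ->
  grad3 f p (c0 p) (c1 p) (c2 p).
Proof.
move=> k0 k1 k2 fE.
have H : f \o shift p = (cst (f p) : R3 R -> R) + (lin3 (c0 p) (c1 p) (c2 p) : R3 R -> R)
    +o_ (0 : R3 R) (id : R3 R -> R3 R).
  apply/eqaddoP => e e0.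
  have e3 : 0 < e / 3 by rewrite divr_gt0.
  move/cvgrPdist_le/(_ _ e3): k0 => k0.
  move/cvgrPdist_le/(_ _ e3): k1 => k1.
  move/cvgrPdist_le/(_ _ e3): k2 => k2.
  suff : \forall q \near p, `|f q - f p - lin3 (c0 p) (c1 p) (c2 p) (q - p)| <= e * `|q - p|.
    rewrite (near_shift 0 p) subr0 => h; near=> v.
    have := near h v; rewrite /= addrK => hv.
    rewrite (_ : (f \o shift p - _) v = f (v + p) - f p - lin3 (c0 p) (c1 p) (c2 p) v).
      by apply: hv.
    by rewrite /= opprD addrA.
  near=> q.
  have -> : f q - f p - lin3 (c0 p) (c1 p) (c2 p) (q - p) =
    - ((c0 p - c0 q) * (q - p).1.1) + - ((c1 p - c1 q) * (q - p).1.2)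
    + - ((c2 p - c2 q) * (q - p).2).
    by rewrite (near fE q)// /lin3/=; ring.
  have [n1 n2 n3] := norm3_ge (q - p).
  have nn : 0 <= `|q - p| by [].
  have B c m (x : R) : `|c| <= e / 3 -> `|x| <= m -> `|- (c * x)| <= e / 3 * m.
    by move=> h1 h2; rewrite normrN normrM ler_pM.
  have -> : e * `|q - p| = e / 3 * `|q - p| + e / 3 * `|q - p| + e / 3 * `|q - p| by field.
  apply: le_trans (ler_normD _ _) _; apply: lerD.
    apply: le_trans (ler_normD _ _) _; apply: lerD; apply: B => //.
      by near: q.
    by near: q.
  by apply: B => //; near: q.
have dE := diff_unique (@lin3_continuous (c0 p) (c1 p) (c2 p)) H.
split; last by move=> v; rewrite dE.
by apply/diff_locallyP; rewrite dE; split=> //; exact: lin3_continuous.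
Unshelve. all: by end_near. Qed.

Lemma grad3_continuous f p a b c : grad3 f p a b c -> {for p, continuous f}.
Proof. by move=> [h _]; exact: differentiable_continuous. Qed.

Lemma grad3_near f g p a b c : (\forall q \near p, f q = g q) -> grad3 f p a b c ->
  grad3 g p a b c.
Proof.
move=> fg [df fE].
have fgp : f p = g p by exact: nbhs_singleton fg.
have dfE : 'd f p = lin3 a b c :> (R3 R -> R) by apply/funext => v; exact: fE.
have H : g \o shift p = (cst (g p) : R3 R -> R) + (lin3 a b c : R3 R -> R)
    +o_ (0 : R3 R) (id : R3 R -> R3 R).
  apply/eqaddoP => e e0.
  have := diff_locally df; rewrite dfE => /eqaddoP/(_ e e0) h.
  move: fg; rewrite (near_shift 0 p) subr0 => fg.
  near=> v.
  have hv : f (v + p) = g (v + p) by near: v.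
  suff -> : (g \o shift p - ((cst (g p) : R3 R -> R) + lin3 a b c)) v =
      (f \o shift p - ((cst (f p) : R3 R -> R) + lin3 a b c)) v by near: v.
  rewrite -[LHS]/(g (v + p) - (g p + lin3 a b c v)).
  by rewrite -[RHS]/(f (v + p) - (f p + lin3 a b c v)) hv fgp.
have dE := diff_unique (@lin3_continuous a b c) H.
split; last by move=> v; rewrite dE.
by apply/diff_locallyP; rewrite dE; split=> //; exact: lin3_continuous.
Unshelve. all: by end_near. Qed.

Lemma grad3_eq f p a b c a' b' c' : grad3 f p a b c -> a = a' -> b = b' -> c = c' ->
  grad3 f p a' b' c'.
Proof. by move=> h <- <- <-. Qed.

Lemma grad3_cst p (r : R) : grad3 (fun=> r) p 0 0 0.
Proof.
split; first exact: differentiable_cst.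
by move=> v; rewrite diff_cst /lin3 !mul0r !addr0.
Qed.

Lemma grad3D f g p a b c a' b' c' : grad3 f p a b c -> grad3 g p a' b' c' ->
  grad3 (fun q => f q + g q) p (a + a') (b + b') (c + c').
Proof.
move=> [df fE] [dg gE]; split; first exact: differentiableD.
move=> v; rewrite diffD//= fE gE /lin3; ring.
Qed.

Lemma grad3M f g p a b c a' b' c' : grad3 f p a b c -> grad3 g p a' b' c' ->
  grad3 (fun q => f q * g q) p (f p * a' + g p * a) (f p * b' + g p * b)
    (f p * c' + g p * c).
Proof.
move=> [df fE] [dg gE]; split; first exact: differentiableM.
move=> v; rewrite (_ : (fun q => f q * g q) = f * g)//.
transitivity (f p * 'd g p v + g p * 'd f p v); first by rewrite (diffM df dg).
by rewrite fE gE /lin3; ring.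
Qed.

Lemma grad3_comp1 (h : R -> R) f p d a b c : is_derive (f p) 1 h d -> grad3 f p a b c ->
  grad3 (fun q => h (f q)) p (d * a) (d * b) (d * c).
Proof.
move=> [dh hE] [df fE].
have dh' : differentiable h (f p) by apply/derivable1_diffP.
split; first exact: differentiable_comp.
move=> v; rewrite (diff_comp df dh')/= fE.
rewrite -[lin3 a b c v]mulr1 -[_ * 1]/(_ *: (1 : R)) linearZ/= -deriveE// hE.
by rewrite /GRing.scale/= /lin3; ring.
Qed.

Lemma grad3_coord1 p : grad3 (fun q => q.1.2) p 0 1 0.
Proof.
have := @grad3_caratheodory (fun q => q.1.2) p (fun=> 0) (fun=> 1) (fun=> 0).
apply; try exact: cvg_cst.
by near=> q; rewrite !mul0r add0r addr0 mul1r.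
Unshelve. all: by end_near. Qed.

Lemma grad3_derive f p a b c (i : 'I_3) : grad3 f p a b c ->
  'D_(basis3 R i) f p = tnth [tuple a; b; c] i.
Proof.
move=> [df fE]; rewrite deriveE// fE /lin3/=.
case: i => -[|[|[|//]]] hi; rewrite (tnth_nth 0)/=; ring.
Qed.

End gradient.

(** * Density in mean square *)

Section L2_density.
Import HBNNSimple.
Context d (T : measurableType d) (R : realType) (mu : {measure set T -> \bar R}).
Variables (D : set T) (mD : measurable D) (Doo : (mu D < +oo)%E).

Definition sqdist (u v : T -> R) : \bar R := (\int[mu]_(x in D) ((u x - v x) ^+ 2)%:E)%E.

Lemma measurable_sqB (u v : T -> R) : measurable_fun D u -> measurable_fun D v ->
  measurable_fun D (fun x => ((u x - v x) ^+ 2)%:E : \bar R).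
Proof.
move=> mu_ mv; apply/measurable_EFinP; apply: (measurable_funM (measurable_funB mu_ mv)).
exact: measurable_funB.
Qed.

(** The factor [2] replaces Minkowski's inequality; it is the source of the tolerances [e / 4]
    below. *)
Lemma sqdistD (u v w : T -> R) : measurable_fun D u -> measurable_fun D v ->
  measurable_fun D w -> (sqdist u w <= 2%:E * sqdist u v + 2%:E * sqdist v w)%E.
Proof.
move=> mu_ mv mw; rewrite /sqdist -!ge0_integralZl//; try exact: measurable_sqB;
  try by move=> x _; rewrite lee_fin sqr_ge0.
rewrite -ge0_integralD//; try by [move=> x _; rewrite mule_ge0// lee_fin sqr_ge0|
  apply: measurable_funeM; exact: measurable_sqB].
apply: ge0_le_integral => //; first by move=> x _; rewrite lee_fin sqr_ge0.
- exact: measurable_sqB.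
- by apply: emeasurable_funD; apply: measurable_funeM; exact: measurable_sqB.
move=> x _; rewrite -!EFinM -EFinD lee_fin.
have := sqr_ge0 ((u x - v x) - (v x - w x)); nra.
Qed.

Variable A : set (T -> R).
Hypothesis mA : forall f, A f -> measurable_fun D f.
Hypothesis AD : forall f g, A f -> A g -> A (fun x => f x + g x).
Hypothesis AZ : forall f (c : R), A f -> A (fun x => f x * c).

Definition approximable (u : T -> R) :=
  forall e : R, 0 < e -> exists2 f, A f & (sqdist u f < e%:E)%E.

Lemma approximable_lim u : measurable_fun D u ->
  (forall e : R, 0 < e -> exists v, [/\ measurable_fun D v, approximable v & (sqdist u v < e%:E)%E]) ->
  approximable u.
Proof.
move=> mu_ H e e0.
have e40 : 0 < e / 4 by lra.
have [v [mv av uv]] := H _ e40; have [f Af vf] := av _ e40; exists f => //.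
apply: le_lt_trans (sqdistD mu_ mv (mA Af)) _.
have -> : e%:E = (2%:E * (e / 4)%:E + 2%:E * (e / 4)%:E)%E.
  by rewrite -!EFinM -EFinD; congr EFin; lra.
by apply: lteD; rewrite lte_pmul2l.
Qed.

Lemma approximable_cvg (u : T -> R) (v : nat -> T -> R) (g : T -> \bar R) :
  measurable_fun D u -> (forall n, measurable_fun D (v n)) -> (forall n, approximable (v n)) ->
  mu.-integrable D g -> (forall n x, D x -> (((u x - v n x) ^+ 2)%:E <= g x)%E) ->
  (forall x, D x -> v ^~ x @ \oo --> u x) -> approximable u.
Proof.
move=> mu_ mv av ig vg vu; apply: approximable_lim => // e e0.
have h : {ae mu, forall x, D x -> (((u x - v n x) ^+ 2)%:E @[n --> \oo] --> 0)%E}.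
  apply: aeW => x Dx; apply: cvg_EFin; first by apply: nearW.
  have h1 : u x - v n x @[n --> \oo] --> u x - u x by apply: cvgB; [exact: cvg_cst|exact: vu].
  have h2 := cvgM h1 h1; rewrite subrr mulr0 in h2; exact: h2.
have [|_ _] := dominated_convergence mD (fun n => measurable_sqB mu_ (mv n)) (measurable_cst 0%E) h ig.
  by apply: aeW => x n Dx; rewrite gee0_abs ?lee_fin ?sqr_ge0//; exact: vg.
rewrite integral0 => hc.
have e0' : (0 < e%:E)%E by rewrite lte_fin.
have : nbhs (0 : \bar R)%E [set y | (y < e%:E)%E].
  by apply: open_nbhs_nbhs; split => //; exact: open_ereal_lt_ereal.
move=> /hc[n _ hn]; exists (v n); split => //; exact: (hn n (leqnn n)).
Qed.

Lemma approximableD (u v : T -> R) : measurable_fun D u -> measurable_fun D v ->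
  approximable u -> approximable v -> approximable (fun x => u x + v x).
Proof.
move=> mu_ mv au av; apply: approximable_lim; first exact: measurable_funD.
move=> e e0; have e40 : 0 < e / 4 by lra.
have [f Af uf] := au _ e40; have [g Ag vg] := av _ e40.
have mf := mA Af; have mg := mA Ag.
exists (fun x => f x + g x); split; first exact: measurable_funD.
  move=> e' e'0; exists (fun x => f x + g x); first exact: AD.
  by rewrite /sqdist; under eq_integral do rewrite subrr expr0n; rewrite integral0 lte_fin.
have -> : e%:E = (2%:E * (e / 4)%:E + 2%:E * (e / 4)%:E)%E.
  by rewrite -!EFinM -EFinD; congr EFin; lra.
apply: le_lt_trans (sqdistD (measurable_funD mu_ mv) (measurable_funD mf mv) (measurable_funD mf mg)) _.
have -> : sqdist (u \+ v) (f \+ v) = sqdist u f.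
  by apply: eq_integral => x _ /=; congr (_ ^+ 2)%:E; ring.
have -> : sqdist (f \+ v) (f \+ g) = sqdist v g.
  by apply: eq_integral => x _ /=; congr (_ ^+ 2)%:E; ring.
by apply: lteD; rewrite lte_pmul2l.
Qed.

Lemma approximableZ (u : T -> R) (c : R) : measurable_fun D u -> approximable u -> approximable (fun x => u x * c).
Proof.
move=> mu_ au e e0.
have c0 : 0 < c ^+ 2 + 1 by have := sqr_ge0 c; lra.
have [f Af uf] := au _ (divr_gt0 e0 c0); exists (fun x => f x * c); first exact: AZ.
apply: le_lt_trans (_ : _ <= (c ^+ 2 + 1)%:E * sqdist u f)%E _; last first.
  by rewrite muleC -lte_pdivlMr// muleC -EFinM mulrC.
have mf := mA Af.
rewrite /sqdist -ge0_integralZl//; [|exact: measurable_sqB|by move=> x _; rewrite lee_fin sqr_ge0|by rewrite lee_fin ltW].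
apply: ge0_le_integral => //.
- by move=> x _; rewrite lee_fin sqr_ge0.
- by apply: measurable_sqB; apply: measurable_funM => //; exact: measurable_cst.
- by apply: measurable_funeM; exact: measurable_sqB.
move=> x _; rewrite -EFinM lee_fin -mulrBl exprMn mulrC ler_wpM2r ?sqr_ge0//; lra.
Qed.

Lemma approximable_sum (I : Type) (s : seq I) (F : I -> T -> R) :
  A (fun=> 0) ->
  (forall i, measurable_fun D (F i)) -> (forall i, approximable (F i)) ->
  approximable (fun x => \sum_(i <- s) F i x).
Proof.
move=> A0 mF aF; elim: s => [|i s IH].
  move=> e e0; exists (fun=> 0) => //.
  by rewrite /sqdist; under eq_integral do rewrite big_nil subrr expr0n; rewrite integral0 lte_fin.
under [X in approximable X]eq_fun do rewrite big_cons.
by apply: approximableD => //; exact: measurable_sum.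
Qed.

Hypothesis A0 : A (fun=> 0).

(** The sets with approximable indicator form a Dynkin system: complements come from linearity,
    disjoint unions from dominated convergence with bound [1], as [D] has finite measure. *)
Lemma approximable_indic (G : set (set T)) : @measurable _ T = <<s G >> -> setI_closed G ->
  approximable (fun=> 1) -> (forall E, G E -> approximable (\1_E)) ->
  forall E, measurable E -> approximable (\1_E).
Proof.
move=> mG GI a1 aG E; rewrite mG.
have mI (S : set T) : measurable S -> measurable_fun D (\1_S : T -> R).
  by move=> mS; exact: measurable_indic.
apply: (@dynkin_induction _ _ G (fun S => approximable (\1_S)) mG GI).
- by rewrite indicT.
- exact: aG.
- move=> S mS aS.
  rewrite (_ : \1_(~` S) = fun x => 1 + \1_S x * (-1)); last first.
    by apply/funext => x; rewrite indicC indicE; case: (_ \in _) => /=; ring.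
  apply: approximableD => //; last by apply: approximableZ => //; exact: mI.
  by apply: measurable_funM => //; exact: mI.
- move=> F mF tF aF.
  have ig : mu.-integrable D (fun=> 1%:E : \bar R).
    by apply/integrableP; split; [exact: measurable_cst|rewrite integral_cst//= normr1 mul1e].
  have partial01 n x : 0 <= \sum_(k <- index_iota 0 n) (\1_(F k) x : R) <= 1.
    have h : ((\sum_(k <- index_iota 0 n) \1_(F k) x)%:E <= (\1_(\bigcup_k F k) x)%:E :> \bar R)%E.
      rewrite indic_bigcup// -sumEFin; apply: nneseries_lim_ge => k _ _; by rewrite lee_fin.
    rewrite sumr_ge0//=; move: h; rewrite lee_fin => /le_trans; apply.
    by rewrite indicE; case: (_ \in _).
  apply: (@approximable_cvg _ (fun n x => \sum_(k <- index_iota 0 n) \1_(F k) x) (fun=> 1%:E)) => //.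
  + by apply: mI; exact: bigcup_measurable.
  + by move=> n; apply: measurable_sum => k; exact: mI.
  + by move=> n; apply: approximable_sum => // k; exact: mI.
  + move=> n x _; rewrite lee_fin; have := partial01 n x.
    have : 0 <= (\1_(\bigcup_k F k) x : R) <= 1 by rewrite indicE; case: (_ \in _); rewrite /= ?lexx ?ler01.
    move: (\sum_(k <- _) _) (\1_(\bigcup_k F k) x) => a b; nra.
  + move=> x _.
    suff /fine_cvgP[] : ((\sum_(k <- index_iota 0 n) \1_(F k) x)%:E @[n --> \oo] -->
        (\1_(\bigcup_k F k) x : R)%:E)%E by [].
    rewrite indic_bigcup//.
    have h : cvgn (fun n => \sum_(0 <= k < n) (\1_(F k) x)%:E : \bar R)%E.
      by apply: is_cvg_nneseries => k _ _; rewrite lee_fin.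
    by move: h; under eq_fun do rewrite sumEFin.
Qed.

(** Simple functions increase to the positive and the negative part of [u]; the squared errors are
    dominated by [u ^+ 2]. *)
Lemma approximable_sqi (u : T -> R) :
  (forall E, measurable E -> approximable (\1_E)) ->
  measurable_fun D u -> mu.-integrable D (fun x => (u x ^+ 2)%:E) -> approximable u.
Proof.
move=> aI mu_ iu.
have pos (w : T -> R) : measurable_fun D w -> (forall x, D x -> 0 <= w x) ->
    (forall x, D x -> w x ^+ 2 <= u x ^+ 2) -> approximable w.
  move=> mw w0 wu; have mw' : measurable_fun D (EFin \o w) by apply/measurable_EFinP.
  have w0' x : D x -> (0 <= (EFin \o w) x)%E by move=> Dx; rewrite lee_fin; exact: w0.
  have cvw x Dx := @cvg_nnsfun_approx _ _ _ D mD _ mw' w0' x Dx.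
  pose v n : T -> R := nnsfun_approx mD mw' n.
  have cv x : D x -> v ^~ x @ \oo --> w x.
    by move=> Dx; have /fine_cvgP[] := cvw x Dx.
  have mv n : measurable_fun D (v n) by exact: measurable_funTS.
  apply: (@approximable_cvg _ v _ mw mv _ iu) => // n.
  - rewrite (_ : v n = fun x => \sum_(y <- finmap.enum_fset (fset_set (range (v n))))
       \1_(v n @^-1` [set y]) x * y).
      apply: approximable_sum => //.
        by move=> y; apply: measurable_funM => //; exact: measurable_indic.
      move=> y; apply: approximableZ; first exact: measurable_indic.
      exact: aI.
    apply/funext => x; rewrite {1}/v fimfunE fsbig_finite//=.
    by apply: eq_bigr => y _; rewrite mulrC.
  - move=> x Dx; rewrite lee_fin; apply: le_trans (wu x Dx).
    have v0 : 0 <= v n x by [].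
    have vw : v n x <= w x.
      have nv : nondecreasing_seq (v ^~ x).
        by move=> i j ij; have /lefP := nd_nnsfun_approx mD mw' ij; apply.
      have := nondecreasing_cvgn_le nv (cvgP _ (cv x Dx)) n.
      by rewrite (cvg_lim _ (cv x Dx)).
    by rewrite ler_sqr ?nnegrE; lra.
have -> : u = fun x => Num.max (u x) 0 + Num.max (- u x) 0 * (-1).
  by apply/funext => x; rewrite /Num.max; do 2 case: ifPn; rewrite -?leNgt; lra.
have mp : measurable_fun D (fun x => Num.max (u x) 0) by exact: measurable_funrpos.
have mn : measurable_fun D (fun x => Num.max (- u x) 0) by exact: measurable_funrneg.
apply: approximableD => //; first by apply: measurable_funM.
  apply: pos => // x _; rewrite /Num.max; case: ifPn; rewrite -?leNgt// => _; nra.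
apply: approximableZ => //; apply: pos => // x _; rewrite /Num.max; case: ifPn; rewrite -?leNgt// => _; nra.
Qed.

End L2_density.

Section open_indicator.
Context d (T : measurableType d) (R : realType) (mu : {measure set T -> \bar R}).
Variables (D : set T) (mD : measurable D) (Doo : (mu D < +oo)%E).
Variable A : set (T -> R).
Hypothesis mA : forall f, A f -> measurable_fun D f.
Hypothesis AD : forall f g, A f -> A g -> A (fun x => f x + g x).
Hypothesis AM : forall f g, A f -> A g -> A (fun x => f x * g x).
Hypothesis AZ : forall f (c : R), A f -> A (fun x => f x * c).
Hypothesis A0 : A (fun=> 0).

(* [1 - \prod_(i < n) (1 - b i) ^+ n] over the indices [i] with [b i > 0] only in [U]
   tends to the indicator of [U]. *)
Lemma approximable_union (b : nat -> T -> R) (U : set T) : measurable U ->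
  (forall n, A (b n)) -> (forall n x, 0 <= b n x <= 1) ->
  (forall x, D x -> U x -> exists n, 0 < b n x /\ forall y, D y -> 0 < b n y -> U y) ->
  approximable mu D A (\1_U).
Proof.
move=> mU Ab b01 cover.
pose good n := `[< forall y, D y -> 0 < b n y -> U y >].
pose g (m i : nat) x := if good i then (1 - b i x) ^+ m else 1.
pose v n x := 1 - \prod_(i < n) g n i x.
have co_M (f h : T -> R) : A (fun x => 1 - f x) -> A (fun x => 1 - h x) -> A (fun x => 1 - f x * h x).
  move=> hf hh; rewrite (_ : (fun x => _) =
    fun x => (1 - f x) + ((1 - h x) + ((1 - f x) * (1 - h x)) * (-1))); last first.
    by apply/funext => x; ring.
  by apply: AD => //; apply: AD => //; apply: AZ; exact: AM.
have co_1 : A (fun x : T => 1 - 1) by rewrite subrr.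
have Ag m i : A (fun x => 1 - g m i x).
  rewrite /g; case: (good i) => //.
  elim: m => [|m IH]; first by under eq_fun do rewrite expr0.
  under eq_fun do rewrite exprS; apply: co_M => //.
  by under eq_fun do rewrite opprB addrC subrK.
have Av n : A (v n).
  have H m : A (fun x => 1 - \prod_(i < m) g n i x).
    elim: m => [|m IH]; first by under eq_fun do rewrite big_ord0.
    by under eq_fun do rewrite big_ord_recr/=; exact: co_M.
  exact: H.
have mv n : measurable_fun D (v n) by exact: mA.
have g01 m i x : 0 <= g m i x <= 1.
  rewrite /g; case: (good i); last by rewrite ler01 lexx.
  have h := b01 i x; rewrite exprn_ge0 ?exprn_ile1//; lra.
have prod01 m n x : 0 <= \prod_(i < m) g n i x <= 1.
  elim: m => [|m IH]; first by rewrite big_ord0 ler01 lexx.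
  rewrite big_ord_recr/=; have := g01 n m x; move: (\prod_(i < m) _) (g n m x) IH => a c; nra.
have ig : mu.-integrable D (fun=> 1%:E : \bar R).
  by apply/integrableP; split; [exact: measurable_cst|rewrite integral_cst//= normr1 mul1e].
apply: (@approximable_cvg _ _ _ mu D mD A mA _ v (fun=> 1%:E)) => //.
- move=> n e e0; exists (v n) => //.
  by rewrite /sqdist; under eq_integral do rewrite subrr expr0n; rewrite integral0 lte_fin.
- move=> n x _; rewrite lee_fin /v; have := prod01 n n x.
  have : 0 <= (\1_U x : R) <= 1 by rewrite indicE; case: (_ \in _); rewrite /= ?lexx ?ler01.
  move: (\prod_(_ < _) _) (\1_U x) => a c; nra.
move=> x Dx; rewrite indicE; have [Ux|nUx] := pselect (U x); last first.
  rewrite memNset//= (_ : (fun n => v n x) = fun=> 0); first exact: cvg_cst.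
  apply/funext => n; rewrite /v big1 ?subrr// => i _; rewrite /g /good; case: asboolP => // h.
  have /andP[bi0 _] := b01 i x.
  have -> : b i x = 0 by apply/eqP; rewrite eq_le bi0 andbT leNgt; apply/negP => /(h x Dx).
  by rewrite subr0 expr1n.
rewrite mem_set//=; have [i [bi hi]] := cover x Dx Ux.
rewrite -[X in _ --> X](subr0 1); apply: cvgB; first exact: cvg_cst.
have bi1 := b01 i x.
(* All factors lie in the unit interval, so the single good index [i] already bounds the product by
   [(1 - b i x) ^+ n]. *)
apply: (@squeeze_cvgr _ _ _ _ (fun=> 0) (fun n => (1 - b i x) ^+ n)); last 2 first.
- exact: cvg_cst.
- by apply: cvg_expr; rewrite ger0_norm; lra.
near=> n; have /andP[-> _] /= := prod01 n n x.
have ni : (i < n)%N by near: n; exact: nbhs_infty_gt.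
rewrite (bigD1 (Ordinal ni))//= {1}/g ifT; last exact/asboolP.
rewrite ler_piMr ?exprn_ge0//; first lra.
apply: prodr_ile1 => j _; exact: g01.
Unshelve. all: by end_near. Qed.

End open_indicator.

(** * Rational boxes and the Borel sets of space *)

Section boxes.
Variable R : realType.
Local Notation M := (measurableTypeR R * measurableTypeR R * measurableTypeR R)%type.

Definition box (q : rat * rat * (rat * rat) * (rat * rat)) : set (R3 R) :=
  [set p | [/\ ratr q.1.1.1 < (p.1.1 : R) < ratr q.1.1.2, ratr q.1.2.1 < (p.1.2 : R) < ratr q.1.2.2 &
     ratr q.2.1 < (p.2 : R) < ratr q.2.2]].

Lemma box_nbhs (U : set (R3 R)) p (e : R) : 0 < e -> nbhs p U -> exists q,
  [/\ box q p, box q `<=` U, p.1.1 - e < ratr q.1.1.1 /\ ratr q.1.1.2 < p.1.1 + e,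
    p.1.2 - e < ratr q.1.2.1 /\ ratr q.1.2.2 < p.1.2 + e &
    p.2 - e < ratr q.2.1 /\ ratr q.2.2 < p.2 + e].
Proof.
move=> e0 /nbhs_ballP[d /= d0 hd].
pose m := Num.min d e; have m0 : 0 < m by rewrite lt_min d0 e0.
have [md me] : m <= d /\ m <= e by rewrite /m !ge_min !lexx orbT.
have rat1 (a : R) : exists q : rat * rat, [/\ (ratr q.1 < a < ratr q.2),
    (forall t : R, ratr q.1 < t < ratr q.2 -> `|a - t| < d) & a - e < ratr q.1 /\ ratr q.2 < a + e].
  have [q1] := @rat_in_itvoo R (a - m) a ltac:(lra); rewrite in_itv/= => h1.
  have [q2] := @rat_in_itvoo R a (a + m) ltac:(lra); rewrite in_itv/= => h2.
  by exists (q1, q2); split => /= [|t ht|]; [lra|rewrite ltr_norml; lra|lra].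
have [q1 [a1 b1 c1]] := rat1 p.1.1; have [q2 [a2 b2 c2]] := rat1 p.1.2; have [q3 [a3 b3 c3]] := rat1 p.2.
exists (q1, q2, q3); split => // t [h1 h2 h3].
apply: hd; split => /=; first split => /=; rewrite -ball_normE /=.
- exact: b1.
- exact: b2.
- exact: b3.
Qed.

Lemma measurable_box q : measurable (box q : set M).
Proof.
rewrite (_ : box q = (`]ratr q.1.1.1, ratr q.1.1.2[ `*` `]ratr q.1.2.1, ratr q.1.2.2[) `*`
   `]ratr q.2.1, ratr q.2.2[); last first.
  by apply/seteqP; split => -[[a b] c] /=; rewrite !in_itv/= => -[]; [move=> ? ? ?|move=> -[]].
by apply: measurableX; [apply: measurableX|]; exact: measurable_itv.
Qed.

Lemma open_measurable3 (U : set (R3 R)) : open U -> measurable (U : set M).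
Proof.
move=> oU.
pose F n : set (R3 R) := if unpickle n is Some q then if `[< box q `<=` U >] then box q else set0 else set0.
rewrite (_ : U = \bigcup_n F n).
  apply: bigcupT_measurable => n; rewrite /F; case: unpickle => [q|//].
  by case: asboolP => // _; exact: measurable_box.
apply/seteqP; split => [p Up|p [n _]].
  have [q [qp qU _ _ _]] := box_nbhs ltr01 (open_nbhs_nbhs (conj oU Up)).
  exists (pickle q); first exact: I.
  by rewrite /F pickleK (asboolT qU).
by rewrite /F; case: unpickle => [q|//]; case: asboolP => // qU /qU.
Qed.

(** Open sets are the generators suited to the Dynkin argument: they are stable under intersection,
    and unlike Cartesian boxes they are described equally well by boxes in the tube coordinates. *)
Lemma measurable3E : @measurable _ M = <<s [set U : set (R3 R) | open U] >>.
Proof.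
apply/seteqP; split; last first.
  by apply: smallest_sub; [exact: sigma_algebra_measurable|exact: open_measurable3].
pose T0 := g_sigma_algebraType [set U : set (R3 R) | open U].
have mo (f : R3 R -> R) : continuous f -> measurable_fun setT (f : T0 -> measurableTypeR R).
  move=> cf; apply: (measurability _ (RGenOpens.measurableE R)).
  move=> _ [_ [a [b ->]] <-]; rewrite setTI; apply: sub_sigma_algebra => /=.
  by move/continuousP : cf; apply; exact: interval_open.
have : measurable_fun setT (id : T0 -> M).
  apply/measurable_fun_pairP; split; last by apply: mo => p; exact: cvg_snd.
  apply/measurable_fun_pairP; split; apply: mo => p.
    by apply: continuous_comp; exact: cvg_fst.
  by apply: continuous_comp; [exact: cvg_fst|exact: cvg_snd].
by move=> mid E mE; have := mid measurableT E mE; rewrite setTI.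
Qed.

Lemma continuous_measurable3 (D : set (R3 R)) (f : R3 R -> R) : open D ->
  (forall p, D p -> {for p, continuous f}) -> measurable_fun (D : set M) f.
Proof.
move=> oD cf mD; apply: (measurability _ (RGenOpens.measurableE R)) => //.
move=> _ [_ [a [b ->]] <-]; apply: open_measurable3.
rewrite openE => p [Dp fp]; rewrite /interior; apply: filterI.
  by apply: open_nbhs_nbhs.
by apply: cf => //; apply: open_nbhs_nbhs; split => //; exact: interval_open.
Qed.

End boxes.

(** * Vanishing integrals and the reflection *)

Section divergence.
Variable R : realType.
Local Notation mu := (@lebesgue_measure R).
Local Notation M := (measurableTypeR R * measurableTypeR R * measurableTypeR R)%type.
Local Notation M2 := (measurableTypeR R * measurableTypeR R)%type.

Lemma integral_derive_line (h h' : R -> R) (K : R) :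
  (forall t : R, is_derive t 1 h (h' t)) -> continuous h' ->
  (forall t, K < `|t| -> h t = 0 /\ h' t = 0) -> (\int[mu]_t (h' t)%:E = 0)%E.
Proof.
move=> dh ch h0.
pose K' := `|K| + 1; have K0 : 0 <= `|K| := normr_ge0 K; have KK : K <= `|K| := ler_norm K.
have out t : K' <= `|t| -> h t = 0 /\ h' t = 0 by move=> ht; apply: h0; rewrite /K' in ht; lra.
transitivity (\int[mu]_(t in `[(- K')%R, K']) (h' t)%:E)%E.
  rewrite [RHS]integral_mkcond; apply: eq_integral => t _.
  rewrite patchE; case: ifPn => // /negP ht.
  suff /out[_ ->] : K' <= `|t| by [].
  rewrite leNgt; apply/negP => lt; apply: ht.
  by rewrite inE /= in_itv/=; move: lt; rewrite ltr_norml; lra.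
have [hK _] := out K' (ler_norm _); have [hNK _] := out (- K') ltac:(rewrite normrN; exact: ler_norm).
rewrite (@continuous_FTC2 _ h' h); first by rewrite hK hNK sube0.
- by rewrite /K'; lra.
- exact: continuous_subspaceT.
- have ct : continuous h by move=> s; apply: is_derive_continuous (dh s).
  split.
  + by move=> s _; have [] := dh s.
  + by apply: cvg_at_right_filter; exact: ct.
  + by apply: cvg_at_left_filter; exact: ct.
- by move=> s _; rewrite derive1E; have [_ ->] := dh s.
Qed.

Lemma integrable_bounded_support d (T : measurableType d) (m : {measure set T -> \bar R})
    (g : T -> R) (A : set T) (B : R) : measurable A -> (m A < +oo)%E -> measurable_fun setT g ->
  (forall x, `|g x| <= B) -> (forall x, ~ A x -> g x = 0) -> m.-integrable setT (EFin \o g).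
Proof.
move=> mA Aoo mg gB g0.
have ig : m.-integrable A (EFin \o g).
  apply: measurable_bounded_integrable => //; first exact: measurable_funTS.
  by exists B; split; [exact: num_real|move=> b Bb x _; apply: (le_trans (gB x)); exact: ltW].
move/(integrable_mkcond _ mA) : ig; congr (_.-integrable _ _).
apply/funext => x; rewrite patchE; case: ifPn => // /negP hx.
by rewrite /= g0// => Ax; apply: hx; rewrite inE.
Qed.

Definition cube (K : R) : set (R3 R) := [set p | [/\ `|p.1.1| <= K, `|p.1.2| <= K & `|p.2| <= K]].

Lemma segmentE (K : R) : [set t : R | `|t| <= K] = `[- K, K]%classic.
Proof. by apply/seteqP; split => t /=; rewrite in_itv/= ler_norml. Qed.

Lemma cubeE K : cube K = ([set t | `|t| <= K] `*` [set t | `|t| <= K]) `*` [set t | `|t| <= K].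
Proof. by apply/seteqP; split => -[[a b] c] /= []; [move=> ? ? ?|move=> -[]]. Qed.

Lemma measurable_segment (K : R) : measurable ([set t : R | `|t| <= K] : set (measurableTypeR R)).
Proof. by rewrite segmentE; exact: measurable_itv. Qed.

Lemma segment_fin (K : R) : (mu [set t : R | (`|t| <= K)%R] < +oo)%E.
Proof.
rewrite segmentE lebesgue_measure_itv/=; case: ifPn => // _.
by rewrite -EFinB ltry.
Qed.

Lemma square_fin (K : R) :
  ((mu \x mu)%E ([set t : R | (`|t| <= K)%R] `*` [set t : R | (`|t| <= K)%R]) < +oo)%E.
Proof.
have mK := measurable_segment K.
rewrite product_measure1E//; apply: lte_mul_pinfty => //; last exact: segment_fin.
by rewrite ge0_fin_numE//; exact: segment_fin.
Qed.

Lemma area_sigma_finite : sigma_finite setT (mu \x mu)%E.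
Proof.
exists (fun n => [set t : R | (`|t| <= n%:R)%R] `*` [set t : R | (`|t| <= n%:R)%R]).
  apply/seteqP; split => // -[a b] _; exists (Num.truncn (Num.max `|a| `|b|)).+1 => //=.
  by have := truncnS_gt (Num.max `|a| `|b|); rewrite gt_max => /andP[h1 h2]; split; exact: ltW.
move=> n; split; last exact: square_fin.
by apply: measurableX; exact: measurable_segment.
Qed.

(* A copy of [mu \x mu], whose own canonical structures would hide this
   sigma-finite instance. *)
Definition area : set M2 -> \bar R := (mu \x mu)%E.

HB.instance Definition _ := Measure.copy area ((mu \x mu)%E : {measure set M2 -> \bar R}).
HB.instance Definition _ := Measure_isSigmaFinite.Build _ _ _ area area_sigma_finite.

Lemma measurable_cube K : measurable (cube K : set M).
Proof.
have mK := measurable_segment K.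
by rewrite cubeE; apply: measurableX => //; exact: measurableX.
Qed.

Lemma vol3E (E : set M) : vol3 R E = ((mu \x mu) \x mu)%E E.
Proof. by []. Qed.

Lemma cube_fin K : (vol3 R (cube K) < +oo)%E.
Proof.
have mK := measurable_segment K.
rewrite cubeE vol3E product_measure1E//; last exact: measurableX.
apply: lte_mul_pinfty => //; last exact: segment_fin.
by rewrite ge0_fin_numE//; exact: square_fin.
Qed.

Section partial.
Variables (f g : R3 R -> R) (K B : R).
Hypothesis cg : continuous g.
Hypothesis gB : forall p, `|g p| <= B.
Hypothesis f0 : forall p, ~ cube K p -> f p = 0.
Hypothesis g0 : forall p, ~ cube K p -> g p = 0.

Let mg : measurable_fun (setT : set M) g.
Proof. by apply: continuous_measurable3; [exact: openT|move=> p _; exact: cg]. Qed.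

Let ig : ((mu \x mu) \x mu)%E.-integrable setT (EFin \o g).
Proof. exact: integrable_bounded_support (measurable_cube K) (@cube_fin K) mg gB g0. Qed.

Lemma integral_partial_z : (forall a b c : R, is_derive c 1 (fun t => f (a, b, t)) (g (a, b, c))) ->
  (\int[vol3 R]_p (g p)%:E = 0)%E.
Proof.
move=> dfg; transitivity (\int[((mu \x mu) \x mu)%E]_p (EFin \o g) p)%E; first by [].
rewrite -(@integral12_prod_meas1 _ _ _ _ R area mu (EFin \o g) ig).
have line (a b : R) : (\int[mu]_t (g (a, b, t))%:E = 0)%E.
  apply: (@integral_derive_line (fun t => f (a, b, t)) (fun t => g (a, b, t)) K).
  - have ci : continuous (fun t : R => (a, b, t)).
      by apply: continuous_pair => t; [exact: cvg_cst|exact: cvg_id].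
    by move=> t; apply: (@continuous_comp _ _ _ (fun t : R => (a, b, t)) g); [exact: ci|exact: cg].
  - by move=> t Kt; split; [apply: f0|apply: g0] => -[_ _ /=]; rewrite leNgt Kt.
by rewrite -[RHS](integral0 (mu \x mu)%E setT); apply: eq_integral => -[a b] _; exact: line.
Qed.

(** The first coordinate sits inside the left factor of the product measure, so Fubini is applied to
    the outer product and then to each slice. *)
Lemma integral_partial_x : (forall a b c : R, is_derive a 1 (fun t => f (t, b, c)) (g (a, b, c))) ->
  (\int[vol3 R]_p (g p)%:E = 0)%E.
Proof.
move=> dfg; transitivity (\int[((mu \x mu) \x mu)%E]_p (EFin \o g) p)%E; first by [].
rewrite -(@integral21_prod_meas1 _ _ _ _ R area mu (EFin \o g) ig).
have line (b c : R) : (\int[mu]_t (g (t, b, c))%:E = 0)%E.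
  apply: (@integral_derive_line (fun t => f (t, b, c)) (fun t => g (t, b, c)) K).
  - have ci : continuous (fun t : R => (t, b, c)).
      by apply: continuous_pair => [|t]; [apply: continuous_pair => t; [exact: cvg_id|exact: cvg_cst]|exact: cvg_cst].
    by move=> t; apply: (@continuous_comp _ _ _ (fun t : R => (t, b, c)) g); [exact: ci|exact: cg].
  - by move=> t Kt; split; [apply: f0|apply: g0] => -[/=]; rewrite leNgt Kt.
rewrite -[RHS](integral0 mu setT); apply: eq_integral => c _.
have mgc : measurable_fun setT (fun ab : M2 => g (ab, c)) by exact: (measurable_fun_pair1 (f := g) c mg).
have igc : (mu \x mu)%E.-integrable setT (EFin \o (fun ab : M2 => g (ab, c))).
  apply: (integrable_bounded_support _ (square_fin K) mgc (fun ab => gB (ab, c))).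
    by apply: measurableX; exact: measurable_segment.
  by move=> ab nab; apply: g0 => -[h1 h2 _]; apply: nab.
rewrite /fubini_G -(integral21_prod_meas1 igc).
by rewrite -[RHS](integral0 mu setT); apply: eq_integral => b _; exact: line.
Qed.

End partial.

Definition flip (p : R3 R) : R3 R := (- p.1.1, p.1.2, p.2).

Lemma measurable_flip : measurable_fun setT (flip : M -> M).
Proof.
apply/measurable_fun_pairP; split; last exact: measurable_snd.
apply/measurable_fun_pairP; split.
  apply: (@continuous_measurable3 R setT (fun p => - p.1.1)) openT _ => p _.
  by apply: cvgN; exact: cont_fst1.
by apply: (@continuous_measurable3 R setT (fun p => p.1.2)) openT _ => p _; exact: cont_fst2.
Qed.

(** Uniqueness of the product measure, applied once per product, reduces this to the reflection
    invariance of Lebesgue measure on the line. *)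
Lemma vol3_flip (A : set M) : measurable A -> pushforward (vol3 R) (flip : M -> M) A = vol3 R A.
Proof.
move=> mA.
pose flip2 (q : M2) : M2 := (- q.1, q.2).
have mf2 : measurable_fun setT (flip2 : M2 -> M2).
  apply/measurable_fun_pairP; split; last exact: measurable_snd.
  by apply: measurable_funN; exact: measurable_fst.
have mN (E : set (measurableTypeR R)) : measurable E -> measurable ((-%R : R -> measurableTypeR R) @^-1` E).
  by move=> mE; rewrite -[X in measurable X]setTI; exact: oppr_measurable.
have h2 (E : set M2) : measurable E -> (mu \x mu)%E (flip2 @^-1` E) = (mu \x mu)%E E.
  move=> mE; apply/esym.
  apply: (@product_measure_unique _ _ _ _ R mu mu (pushforward (mu \x mu)%E (flip2 : M2 -> M2))) => // X Y mX mY.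
  transitivity ((mu \x mu)%E (((-%R : R -> measurableTypeR R) @^-1` X) `*` Y)); first by [].
  rewrite product_measure1E//; last exact: mN.
  by congr (_ * _)%E; exact: lebesgue_measureN.
apply/esym; rewrite /vol3; have mf := measurable_flip.
apply: (@product_measure_unique _ _ _ _ R area mu (pushforward ((mu \x mu) \x mu)%E (flip : M -> M))) => // X Y mX mY.
transitivity (((mu \x mu) \x mu)%E ((flip2 @^-1` X) `*` Y)); first by [].
rewrite product_measure1E; [by congr (_ * _)%E; exact: h2 mX| |exact: mY].
by rewrite -[X in measurable X]setTI; exact: mf2.
Qed.

Lemma integral_flip (D : set M) (w : M -> \bar R) : measurable D -> measurable_fun D w ->
  (forall p, (0 <= w p)%E) -> flip @^-1` D = D ->
  (\int[vol3 R]_(p in D) w (flip p) = \int[vol3 R]_(p in D) w p)%E.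
Proof.
move=> mD mw w0 fD.
have := ge0_integral_pushforward measurable_flip (vol3 R) mD mw (fun p _ => w0 p).
rewrite fD => H; apply: etrans (esym H) _.
have mf := measurable_flip.
by apply: (eq_measure_integral (vol3 R)) => A mA _; exact: vol3_flip.
Qed.

End divergence.

Section slices.
Variable R : realType.
Implicit Type f : R3 R -> R.

Lemma grad3_slice f (g : R -> R3 R) (t a b c da db dc : R) : derivable (fst \o (fst \o g)) t 1 ->
  derivable (snd \o (fst \o g)) t 1 -> derivable (snd \o g) t 1 ->
  derive1 (fst \o (fst \o g)) t = da -> derive1 (snd \o (fst \o g)) t = db ->
  derive1 (snd \o g) t = dc ->
  grad3 f (g t) a b c -> is_derive t 1 (fun u => f (g u)) (a * da + b * db + c * dc).
Proof.
move=> d1 d2 d3 e1 e2 e3 [df dfE].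
have gE : g = fun u => ((fst \o (fst \o g)) u, (snd \o (fst \o g)) u, (snd \o g) u).
  by apply/funext => u /=; case: (g u) => -[].
have dg : differentiable g t.
  rewrite gE; apply: differentiable_pair; last exact/derivable1_diffP.
  by apply: differentiable_pair; exact/derivable1_diffP.
have dfg : differentiable (f \o g) t by exact: differentiable_comp.
split; first by apply/derivable1_diffP.
rewrite -[LHS]/('D_1 (f \o g) t) deriveE// diff_comp//= dfE.
have -> : 'd g t 1 = (da, db, dc).
  by rewrite -deriveE// -derive1E gE derive1_triple// e1 e2 e3.
by [].
Qed.

Lemma grad3_slice_x f (s b c f0 f1 f2 : R) : grad3 f (s, b, c) f0 f1 f2 ->
  is_derive s 1 (fun t => f (t, b, c)) f0.
Proof.
move=> gf; apply: is_derive_eq (@grad3_slice f (fun t => (t, b, c)) s f0 f1 f2 1 0 0 _ _ _ _ _ _ gf) _.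
- exact: derivable_id.
- exact: derivable_cst.
- exact: derivable_cst.
- exact: derive1_id.
- exact: derive1_cst.
- exact: derive1_cst.
- by ring.
Qed.

Lemma grad3_slice_z f (a b s f0 f1 f2 : R) : grad3 f (a, b, s) f0 f1 f2 ->
  is_derive s 1 (fun t => f (a, b, t)) f2.
Proof.
move=> gf; apply: is_derive_eq (@grad3_slice f (fun t => (a, b, t)) s f0 f1 f2 0 0 1 _ _ _ _ _ _ gf) _.
- exact: derivable_cst.
- exact: derivable_cst.
- exact: derivable_id.
- exact: derive1_cst.
- exact: derive1_cst.
- exact: derive1_id.
- by ring.
Qed.

Lemma grad3_uniq f p (a b c a' b' c' : R) : grad3 f p a b c -> grad3 f p a' b' c' ->
  [/\ a = a', b = b' & c = c'].
Proof.
move=> [_ h] [_ h'].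
have e v : lin3 a b c v = lin3 a' b' c' v by rewrite -h h'.
move: (e (1, 0, 0)) (e (0, 1, 0)) (e (0, 0, 1)); rewrite /lin3/= !mulr1 !mulr0 !addr0 !add0r.
by move=> -> -> ->.
Qed.

End slices.

Section square_integrable_functions.
Variables (R : realType) (D : set (R3 R)).
Local Notation M := (measurableTypeR R * measurableTypeR R * measurableTypeR R)%type.
Hypothesis mD : measurable (D : set M).

Lemma integrable_sqM (u v : R3 R -> R) : square_integrable D u -> square_integrable D v ->
  (vol3 R).-integrable D (EFin \o (fun p => u p * v p)).
Proof.
move=> [mu iu] [mv iv]; apply: (le_integrable mD _ _ (integrableD mD iu iv)).
  by apply/measurable_EFinP; exact: measurable_funM.
move=> p _ /=; rewrite lee_fin [in leRHS]ger0_norm ?addr_ge0 ?sqr_ge0//.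
have h1 := sqr_ge0 (u p + v p); have h2 := sqr_ge0 (u p - v p).
have h3 := sqr_ge0 (u p); have h4 := sqr_ge0 (v p).
by rewrite ler_norml; apply/andP; split; nra.
Qed.

Lemma square_integrableE (u : R3 R -> R) : square_integrable D u ->
  (vol3 R).-integrable D (EFin \o (fun p => u p ^+ 2)).
Proof. by case. Qed.

End square_integrable_functions.

(** Here [a] is a value of [u], [j] of [J], and [b], [c] are the values at a point and its mirror
    image of an approximant of [u * J]. The error of the odd part is the mean of two errors, whose
    square is at most the mean of the squares. *)
Lemma odd_part_sq (R : realType) (a b c j m : R) : 0 < m -> m <= j ->
  (a - (b * 2^-1 - c * 2^-1) / j) ^+ 2 <= m ^- 2 * (2^-1 * (a * j - b) ^+ 2 + 2^-1 * (- a * j - c) ^+ 2).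
Proof.
move=> m0 mj; have j0 : 0 < j by lra.
have jn : j != 0 by rewrite gt_eqF.
have -> : a - (b * 2^-1 - c * 2^-1) / j = ((a * j - b) + (a * j + c)) / 2 / j by field.
have -> : (- a * j - c) ^+ 2 = (a * j + c) ^+ 2 by ring.
rewrite expr_div_n mulrC; apply: ler_pM; rewrite ?invr_ge0 ?sqr_ge0//.
  by rewrite lef_pV2 ?posrE ?exprn_gt0// ler_sqr ?nnegrE; lra.
have := sqr_ge0 ((a * j - b) - (a * j + c)); nra.
Qed.

Lemma segment_itvoo (R : realType) (a b c t : R) : 0 <= t <= 1 -> 0 < a < c -> 0 < b < c ->
  0 < a + t * (b - a) < c.
Proof.
move=> /andP[t0 t1] ha hb; have [ab|ab] := leP a b.
  have h1 : 0 <= t * (b - a) by rewrite mulr_ge0// subr_ge0.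
  have h2 : t * (b - a) <= b - a by rewrite ler_piMl// subr_ge0.
  lra.
have h1 : 0 <= t * (a - b) by rewrite mulr_ge0// subr_ge0 ltW.
have h2 : t * (a - b) <= a - b by rewrite ler_piMl// subr_ge0 ltW.
rewrite (_ : a + t * (b - a) = a - t * (a - b)); last by ring.
lra.
Qed.

Lemma near_gt (R : realType) (V : topologicalType) (f : V -> R) p c :
  {for p, continuous f} -> c < f p -> \forall q \near p, c < f q.
Proof. by move=> cf h; exact: (cf _ (lt_nbhsr h)). Qed.

Lemma near_lt (R : realType) (V : topologicalType) (f : V -> R) p c :
  {for p, continuous f} -> f p < c -> \forall q \near p, f q < c.
Proof. by move=> cf h; exact: (cf _ (lt_nbhsl h)). Qed.

(** * Analysis in the tube *)

Section tube_coordinates.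
Variables (R : realType) (L T delta : R) (xd zd : nat -> R -> R).
Hypothesis L_gt0 : 0 < L.
Hypothesis dx : forall n (s : R), is_derive s 1 (xd n) (xd n.+1 s).
Hypothesis dz : forall n (s : R), is_derive s 1 (zd n) (zd n.+1 s).
Hypothesis unit_speed : forall s : R, 0 <= s <= L -> xd 1 s ^+ 2 + zd 1 s ^+ 2 = 1.
Hypothesis symmetric : forall s : R, 0 <= s <= L / 2 ->
  xd 0 (L - s) = - xd 0 s /\ zd 0 (L - s) = zd 0 s.
Local Notation k := (kappa xd zd).
Local Notation dk := (dkappa xd zd).
Local Notation FX := (offX xd zd).
Local Notation FZ := (offZ xd zd).
Hypothesis J_gt0 : forall s r : R, 0 <= s <= L -> 0 <= r <= delta -> 0 < 1 + r * k s.
Hypothesis inj : forall s1 r1 s2 r2 : R,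
  0 < s1 < L -> 0 < r1 < delta -> 0 < s2 < L -> 0 < r2 < delta ->
  FX s1 r1 = FX s2 r2 -> FZ s1 r1 = FZ s2 r2 -> s1 = s2 /\ r1 = r2.
Local Notation M := (measurableTypeR R * measurableTypeR R * measurableTypeR R)%type.

Let x2E := curve_x2 L_gt0 dx dz unit_speed.
Let z2E := curve_z2 L_gt0 dx dz unit_speed.

Definition tube_set : set (R3 R) := [set p | exists s r : R,
  [/\ 0 < s < L, 0 < r < delta, - T < p.1.2 < 0, p.1.1 = FX s r & p.2 = FZ s r]].

(* Unspecified outside the tube. *)
Definition coord (p : R3 R) : R * R := get [set sr : R * R |
  [/\ 0 < sr.1 < L, 0 < sr.2 < delta, p.1.1 = FX sr.1 sr.2 & p.2 = FZ sr.1 sr.2]].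

Definition cs (p : R3 R) := (coord p).1.
Definition cr (p : R3 R) := (coord p).2.

Lemma coordP p : tube_set p -> [/\ 0 < cs p < L, 0 < cr p < delta, - T < p.1.2 < 0,
  p.1.1 = FX (cs p) (cr p) & p.2 = FZ (cs p) (cr p)].
Proof.
move=> [s [r [hs hr hy eX eZ]]].
have [] := @getPex _ [set sr : R * R |
  [/\ 0 < sr.1 < L, 0 < sr.2 < delta, p.1.1 = FX sr.1 sr.2 & p.2 = FZ sr.1 sr.2]].
  by exists (s, r).
by move=> h1 h2 h3 h4; split.
Qed.

Lemma coord_uniq p s r : 0 < s < L -> 0 < r < delta -> p.1.1 = FX s r -> p.2 = FZ s r ->
  cs p = s /\ cr p = r.
Proof.
move=> hs hr eX eZ.
have [] := @getPex _ [set sr : R * R |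
  [/\ 0 < sr.1 < L, 0 < sr.2 < delta, p.1.1 = FX sr.1 sr.2 & p.2 = FZ sr.1 sr.2]].
  by exists (s, r).
move=> h1 h2 h3 h4; apply: inj => //; by rewrite -?h3 -?h4.
Qed.

(** Tangential and normal components of [q] seen from the point [s] of the curve. The coordinate [s]
    of [q] is a zero of [gt_ q], and [gn_] is then the coordinate [r]. *)
Let gt_ (q : R3 R) s := (q.1.1 - xd 0 s) * xd 1 s + (q.2 - zd 0 s) * zd 1 s.
Let gn_ (q : R3 R) s := (q.1.1 - xd 0 s) * zd 1 s - (q.2 - zd 0 s) * xd 1 s.

Let foot q s : 0 <= s <= L -> gt_ q s = 0 -> q.1.1 = FX s (gn_ q s) /\ q.2 = FZ s (gn_ q s).
Proof.
move=> hs; have u := unit_speed hs; rewrite /gt_ /gn_ /offX /offZ.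
move: (q.1.1) (q.2) (xd 0 s) (zd 0 s) (xd 1 s) (zd 1 s) u => a b c d e f u h; split.
  have : (a - c) * (e ^+ 2 + f ^+ 2) = ((a - c) * f - (b - d) * e) * f
      + e * ((a - c) * e + (b - d) * f) by ring.
  by rewrite u h; lra.
have : (b - d) * (e ^+ 2 + f ^+ 2) = - (((a - c) * f - (b - d) * e) * e)
    + f * ((a - c) * e + (b - d) * f) by ring.
by rewrite u h; lra.
Qed.

Let gtn_off p s r : 0 <= s <= L -> p.1.1 = FX s r -> p.2 = FZ s r ->
  gt_ p s = 0 /\ gn_ p s = r.
Proof.
move=> hs; have u := unit_speed hs; rewrite /gt_ /gn_ /offX /offZ => -> ->.
move: (xd 0 s) (zd 0 s) (xd 1 s) (zd 1 s) u => c d e f u; split; first by ring.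
by rewrite -[RHS]mulr1 -u; ring.
Qed.

Let gt_derive p s : 0 <= s <= L -> is_derive s 1 (gt_ p) (- (1 + gn_ p s * k s)).
Proof.
move=> hs; have d0 := dx 0 s; have d1 := dx 1 s; have e0 := dz 0 s; have e1 := dz 1 s.
rewrite /gt_ /gn_; derive_tac; rewrite x2E// z2E// -(unit_speed hs).
by move: (k s) (xd 0 s) (zd 0 s) (xd 1 s) (zd 1 s) => *; ring.
Qed.

Let cont_xd n : continuous (xd n).
Proof. by move=> s; apply: is_derive_continuous (dx n s). Qed.
Let cont_zd n : continuous (zd n).
Proof. by move=> s; apply: is_derive_continuous (dz n s). Qed.

(** An inverse function theorem by intermediate values: [gt_ p] has derivative [- J < 0] at [cs p],
    so it changes sign there; for [q] near [p] the signs at two nearby parameters persist and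
    enclose a zero of [gt_ q]. Injectivity identifies that zero with [cs q]. *)
Lemma tube_near p (e : R) : tube_set p -> 0 < e ->
  \forall q \near p, [/\ tube_set q, `|cs q - cs p| < e & `|cr q - cr p| < e].
Proof.
move=> pD e0; have [hs hr hy eX eZ] := coordP pD.
set s1 := cs p in hs eX eZ *; set r1 := cr p in hr eX eZ *.
have hs' : 0 <= s1 <= L by lra.
have [g0 n0] := gtn_off hs' eX eZ.
have J0 : 0 < 1 + r1 * k s1 by apply: J_gt0; lra.
have dg : is_derive s1 1 (gt_ p) (- (1 + r1 * k s1)).
  by rewrite -n0; exact: gt_derive.
have [d d0 hd] := is_derive_quotient dg J0.
pose e' := Num.min e (Num.min r1 (delta - r1)).
have [e1 [e2 e3]] : e' <= e /\ e' <= r1 /\ e' <= delta - r1.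
  by rewrite /e' !ge_min !lexx !orbT.
have e'0 : 0 < e' by rewrite !lt_min; lra.
have cn : {for (p, s1), continuous (fun qs : R3 R * R => gn_ qs.1 qs.2)}.
  have c1 (f : R -> R) : continuous f -> {for (p, s1), continuous (fun qs : R3 R * R => f qs.2)}.
    by move=> cf; apply: (@continuous_comp _ _ _ snd f); [exact: cvg_snd|exact: cf].
  have c2 : {for (p, s1), continuous (fun qs : R3 R * R => qs.1.1.1)}.
    by apply: (@continuous_comp _ _ _ fst (fun v : R3 R => v.1.1)); [exact: cvg_fst|exact: cont_fst1].
  have c3 : {for (p, s1), continuous (fun qs : R3 R * R => qs.1.2)}.
    by apply: (@continuous_comp _ _ _ fst (fun v : R3 R => v.2)); [exact: cvg_fst|exact: cont_snd].
  by apply: cvgB; apply: cvgM; [apply: cvgB => //| |apply: cvgB => //|]; apply: c1.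
have /cvgrPdist_lt/(_ _ e'0) := cn.
move=> -[[B1 B2] /= [nB1 /nbhs_ballP[m /= m0 hm]] hB].
pose u := Num.min (d / 2) (Num.min (m / 2) (Num.min (e / 2) (Num.min (s1 / 2) ((L - s1) / 2)))).
have [u1 [u2 [u3 [u4 u5]]]] : u <= d / 2 /\ u <= m / 2 /\ u <= e / 2 /\ u <= s1 / 2 /\ u <= (L - s1) / 2.
  by rewrite /u !ge_min !lexx !orbT.
have u0 : 0 < u by rewrite !lt_min; lra.
have gp : gt_ p (s1 + u) < 0.
  have := hd u; rewrite gt_eqF// gtr0_norm// => /(_ isT ltac:(lra)).
  rewrite g0 subr0 ltr_norml => /andP[_ q].
  have {}q : gt_ p (s1 + u) / u < 0 by lra.
  by move: q; rewrite pmulr_llt0// invr_gt0.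
have gm : 0 < gt_ p (s1 - u).
  have := hd (- u); rewrite oppr_eq0 gt_eqF// normrN gtr0_norm// => /(_ isT ltac:(lra)).
  rewrite g0 subr0 ltr_norml => /andP[_ q].
  have {}q : gt_ p (s1 - u) / - u < 0 by lra.
  by move: q; rewrite invrN mulrN oppr_lt0 pmulr_lgt0// invr_gt0.
have cgt s : {for p, continuous (gt_ ^~ s)}.
  apply: cvgD; apply: cvgM; try exact: cvg_cst.
    by apply: cvgB; [exact: cont_fst1|exact: cvg_cst].
  by apply: cvgB; [exact: cont_snd|exact: cvg_cst].
have n1 : \forall q \near p, gt_ q (s1 + u) < 0 by exact: near_lt (cgt _) gp.
have n2 : \forall q \near p, 0 < gt_ q (s1 - u) by exact: near_gt (cgt _) gm.
have n3 : \forall q \near p, - T < q.1.2 by apply: near_gt (@cont_fst2 R p) _; lra.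
have n4 : \forall q \near p, q.1.2 < 0 by apply: near_lt (@cont_fst2 R p) _; lra.
near=> q.
have q1 : gt_ q (s1 + u) < 0 by near: q.
have q2 : 0 < gt_ q (s1 - u) by near: q.
have q3 : - T < q.1.2 by near: q.
have q4 : q.1.2 < 0 by near: q.
have q5 : B1 q by near: q.
have [||s hs2 gs] := @IVT_itv R (gt_ q) (s1 - u) (s1 + u) 0 ltac:(lra).
- apply: continuous_subspaceT => t.
  apply: cvgD; apply: cvgM; try exact: cont_xd; try exact: cont_zd.
    by apply: cvgB; [exact: cvg_cst|exact: cont_xd].
  by apply: cvgB; [exact: cvg_cst|exact: cont_zd].
- by right; lra.
have hsL : 0 < s < L by lra.
have [qX qZ] := @foot q s ltac:(lra) gs.
have rr : `|r1 - gn_ q s| < e'.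
  have := hB (q, s); rewrite /= n0; apply; split => //=.
  by apply: hm; rewrite -ball_normE/= ltr_norml; lra.
have hrd : 0 < gn_ q s < delta by move: rr; rewrite ltr_norml; lra.
have [sE rE] := coord_uniq hsL hrd qX qZ.
split.
- by exists s, (gn_ q s); split => //; rewrite q3 q4.
- by rewrite sE ltr_norml; lra.
- by rewrite rE distrC; lra.
Unshelve. all: by end_near. Qed.

Lemma tube_open : open tube_set.
Proof.
rewrite openE => p pD; have := tube_near pD ltr01.
by rewrite /interior; apply: filterS => q [].
Qed.

Lemma cs_continuous p : tube_set p -> {for p, continuous cs}.
Proof.
move=> pD; apply/cvgrPdist_lt => e e0; have := tube_near pD e0.
by apply: filterS => q [_ h _]; rewrite distrC.
Qed.

Lemma cr_continuous p : tube_set p -> {for p, continuous cr}.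
Proof.
move=> pD; apply/cvgrPdist_lt => e e0; have := tube_near pD e0.
by apply: filterS => q [_ _ h]; rewrite distrC.
Qed.

(** The difference quotient completed by the derivative at [s1]: it is continuous there, and
    increments of [f] are exact multiples of it. *)
Let dq (f : R -> R) (f1 s1 s : R) := if s == s1 then f1 else (f s - f s1) / (s - s1).

Let dqE f f1 s1 s : f s - f s1 = (s - s1) * dq f f1 s1 s.
Proof.
rewrite /dq; case: eqP => [->|/eqP n]; first by rewrite !subrr mul0r.
by rewrite mulrC divfK// subr_eq0.
Qed.

Let dq_cont (f : R -> R) (f1 s1 : R) : is_derive s1 1 f f1 -> {for s1, continuous (dq f f1 s1)}.
Proof.
move=> df; apply/cvgrPdist_lt => e e0.
have [d d0 hd] := is_derive_quotient df e0.
apply/nbhs_ballP; exists d => //= s /= hs.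
rewrite {1}/dq eqxx /dq; case: eqP => [_|/eqP n]; first by rewrite subrr normr0.
have := hd (s - s1); rewrite subr_eq0 n distrC => /(_ isT hs).
by rewrite (addrC s1) subrK distrC.
Qed.

Local Notation D := tube_set.
Local Notation J p := (1 + cr p * k (cs p)).

Lemma Jp_gt0 p : tube_set p -> 0 < J p.
Proof. by move=> /coordP[hs hr _ _ _]; apply: J_gt0; lra. Qed.

Section at_point.
Variable p : R3 R.
Hypothesis pD : tube_set p.
Let s1 := cs p.
Let r1 := cr p.
(** With these slopes the horizontal part of [q - p] is exactly [(cs q - s1)] times [(Mx q, Mz q)]
    plus [(cr q - r1)] times the normal at [s1]. Its tangential component, divided by [det], gives
    the increment of [cs]; the normal one, corrected by [nor], that of [cr]. *)
Let Mx q := dq (xd 0) (xd 1 s1) s1 (cs q) + cr q * dq (zd 1) (zd 2 s1) s1 (cs q).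
Let Mz q := dq (zd 0) (zd 1 s1) s1 (cs q) - cr q * dq (xd 1) (xd 2 s1) s1 (cs q).
Let det q := Mx q * xd 1 s1 + Mz q * zd 1 s1.
Let nor q := Mx q * zd 1 s1 - Mz q * xd 1 s1.

Let dq_cs f f1 : is_derive s1 1 f f1 -> {for p, continuous (fun q => dq f f1 s1 (cs q))}.
Proof.
move=> df; apply: (@continuous_comp _ _ _ cs (dq f f1 s1)); first exact: cs_continuous.
exact: dq_cont.
Qed.

Let Mx_cont : {for p, continuous Mx}.
Proof.
apply: cvgD; first exact: dq_cs (dx 0 s1).
by apply: cvgM; [exact: cr_continuous|exact: dq_cs (dz 1 s1)].
Qed.

Let Mz_cont : {for p, continuous Mz}.
Proof.
apply: cvgB; first exact: dq_cs (dz 0 s1).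
by apply: cvgM; [exact: cr_continuous|exact: dq_cs (dx 1 s1)].
Qed.

Let det_cont : {for p, continuous det}.
Proof. by apply: cvgD; apply: cvgM => //; exact: cvg_cst. Qed.

Let nor_cont : {for p, continuous nor}.
Proof. by apply: cvgB; apply: cvgM => //; exact: cvg_cst. Qed.

Let hs1 : 0 <= s1 <= L.
Proof. by have [h _ _ _ _] := coordP pD; rewrite /s1; lra. Qed.

Let MxE : Mx p = (1 + r1 * k s1) * xd 1 s1.
Proof. by rewrite /Mx /dq !eqxx z2E// -/r1; ring. Qed.

Let MzE : Mz p = (1 + r1 * k s1) * zd 1 s1.
Proof. by rewrite /Mz /dq !eqxx x2E// -/r1; ring. Qed.

Let detE : det p = 1 + r1 * k s1.
Proof. by rewrite /det MxE MzE -[RHS]mulr1 -(unit_speed hs1); ring. Qed.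

Let norE : nor p = 0.
Proof. by rewrite /nor MxE MzE; ring. Qed.

Let diffX q : tube_set q -> q.1.1 - p.1.1 = (cs q - s1) * Mx q + (cr q - r1) * zd 1 s1.
Proof.
move=> qD; have [_ _ _ -> _] := coordP qD; have [_ _ _ -> _] := coordP pD.
rewrite -/s1 -/r1 /Mx mulrDr -dqE mulrCA -dqE /offX; ring.
Qed.

Let diffZ q : tube_set q -> q.2 - p.2 = (cs q - s1) * Mz q - (cr q - r1) * xd 1 s1.
Proof.
move=> qD; have [_ _ _ _ ->] := coordP qD; have [_ _ _ _ ->] := coordP pD.
rewrite -/s1 -/r1 /Mz mulrBr -dqE mulrCA -dqE /offZ; ring.
Qed.

Let near_det : \forall q \near p, tube_set q /\ det q != 0.
Proof.
have d0 : 0 < det p by rewrite detE; exact: Jp_gt0.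
have h : \forall q \near p, 0 < det q by exact: near_gt det_cont d0.
have h' := tube_near pD ltr01.
by near=> q; split; [have [] : [/\ tube_set q, `|cs q - cs p| < 1 & `|cr q - cr p| < 1] by near: q
  |rewrite gt_eqF//; near: q].
Unshelve. all: by end_near. Qed.

Let csE q : tube_set q -> det q != 0 -> cs q - s1 =
  xd 1 s1 / det q * (q.1.1 - p.1.1) + 0 * (q.1.2 - p.1.2) + zd 1 s1 / det q * (q.2 - p.2).
Proof.
move=> qD d0; rewrite diffX// diffZ// mul0r addr0.
by rewrite /det in d0 *; field.
Qed.

Lemma grad3_cs : grad3 cs p (xd 1 s1 / J p) 0 (zd 1 s1 / J p).
Proof.
rewrite -/s1 -/r1 -detE.
have dn : det p != 0 by rewrite detE gt_eqF//; exact: Jp_gt0.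
apply: (@grad3_caratheodory R cs p (fun q => xd 1 s1 / det q) (fun=> 0) (fun q => zd 1 s1 / det q)).
- by apply: cvgM; [exact: cvg_cst|exact: cvgV].
- exact: cvg_cst.
- by apply: cvgM; [exact: cvg_cst|exact: cvgV].
by apply: filterS near_det => q [qD d0]; exact: csE.
Qed.

Lemma grad3_cr : grad3 cr p (zd 1 s1) 0 (- xd 1 s1).
Proof.
have dn : det p != 0 by rewrite detE gt_eqF//; exact: Jp_gt0.
have := @grad3_caratheodory R cr p (fun q => zd 1 s1 - xd 1 s1 / det q * nor q) (fun=> 0)
  (fun q => - xd 1 s1 - zd 1 s1 / det q * nor q).
rewrite norE !mulr0 !subr0; apply.
- by apply: cvgB; [exact: cvg_cst|apply: cvgM => //; apply: cvgM; [exact: cvg_cst|exact: cvgV]].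
- exact: cvg_cst.
- by apply: cvgB; [exact: cvg_cst|apply: cvgM => //; apply: cvgM; [exact: cvg_cst|exact: cvgV]].
apply: filterS near_det => q [qD d0].
have u := unit_speed hs1.
transitivity ((q.1.1 - p.1.1) * zd 1 s1 - (q.2 - p.2) * xd 1 s1 - (cs q - s1) * nor q).
  rewrite diffX// diffZ// /nor -[LHS]mulr1 -u; ring.
by rewrite csE//; field.
Qed.

End at_point.

Lemma smooth1_xd n : smooth1 (xd n).
Proof.
apply/smooth1P => m; elim: m n => [|m IH] n; first by split=> // s; have [] := dx n s.
exact: CkP (dx n) (IH n.+1).
Qed.

Lemma smooth1_zd n : smooth1 (zd n).
Proof.
apply/smooth1P => m; elim: m n => [|m IH] n; first by split=> // s; have [] := dz n s.
exact: CkP (dz n) (IH n.+1).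
Qed.

Lemma smooth1N (f : R -> R) : smooth1 f -> smooth1 (fun s => - f s).
Proof.
move=> sf; rewrite (_ : (fun s => _) = fun s => (-1) * f s); last by apply/funext => s; rewrite mulN1r.
by apply: smooth1M => //; exact: smooth1_cst.
Qed.

Lemma smooth1_kappa : smooth1 k.
Proof.
apply: smooth1D; first by apply: smooth1M; [exact: smooth1_xd|exact: smooth1_zd].
by apply: smooth1N; apply: smooth1M; [exact: smooth1_zd|exact: smooth1_xd].
Qed.

Lemma smooth1_dkappa : smooth1 dk.
Proof.
apply: smooth1D; first by apply: smooth1M; [exact: smooth1_xd|exact: smooth1_zd].
by apply: smooth1N; apply: smooth1M; [exact: smooth1_zd|exact: smooth1_xd].
Qed.

(** * Test functions built from the coordinates *)

Definition bump_in (a b : R) (f : R -> R) :=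
  smooth1 f /\ exists2 l : R, 0 < l & forall s, ~~ (a + l <= s <= b - l) -> f s = 0.

Lemma bump_inM a b f g : bump_in a b f -> smooth1 g -> bump_in a b (fun s => f s * g s).
Proof.
move=> [sf [l l0 f0]] sg; split; first exact: smooth1M.
by exists l => // s hs; rewrite f0// mul0r.
Qed.

Lemma bump_in_derive1 a b f : bump_in a b f -> bump_in a b (derive1 f).
Proof.
move=> [sf [l l0 f0]]; split; first exact: smooth1_derive1.
exists l => // s hs; apply: (derive1_near_eq (f:=f) (g:=fun=> 0) _ (smooth1_is_derive1 s sf) (is_deriveC s 0)).
  move: hs; rewrite negb_and -!ltNge => /orP[h|h].
    near=> t; apply: f0; rewrite negb_and -!ltNge; apply/orP; left.
    by near: t; exact: lt_nbhsl.
  near=> t; apply: f0; rewrite negb_and -!ltNge; apply/orP; right.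
  by near: t; exact: lt_nbhsr.
Unshelve. all: by end_near. Qed.

Definition mono (A b c : R -> R) n (p : R3 R) : R :=
  if `[< D p >] then A (cs p) * b (cr p) * c p.1.2 / J p ^+ n else 0.

Lemma monoE A b c n p : D p -> mono A b c n p = A (cs p) * b (cr p) * c p.1.2 / J p ^+ n.
Proof. by move=> pD; rewrite /mono asboolT. Qed.

Lemma mono0 A b c n p : ~ D p -> mono A b c n p = 0.
Proof. by move=> pD; rewrite /mono asboolF. Qed.

(* Dividing by powers of [J] makes the class stable under partial derivatives. *)
Inductive tf : (R3 R -> R) -> Prop :=
| tf_mono A b c n : bump_in 0 L A -> bump_in 0 delta b -> bump_in (- T) 0 c ->
    tf (mono A b c n)
| tf_add f g : tf f -> tf g -> tf (fun p => f p + g p).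

Lemma tf_out f p : tf f -> ~ D p -> f p = 0.
Proof.
move=> tff pD; elim: tff => [A b c n _ _ _|g h _ g0 _ h0]; first exact: mono0.
by rewrite g0 h0 addr0.
Qed.

Lemma tf_ext f g : f =1 g -> tf f -> tf g.
Proof. by move=> /funext ->. Qed.

(** The image of the coordinate box shrunk by [l]. For [l > 0] it contains supports and lies in the
    tube; for [l = 0] it is a compact set around the tube, which gives boundedness and finite
    volume. *)
Definition core (l : R) : set (R3 R) := (fun p : R3 R => ((FX p.1.1 p.2, p.1.2), FZ p.1.1 p.2)) @`
  ((`[0 + l, L - l] `*` `[- T + l, 0 - l]) `*` `[0 + l, delta - l]).

Lemma compact_core l : compact (core l).
Proof.
apply: continuous_compact; last first.
  by apply: compact_setX; [apply: compact_setX|]; exact: segment_compact.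
apply: continuous_subspaceT.
have c1 (f : R -> R) : continuous f -> continuous (fun p : R3 R => f p.1.1).
  by move=> cf p; apply: (@continuous_comp _ _ _ (fun v : R3 R => v.1.1) f); [exact: cont_fst1|exact: cf].
have cxd n : continuous (xd n) by move=> s; apply: is_derive_continuous (dx n s).
have czd n : continuous (zd n) by move=> s; apply: is_derive_continuous (dz n s).
apply: continuous_pair; first apply: continuous_pair.
- move=> p; apply: cvgD; first exact: (c1 (xd 0)).
  by apply: cvgM; [exact: cont_snd|exact: (c1 (zd 1))].
- by move=> p; exact: cont_fst2.
- move=> p; apply: cvgB; first exact: (c1 (zd 0)).
  by apply: cvgM; [exact: cont_snd|exact: (c1 (xd 1))].
Qed.

Lemma core_sub (l : R) : 0 < l -> core l `<=` D.
Proof.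
move=> l0 _ [[[s y] r] /= [[hs hy] hr] <-]; move: hs hy hr; rewrite /= !in_itv/= => hs hy hr.
by exists s, r; split => //=; lra.
Qed.

Lemma core_le (l m : R) : l <= m -> core m `<=` core l.
Proof.
move=> lm _ [[[s y] r] /= [[hs hy] hr] <-]; move: hs hy hr; rewrite /= !in_itv/= => hs hy hr.
by exists ((s, y), r) => //=; rewrite !in_itv/=; (do 2?split); lra.
Qed.

Lemma tf_core f : tf f -> exists2 l : R, 0 < l & forall p, ~ core l p -> f p = 0.
Proof.
elim=> [A b c n [_ [l1 l10 A0]] [_ [l2 l20 b0]] [_ [l3 l30 c0]]|g h _ [l1 l10 g0] _ [l2 l20 h0]].
  exists (Num.min l1 (Num.min l2 l3)); first by rewrite !lt_min l10 l20.
  set l := Num.min _ _; move=> p pK.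
  have [e1 [e2 e3]] : l <= l1 /\ l <= l2 /\ l <= l3 by rewrite /l !ge_min !lexx !orbT.
  have [pD|] := pselect (D p); last exact: mono0.
  rewrite monoE//; have [hs hr hy eX eZ] := coordP pD.
  have [h1|h1] := boolP (0 + l1 <= cs p <= L - l1); last by rewrite A0// !mul0r.
  have [h2|h2] := boolP (0 + l2 <= cr p <= delta - l2); last by rewrite b0// mulr0 !mul0r.
  have [h3|h3] := boolP (- T + l3 <= p.1.2 <= 0 - l3); last by rewrite c0// mulr0 mul0r.
  exfalso; apply: pK; exists ((cs p, p.1.2), cr p) => /=.
    by rewrite !in_itv/=; (do 2?split); lra.
  by rewrite -eX -eZ; case: p {pD hs hr hy eX eZ h1 h2 h3} => -[].
exists (Num.min l1 l2); first by rewrite lt_min l10.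
have [e1 e2] : Num.min l1 l2 <= l1 /\ Num.min l1 l2 <= l2 by rewrite !ge_min !lexx !orbT.
by move=> p pK; rewrite g0 ?h0 ?addr0// => /core_le H; apply: pK; exact: H.
Qed.

(** Since this includes the boundary points of the tube, the gradients exist and stay in the class
    on all of space. *)
Lemma tf_near0 f p : tf f -> ~ D p -> \forall q \near p, f q = 0.
Proof.
move=> tff pD; have [l l0 f0] := tf_core tff.
have cK : closed (core l) by apply: compact_closed; [exact: norm_hausdorff|exact: compact_core].
have : \forall q \near p, ~ core l q.
  have oK : open (~` core l) by exact: closed_openC.
  by apply: open_nbhs_nbhs; split => // /(core_sub l0).
by apply: filterS => q; exact: f0.
Qed.

Lemma tf_mul f g : tf f -> tf g -> tf (fun p => f p * g p).
Proof.
move=> tff tfg; elim: tff => [A b c n hA hb hc|f1 f2 _ h1 _ h2]; last first.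
  by apply: tf_ext (tf_add h1 h2) => p; rewrite mulrDl.
elim: tfg => [A' b' c' n' hA' hb' hc'|f1 f2 _ h1 _ h2]; last first.
  by apply: tf_ext (tf_add h1 h2) => p; rewrite mulrDr.
apply: (@tf_ext (mono (fun s => A s * A' s) (fun s => b s * b' s) (fun s => c s * c' s) (n + n'))).
  move=> p; have [pD|pD] := pselect (D p); last by rewrite !mono0// mulr0.
  by rewrite !monoE// exprD invfM; ring.
by apply: tf_mono; apply: bump_inM => //; [case: hA'|case: hb'|case: hc'].
Qed.

Lemma tf_mul_cs f (phi : R -> R) : tf f -> smooth1 phi -> tf (fun p => f p * phi (cs p)).
Proof.
move=> tff sphi; elim: tff => [A b c n hA hb hc|f1 f2 _ h1 _ h2]; last first.
  by apply: tf_ext (tf_add h1 h2) => p; rewrite mulrDl.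
apply: (@tf_ext (mono (fun s => A s * phi s) b c n)).
  move=> p; have [pD|pD] := pselect (D p); last by rewrite !mono0// mul0r.
  by rewrite !monoE//; ring.
by apply: tf_mono => //; exact: bump_inM.
Qed.

Lemma tf_scale f (a : R) : tf f -> tf (fun p => f p * a).
Proof.
move=> tff; have sa : smooth1 (fun _ : R => a) by exact: smooth1_cst.
exact: (tf_ext _ (tf_mul_cs tff sa)). Qed.

Lemma tf_divJ f : tf f -> tf (fun p => f p / J p).
Proof.
elim=> [A b c n hA hb hc|f1 f2 _ h1 _ h2]; last first.
  by apply: tf_ext (tf_add h1 h2) => p; rewrite mulrDl.
apply: (@tf_ext (mono A b c n.+1)); last exact: tf_mono.
move=> p; have [pD|pD] := pselect (D p); last by rewrite !mono0// mul0r.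
by rewrite !monoE// exprSr invfM mulrA.
Qed.

(** The cotangent is singular at [0] and [L]. Division by powers of the sine, cut off outside
    [(0, L)], is a family closed under differentiation, so it preserves smoothness of functions
    supported inside. *)
Definition over_sin (A : R -> R) (j : nat) (s : R) : R :=
  if 0 < s < L then A s / sin (pi / L * s) ^+ j else 0.

Lemma sin_arc_gt0 (s : R) : 0 < s < L -> 0 < sin (pi / L * s).
Proof.
have L0 := L_gt0; move=> /andP[s0 sL]; apply: sin_gt0_pi.
have pL : 0 < pi / L by rewrite divr_gt0// pi_gt0.
rewrite mulr_gt0//= mulrAC ltr_pdivrMr// ltr_pM2l//; exact: pi_gt0.
Qed.

Lemma is_derive_over_sin A j (s : R) : bump_in 0 L A ->
  is_derive s 1 (over_sin A j) (over_sin (derive1 A) j s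
    + over_sin (fun s => A s * (- (j%:R * (pi / L)) * cos (pi / L * s))) j.+1 s).
Proof.
move=> bA; have [sA [l l0 A0]] := bA.
have [hs|hs] := boolP (0 < s < L); last first.
  rewrite /over_sin (negbTE hs) addr0.
  apply: near_eq_is_derive (is_deriveC s 0).
  have h t : ~~ (0 + l <= t <= L - l) -> 0 = over_sin A j t.
    by move=> ht; rewrite /over_sin A0// mul0r if_same.
  move: hs; rewrite negb_and -!leNgt => /orP[hs|hs].
    near=> t; apply: h; rewrite negb_and -!ltNge; apply/orP; left.
    by near: t; apply: lt_nbhsl; lra.
  near=> t; apply: h; rewrite negb_and -!ltNge; apply/orP; right.
  by near: t; apply: lt_nbhsr; lra.
have e : \forall t \near s, A t / sin (pi / L * t) ^+ j = over_sin A j t.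
  have : s \in `]0, L[ by rewrite in_itv.
  by move=> /near_in_itvoo; apply: filterS => t; rewrite in_itv/= /over_sin => ->.
apply: near_eq_is_derive e _.
have s0 := sin_arc_gt0 hs; have sn : sin (pi / L * s) != 0 by rewrite gt_eqF.
have dA := smooth1_is_derive1 s sA.
rewrite /over_sin hs; case: j => [|j].
  rewrite mul0r oppr0 mul0r mulr0 mul0r addr0.
  rewrite (_ : (fun t => _) = A); last by apply/funext => t; rewrite expr0 divr1.
  by apply: is_derive_eq dA _; rewrite expr0 divr1.
have d1 : is_derive s 1 (fun t => sin (pi / L * t) ^+ j.+1)
   (j.+1%:R * sin (pi / L * s) ^+ j * (cos (pi / L * s) * (pi / L * 1 + s * 0))).
  by derive_tac.
have d2 : is_derive s 1 (fun t => (sin (pi / L * t) ^+ j.+1)^-1)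
  (- (sin (pi / L * s) ^+ j.+1) ^- 2 *
   (j.+1%:R * sin (pi / L * s) ^+ j * (cos (pi / L * s) * (pi / L * 1 + s * 0)))).
  by apply: is_deriveV_fun => //; rewrite expf_neq0.
apply: is_derive_eq (is_deriveM_fun dA d2) _.
rewrite !exprS; field.
by rewrite sn expf_neq0//= gt_eqF.
Unshelve. all: by end_near. Qed.

Lemma smooth1_sin_arc (a : R) : smooth1 (fun s : R => sin (a * s)) /\ smooth1 (fun s : R => cos (a * s)).
Proof.
suff H n : Ck n (fun s : R => sin (a * s)) /\ Ck n (fun s : R => cos (a * s)).
  by split; apply/smooth1P => n; have [] := H n.
have d (s : R) : is_derive s 1 (fun t => a * t) a.
  by apply: is_derive_eq (is_deriveM_fun (is_deriveC s a) (is_deriveI s)) _; rewrite mulr0 addr0 mulr1.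
have ds (s : R) : is_derive s 1 (fun s : R => sin (a * s)) (cos (a * s) * a).
  exact: is_derive_sin_fun.
have dc (s : R) : is_derive s 1 (fun s : R => cos (a * s)) (- sin (a * s) * a).
  exact: is_derive_cos_fun.
elim: n => [|n [IHs IHc]].
  by split; (split; last exact: I) => s; [have [] := ds s|have [] := dc s].
split; [apply: (CkP ds)|apply: (CkP dc)].
  by apply: CkM => //; exact: Ck_cst.
rewrite (_ : (fun s => _) = fun s : R => sin (a * s) * - a); last first.
  by apply/funext => s; rewrite mulNr mulrN.
by apply: CkM => //; exact: Ck_cst.
Qed.

Lemma bump_in_over_sin A j : bump_in 0 L A -> bump_in 0 L (over_sin A j).
Proof.
move=> bA; split; last first.
  by have [_ [l l0 A0]] := bA; exists l => // s hs; rewrite /over_sin A0// mul0r if_same.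
apply/smooth1P => n; elim: n A j bA => [|n IH] A j bA.
  by split=> // s; have [] := is_derive_over_sin j s bA.
apply: (CkP (fun s => is_derive_over_sin j s bA)); apply: CkD.
  by apply: IH; exact: bump_in_derive1.
apply: IH; apply: bump_inM => //; apply: smooth1M; first exact: smooth1_cst.
exact: (smooth1_sin_arc _).2.
Qed.

Definition cot_arc (s : R) := pi / L * cos (pi / L * s) / sin (pi / L * s).

Lemma tf_mul_cot f : tf f -> tf (fun p => f p * cot_arc (cs p)).
Proof.
elim=> [A b c n hA hb hc|f1 f2 _ h1 _ h2]; last first.
  by apply: tf_ext (tf_add h1 h2) => p; rewrite mulrDl.
apply: (@tf_ext (mono (over_sin (fun s => A s * (pi / L * cos (pi / L * s))) 1) b c n)).
  move=> p; have [pD|pD] := pselect (D p); last by rewrite !mono0// mul0r.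
  by rewrite !monoE// /over_sin; have [-> _ _ _ _] := coordP pD; rewrite expr1 /cot_arc; ring.
apply: tf_mono => //; apply: bump_in_over_sin; apply: bump_inM => //.
by apply: smooth1M; [exact: smooth1_cst|exact: (smooth1_sin_arc _).2].
Qed.

Lemma is_derive_invX (n : nat) (u : R) : u != 0 ->
  is_derive u 1 (fun v : R => (v ^+ n)^-1) (- n%:R / u ^+ n.+1).
Proof.
move=> un; case: n => [|n].
  rewrite oppr0 mul0r (_ : (fun v => _) = fun=> 1); first exact: is_deriveC.
  by apply/funext => v; rewrite expr0 invr1.
have d1 : is_derive u 1 (fun v : R => v ^+ n.+1) (n.+1%:R * u ^+ n * 1) by derive_tac.
apply: is_derive_eq (is_deriveV_fun _ d1) _; first by rewrite expf_neq0.
by rewrite !exprS; field; rewrite un expf_neq0.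
Qed.

Lemma grad3_J p : D p -> grad3 (fun q => J q) p
  (zd 1 (cs p) * k (cs p) + cr p * dk (cs p) * (xd 1 (cs p) / J p)) 0
  (- xd 1 (cs p) * k (cs p) + cr p * dk (cs p) * (zd 1 (cs p) / J p)).
Proof.
move=> pD.
have gs := grad3_cs pD.
have gr := grad3_cr pD.
have gk := grad3_comp1 (is_derive_kappa dx dz (cs p)) gs.
by apply: grad3_eq (grad3D (grad3_cst p 1) (grad3M gr gk)) _ _ _; ring.
Qed.

Lemma mono_grad A b c n p : bump_in 0 L A -> bump_in 0 delta b -> bump_in (- T) 0 c ->
  grad3 (mono A b c n) p
    (mono (fun s => derive1 A s * xd 1 s) b c n.+1 p
     + mono (fun s => A s * zd 1 s) (derive1 b) c n p
     + mono (fun s => A s * (- n%:R * (k s * zd 1 s))) b c n.+1 p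
     + mono (fun s => A s * (- n%:R * (dk s * xd 1 s))) (fun r => b r * r) c n.+2 p)
    (mono A b (derive1 c) n p)
    (mono (fun s => derive1 A s * zd 1 s) b c n.+1 p
     + mono (fun s => A s * (- xd 1 s)) (derive1 b) c n p
     + mono (fun s => A s * (n%:R * (k s * xd 1 s))) b c n.+1 p
     + mono (fun s => A s * (- n%:R * (dk s * zd 1 s))) (fun r => b r * r) c n.+2 p).
Proof.
move=> bA bb bc.
have [pD|pD] := pselect (D p); last first.
  rewrite !mono0// !addr0; apply: grad3_near (grad3_cst p 0).
  have := tf_near0 (tf_mono n bA bb bc) pD.
  by apply: filterS => q ->.
rewrite !monoE//.
have gs := grad3_cs pD.
have gr := grad3_cr pD.
have Jp := Jp_gt0 pD.
have Jn : J p != 0 by rewrite gt_eqF.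
have gA := grad3_comp1 (smooth1_is_derive1 (cs p) bA.1) gs.
have gb := grad3_comp1 (smooth1_is_derive1 (cr p) bb.1) gr.
have gc := grad3_comp1 (smooth1_is_derive1 p.1.2 bc.1) (grad3_coord1 p).
have gJ := grad3_comp1 (is_derive_invX n Jn) (grad3_J pD).
have near_D : \forall q \near p, D q.
  have := tube_near pD ltr01.
  by apply: filterS => q [].
apply: grad3_near (grad3_eq (grad3M (grad3M (grad3M gA gb) gc) gJ) _ _ _).
- by apply: filterS near_D => q qD; rewrite monoE.
- by rewrite !exprS; field; rewrite Jn expf_neq0.
- by ring.
- by rewrite !exprS; field; rewrite Jn expf_neq0.
Qed.

Lemma tf_grad f : tf f -> exists f0 f1 f2, [/\ tf f0, tf f1, tf f2 &
  forall p, grad3 f p (f0 p) (f1 p) (f2 p)].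
Proof.
elim=> [A b c n hA hb hc|h1 h2 _ [f0 [f1 [f2 [hf0 hf1 hf2 hf]]]] _ [g0 [g1 [g2 [hg0 hg1 hg2 hg]]]]].
  have sk := smooth1_kappa; have sdk := smooth1_dkappa.
  have sx : smooth1 (xd 1) := @smooth1_xd 1; have sz : smooth1 (zd 1) := @smooth1_zd 1.
  have sc (a : R) := @smooth1_cst R a.
  have sM (f1 f2 : R -> R) : smooth1 f1 -> smooth1 f2 -> smooth1 (fun s => f1 s * f2 s) by exact: smooth1M.
  have sN (f1 : R -> R) : smooth1 f1 -> smooth1 (fun s => - f1 s) := @smooth1N f1.
  have sI : smooth1 (fun s : R => s) by exact: smooth1_id.
  have hA' := bump_in_derive1 hA; have hb' := bump_in_derive1 hb; have hc' := bump_in_derive1 hc.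
  have hbr := bump_inM hb sI.
  have m1 := bump_inM hA' sx; have m2 := bump_inM hA sz.
  have m3 := bump_inM hA (sM _ _ (sc (- n%:R)) (sM _ _ sk sz)).
  have m4 := bump_inM hA (sM _ _ (sc (- n%:R)) (sM _ _ sdk sx)).
  have m5 := bump_inM hA' sz; have m6 := bump_inM hA (sN _ sx).
  have m7 := bump_inM hA (sM _ _ (sc n%:R) (sM _ _ sk sx)).
  have m8 := bump_inM hA (sM _ _ (sc (- n%:R)) (sM _ _ sdk sz)).
  pose g0 := tf_add (tf_add (tf_add (tf_mono n.+1 m1 hb hc) (tf_mono n m2 hb' hc))
    (tf_mono n.+1 m3 hb hc)) (tf_mono n.+2 m4 hbr hc).
  pose g2 := tf_add (tf_add (tf_add (tf_mono n.+1 m5 hb hc) (tf_mono n m6 hb' hc))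
    (tf_mono n.+1 m7 hb hc)) (tf_mono n.+2 m8 hbr hc).
  by do 3 eexists; split; [exact: g0|exact: (tf_mono n hA hb hc')|exact: g2|
    move=> p; exact: mono_grad].
exists (fun p => f0 p + g0 p), (fun p => f1 p + g1 p), (fun p => f2 p + g2 p).
by split; [exact: tf_add|exact: tf_add|exact: tf_add|move=> p; exact: grad3D].
Qed.

Lemma tf_derive f (i : 'I_3) : tf f -> tf ('D_(basis3 R i) f).
Proof.
move=> /tf_grad[f0 [f1 [f2 [h0 h1 h2 hf]]]].
case: i => -[|[|[|//]]] hi.
- by apply: tf_ext h0 => p; rewrite (grad3_derive _ (hf p)) (tnth_nth 0).
- by apply: tf_ext h1 => p; rewrite (grad3_derive _ (hf p)) (tnth_nth 0).
- by apply: tf_ext h2 => p; rewrite (grad3_derive _ (hf p)) (tnth_nth 0).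
Qed.

Lemma tf_smooth3 f : tf f -> smooth3 f.
Proof.
move=> tff s p; suff : tf (foldr (fun i g => 'D_(basis3 R i) g) f s).
  by move=> /tf_grad[f0 [f1 [f2 [_ _ _ h]]]]; have [] := h p.
by elim: s => [//|i s IH] /=; exact: tf_derive.
Qed.

Lemma tf_test_function f : tf f -> test_function D f.
Proof.
move=> tff; split; first exact: tf_smooth3.
have [l l0 f0] := tf_core tff.
by exists (core l); split; [exact: compact_core|exact: core_sub|].
Qed.

Let oD : open D.
Proof. exact: tube_open. Qed.

Lemma measurable_tube : measurable (D : set M).
Proof. exact: open_measurable3. Qed.

Lemma tube_sub_core0 : D `<=` core 0.
Proof.
move=> p [s [r [hs hr hy eX eZ]]]; exists ((s, p.1.2), r) => /=.
  by rewrite !in_itv/=; (do 2?split); lra.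
by rewrite -eX -eZ; case: p {hy eX eZ} => -[].
Qed.

Lemma core_sub_core0 (l : R) : 0 < l -> core l `<=` core 0.
Proof. by move=> l0; apply: subset_trans tube_sub_core0; exact: core_sub. Qed.

Lemma core0_cube : exists K, core 0 `<=` cube K.
Proof.
have /compact_bounded[K [_ hK]] := @compact_core 0.
exists (K + 1) => p /(hK (K + 1) ltac:(rewrite ltrDl; exact: ltr01)) pK.
by have [h1 h2 h3] := norm3_ge p; split; apply: le_trans pK.
Qed.

Lemma tube_fin : (vol3 R D < +oo)%E.
Proof.
have [K hK] := core0_cube.
apply: le_lt_trans (cube_fin K); apply: le_measure; rewrite ?inE.
- exact: measurable_tube.
- exact: measurable_cube.
- by apply: subset_trans hK; exact: tube_sub_core0.
Qed.

Lemma tf_continuous f : tf f -> continuous f.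
Proof.
move=> tff p; have [f0 [f1 [f2 [_ _ _ gf]]]] := tf_grad tff.
exact: grad3_continuous (gf p).
Qed.

Lemma tf_bounded f : tf f -> exists B, forall p, `|f p| <= B.
Proof.
move=> tff; have [l l0 f0] := tf_core tff.
have cK := @compact_core l.
have : compact (f @` core l).
  by apply: continuous_compact => //; apply: continuous_subspaceT; exact: tf_continuous.
move=> /compact_bounded[B [_ hB]].
exists (`|B| + 1) => p; have [pK|pK] := pselect (core l p).
  apply: (hB (`|B| + 1)); last by exists p.
  by apply: le_lt_trans (ler_norm B) _; rewrite ltrDl.
by rewrite f0// normr0 addr_ge0.
Qed.

Lemma tf_measurable f : tf f -> measurable_fun (D : set M) f.
Proof. by move=> tff; apply: continuous_measurable3 => // p _; exact: tf_continuous. Qed.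

Lemma tf_integrable f : tf f -> (vol3 R).-integrable D (EFin \o f).
Proof.
move=> tff; have [B hB] := tf_bounded tff.
apply: measurable_bounded_integrable.
- exact: measurable_tube.
- exact: tube_fin.
- exact: tf_measurable.
- by exists B; split; [exact: num_real|move=> b Bb x _; apply: (le_trans (hB x)); exact: ltW].
Qed.

Lemma tf_integral_partial f g : tf f -> tf g ->
  (exists i, (i = 0%N \/ i = 2%N) /\ forall p, exists f0 f1 f2, grad3 f p f0 f1 f2 /\ g p = nth 0 [:: f0; f1; f2] i) ->
  \int[vol3 R]_(p in D) g p = 0.
Proof.
move=> tff tfg [i [hi gf]].
have [K hK] := core0_cube; have [B hB] := tf_bounded tfg.
have out h p : tf h -> ~ cube K p -> h p = 0.
  move=> tfh pK; have [l l0 h0] := tf_core tfh; apply: h0 => pl; apply: pK; apply: hK.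
  exact: core_sub_core0 pl.
have -> : \int[vol3 R]_(p in D) g p = \int[vol3 R]_p g p.
  rewrite Rintegral_mkcond; congr Rintegral; apply/funext => p; rewrite patchE.
  by case: ifPn => // /negP pD; rewrite (tf_out tfg)// => h; apply: pD; rewrite inE.
have cg := tf_continuous tfg.
rewrite /Rintegral; case: hi => hi; rewrite hi in gf.
- have df (a b c : R) : is_derive a 1 (fun t => f (t, b, c)) (g (a, b, c)).
    by have [f0 [f1 [f2 [h ->]]]] := gf (a, b, c); exact: grad3_slice_x h.
  by rewrite (integral_partial_x cg hB (fun p => @out f p tff) (fun p => @out g p tfg) df).
- have df (a b c : R) : is_derive c 1 (fun t => f (a, b, t)) (g (a, b, c)).
    by have [f0 [f1 [f2 [h ->]]]] := gf (a, b, c); exact: grad3_slice_z h.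
  by rewrite (integral_partial_z cg hB (fun p => @out f p tff) (fun p => @out g p tfg) df).
Qed.

(** * The weighted inequality for test functions *)

Section weight.
Variable lambda : R.
Hypothesis lambda_le : forall s r : R, 0 <= s <= L -> 0 <= r <= delta ->
  lambda <= (pi / L) ^+ 2 / (1 + r * k s) ^+ 2.
Hypothesis cot_dk : forall s : R, 0 < s < L -> 0 <= cot_arc s * dk s.

Lemma is_derive_cot_arc (s : R) : 0 < s < L ->
  is_derive s 1 (cot_arc) (- (pi / L) ^+ 2 - cot_arc s ^+ 2).
Proof.
move=> hs; have s0 := sin_arc_gt0 hs; have sn : sin (pi / L * s) != 0 by rewrite gt_eqF.
rewrite /cot_arc.
have ds : is_derive s 1 (fun t => sin (pi / L * t)) (cos (pi / L * s) * (pi / L * 1 + s * 0)) by derive_tac.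
have dV := is_deriveV_fun sn ds.
have dc : is_derive s 1 (fun t => pi / L * cos (pi / L * t))
  (pi / L * (- sin (pi / L * s) * (pi / L * 1 + s * 0)) + cos (pi / L * s) * 0) by derive_tac.
by apply: is_derive_eq (is_deriveM_fun dc dV) _; field; rewrite sn gt_eqF.
Qed.

(* The left-hand side is the divergence of [psi ^ 2 X w tau], with [w = 1 / J] and
   [a = pi / L]; completing the square leaves two nonnegative terms. *)
Lemma riccati_pointwise (psi h X a w lam r d : R) :
  lam <= a ^+ 2 * w ^+ 2 -> 0 <= X * d -> 0 <= r -> 0 <= w ->
  2 * psi * h * X * w + psi ^+ 2 * (- a ^+ 2 - X ^+ 2) * w ^+ 2 - psi ^+ 2 * X * r * d * w ^+ 3
    <= h ^+ 2 - lam * psi ^+ 2.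
Proof.
move=> h1 h2 h3 h4.
have e1 : 0 <= psi ^+ 2 * (a ^+ 2 * w ^+ 2 - lam) by rewrite mulr_ge0 ?sqr_ge0 ?subr_ge0.
have e2 : 0 <= psi ^+ 2 * ((X * d) * r * w ^+ 3).
  by rewrite mulr_ge0 ?sqr_ge0// mulr_ge0 ?exprn_ge0// mulr_ge0.
have e3 : 0 <= (h - psi * X * w) ^+ 2 by rewrite sqr_ge0.
rewrite -subr_ge0; apply: le_trans (addr_ge0 (addr_ge0 e3 e1) e2) _.
by rewrite le_eqVlt; apply/orP; left; apply/eqP; ring.
Qed.

(** Here [h] is the derivative of [psi] along [tau], which equals [div (psi tau)]: the field [tau]
    varies only with [s], and its derivative is normal to it, so it is divergence free. *)
Lemma tangential_inequality psi p0 p1 p2 h : tf psi -> tf p0 -> tf p2 ->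
  (forall p, grad3 psi p (p0 p) (p1 p) (p2 p)) ->
  (forall p, h p = p0 p * xd 1 (cs p) + p2 p * zd 1 (cs p)) ->
  lambda * \int[vol3 R]_(p in D) (psi p ^+ 2) <= \int[vol3 R]_(p in D) (h p ^+ 2).
Proof.
move=> tfp tf0 tf2 gp hE.
have sx : smooth1 (xd 1) := @smooth1_xd 1; have sz : smooth1 (zd 1) := @smooth1_zd 1.
pose V p := psi p * psi p * cot_arc (cs p) / J p.
have tfV : tf V by apply: tf_divJ; apply: tf_mul_cot => //; exact: tf_mul.
have tfVx : tf (fun p => V p * xd 1 (cs p)) by exact: tf_mul_cs.
have tfVz : tf (fun p => V p * zd 1 (cs p)) by exact: tf_mul_cs.
have tfh : tf h.
  by apply: tf_ext (tf_add (tf_mul_cs tf0 sx) (tf_mul_cs tf2 sz)) => p; rewrite hE.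
have [vx0 [vx1 [vx2 [tx0 _ _ gx]]]] := tf_grad tfVx.
have [vz0 [vz1 [vz2 [_ _ tz2 gz]]]] := tf_grad tfVz.
have i1 : \int[vol3 R]_(p in D) vx0 p = 0.
  apply: tf_integral_partial tfVx tx0 _; exists 0%N; split; first by left.
  by move=> p; exists (vx0 p), (vx1 p), (vx2 p).
have i2 : \int[vol3 R]_(p in D) vz2 p = 0.
  apply: tf_integral_partial tfVz tz2 _; exists 2%N; split; first by right.
  by move=> p; exists (vz0 p), (vz1 p), (vz2 p).
have mD := measurable_tube.
have tfh2 : tf (fun p => h p ^+ 2) by apply: tf_ext (tf_mul tfh tfh) => p; rewrite expr2.
have tfp2 : tf (fun p => psi p ^+ 2) by apply: tf_ext (tf_mul tfp tfp) => p; rewrite expr2.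
have tfl2 : tf (fun p => psi p ^+ 2 * - lambda) by exact: tf_scale.
have := @le_Rintegral _ _ _ (vol3 R) D (fun p => vx0 p + vz2 p) (fun p => h p ^+ 2 + psi p ^+ 2 * - lambda) mD
  (tf_integrable (tf_add tx0 tz2)) (tf_integrable (tf_add tfh2 tfl2)).
rewrite !RintegralD//; try exact: tf_integrable.
rewrite i1 i2 addr0 RintegralZr//; last exact: tf_integrable.
rewrite mulrN subr_ge0 mulrC; apply => p pD.
have [hs hr _ _ _] := coordP pD.
have hs' : 0 <= cs p <= L by lra.
have hr' : 0 <= cr p <= delta by lra.
have J0 := J_gt0 hs' hr'; have Jn : J p != 0 by rewrite gt_eqF.
have u := unit_speed hs'.
have gs := grad3_cs pD.
have gJ := grad3_J pD.
(* [tf_grad] only provides some partial derivatives in the class, good for integration; by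
   uniqueness of gradients they agree at [p] with this explicit product rule. *)
have gV := grad3M (grad3M (grad3M (gp p) (gp p)) (grad3_comp1 (is_derive_cot_arc hs) gs))
  (grad3_comp1 (is_derive_invX 1 Jn) gJ).
have [-> _ _] := grad3_uniq (gx p) (grad3M gV (grad3_comp1 (dx 1 (cs p)) gs)).
have [_ _ ->] := grad3_uniq (gz p) (grad3M gV (grad3_comp1 (dz 1 (cs p)) gs)).
have lw : lambda <= (pi / L) ^+ 2 * (J p)^-1 ^+ 2 by rewrite exprVn; exact: lambda_le.
have w0 : 0 <= (J p)^-1 by rewrite invr_ge0 ltW.
have := riccati_pointwise (psi p) (h p) lw (cot_dk hs) (proj1 (andP hr')) w0.
rewrite mulrN (mulrC lambda); apply: le_trans; rewrite le_eqVlt; apply/orP; left; apply/eqP.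
rewrite hE (curve_x2 L_gt0 dx dz unit_speed hs') (curve_z2 L_gt0 dx dz unit_speed hs').
move: (psi p) (p0 p) (p2 p) (cot_arc (cs p)) (pi / L) (dk (cs p)) => P P0 P2 X a d.
move: (cr p) (k (cs p)) (xd 1 (cs p)) (zd 1 (cs p)) u Jn => r kk x1 z1 u Jn.
have u' : z1 ^+ 2 = 1 - x1 ^+ 2 by rewrite -u addrC addKr.
rewrite !expr1.
set w := (1 + r * kk)^-1.
transitivity (2 * P * (P0 * x1 + P2 * z1) * X * w + P ^+ 2 * (- a ^+ 2 - X ^+ 2) * w ^+ 2 * (x1 ^+ 2 + z1 ^+ 2)
  - P ^+ 2 * X * r * d * w ^+ 3 * (x1 ^+ 2 + z1 ^+ 2)); last first.
  by rewrite u !mulr1.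
by rewrite -exprVn -/w; ring.
Qed.

End weight.

(* Without powers of [J], primitives in the first coordinate stay in the class,
   and so do products. *)
Inductive tp : (R3 R -> R) -> Prop :=
| tp_mono A b c : bump_in 0 L A -> bump_in 0 delta b -> bump_in (- T) 0 c -> tp (mono A b c 0)
| tp_add f g : tp f -> tp g -> tp (fun p => f p + g p).

Lemma tp_ext f g : f =1 g -> tp f -> tp g.
Proof. by move=> /funext ->. Qed.

Lemma tp_tf f : tp f -> tf f.
Proof. by elim=> [A b c hA hb hc|g h _ tg _ th]; [exact: tf_mono|exact: tf_add]. Qed.

Lemma tp_mul f g : tp f -> tp g -> tp (fun p => f p * g p).
Proof.
move=> tff tfg; elim: tff => [A b c hA hb hc|f1 f2 _ h1 _ h2]; last first.
  by apply: tp_ext (tp_add h1 h2) => p; rewrite mulrDl.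
elim: tfg => [A' b' c' hA' hb' hc'|f1 f2 _ h1 _ h2]; last first.
  by apply: tp_ext (tp_add h1 h2) => p; rewrite mulrDr.
apply: (@tp_ext (mono (fun s => A s * A' s) (fun s => b s * b' s) (fun s => c s * c' s) 0)).
  move=> p; have [pD|pD] := pselect (D p); last by rewrite !mono0// mulr0.
  by rewrite !monoE// !expr0 !divr1; ring.
by apply: tp_mono; apply: bump_inM => //; [case: hA'|case: hb'|case: hc'].
Qed.

Lemma tp_scale f (a : R) : tp f -> tp (fun p => f p * a).
Proof.
elim=> [A b c hA hb hc|f1 f2 _ h1 _ h2]; last by apply: tp_ext (tp_add h1 h2) => p; rewrite mulrDl.
have sa : smooth1 (fun _ : R => a) by exact: smooth1_cst.
apply: tp_ext (tp_mono (bump_inM hA sa) hb hc) => p.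
have [pD|pD] := pselect (D p); last by rewrite !mono0// mul0r.
by rewrite !monoE//; ring.
Qed.

Lemma bump_in0 (a b : R) : bump_in a b (fun=> 0).
Proof. by split; [exact: smooth1_cst|exists 1; rewrite ?ltr01]. Qed.

Lemma tp0 : tp (fun=> 0).
Proof.
apply: tp_ext (tp_mono (bump_in0 0 L) (bump_in0 0 delta) (bump_in0 (- T) 0)) => p.
have [pD|pD] := pselect (D p); last exact: mono0.
by rewrite monoE// !mul0r.
Qed.

Lemma bump_in_bump (a b a' b' : R) : a < a' -> b' < b -> bump_in a b (bump a' b').
Proof.
move=> ha hb; split; first exact: smooth1_bump.
exists (Num.min (a' - a) (b - b')); first by rewrite lt_min !subr_gt0 ha hb.
set l := Num.min _ _; move=> s hs; have [l1 l2] : l <= a' - a /\ l <= b - b' by rewrite /l !ge_min !lexx orbT.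
apply: bump_eq0; apply: contra hs => hs; lra.
Qed.

(** * Density of products of bumps *)

Let box_bump (q : rat * rat * (rat * rat) * (rat * rat)) : R3 R -> R :=
  mono (bump (ratr q.1.1.1) (ratr q.1.1.2)) (bump (ratr q.2.1) (ratr q.2.2))
    (bump (ratr q.1.2.1) (ratr q.1.2.2)) 0.

(** Indices that decode to no box, or to one whose bump is not in the class, are sent to [0], so the
    enumeration is total and never leaves the class. *)
Let bumps n : R3 R -> R :=
  if unpickle n is Some q then if `[< tp (box_bump q) >] then box_bump q else fun=> 0 else fun=> 0.

Let tp_bumps n : tp (bumps n).
Proof.
rewrite /bumps; case: unpickle => [q|]; last exact: tp0.
by case: asboolP => // _; exact: tp0.
Qed.

Let box_bumpE q p : D p -> box_bump q p = bump (ratr q.1.1.1) (ratr q.1.1.2) (cs p)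
  * bump (ratr q.2.1) (ratr q.2.2) (cr p) * bump (ratr q.1.2.1) (ratr q.1.2.2) p.1.2.
Proof. by move=> pD; rewrite /box_bump monoE// expr0 divr1. Qed.

Let bumps_itv n p : 0 <= bumps n p <= 1.
Proof.
have h0 : 0 <= (0 : R) <= 1 by rewrite lexx ler01.
rewrite /bumps; case: unpickle => [q|//]; case: asboolP => // _.
have [pD|pD] := pselect (D p); last by rewrite /box_bump mono0.
rewrite box_bumpE//.
have /andP[a0 a1] := bump_itv (ratr q.1.1.1 : R) (ratr q.1.1.2) (cs p).
have /andP[b0 b1] := bump_itv (ratr q.2.1 : R) (ratr q.2.2) (cr p).
have /andP[c0 c1] := bump_itv (ratr q.1.2.1 : R) (ratr q.1.2.2) p.1.2.
apply/andP; split; first by apply: mulr_ge0 => //; exact: mulr_ge0.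
by apply: mulr_ile1 => //; [exact: mulr_ge0|exact: mulr_ile1].
Qed.

Let bumps_cover (U : set (R3 R)) p : open U -> D p -> U p ->
  exists n, 0 < bumps n p /\ forall q, D q -> 0 < bumps n q -> U q.
Proof.
move=> oU pD pU; have [hs hr hy eX eZ] := coordP pD.
pose F (w : R3 R) : R3 R := ((FX w.1.1 w.2, w.1.2), FZ w.1.1 w.2).
have cF : continuous F.
  have c1 (f : R -> R) : continuous f -> continuous (fun p : R3 R => f p.1.1).
    by move=> cf v; apply: (@continuous_comp _ _ _ (fun v : R3 R => v.1.1) f); [exact: cont_fst1|exact: cf].
  have cxd n : continuous (xd n) by move=> s; apply: is_derive_continuous (dx n s).
  have czd n : continuous (zd n) by move=> s; apply: is_derive_continuous (dz n s).
  apply: continuous_pair; first apply: continuous_pair.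
  - move=> v; apply: cvgD; first exact: (c1 (xd 0)).
    by apply: cvgM; [exact: cont_snd|exact: (c1 (zd 1))].
  - by move=> v; exact: cont_fst2.
  - move=> v; apply: cvgB; first exact: (c1 (zd 0)).
    by apply: cvgM; [exact: cont_snd|exact: (c1 (xd 1))].
pose w : R3 R := (cs p, p.1.2, cr p).
have FE q : D q -> F (cs q, q.1.2, cr q) = q.
  by move=> qD; have [_ _ _ e1 e2] := coordP qD; rewrite /F/= -e1 -e2; case: q {qD e1 e2} => -[].
have nU : nbhs w (F @^-1` U).
  by apply: cF; rewrite /w FE//; exact: open_nbhs_nbhs.
(* The distance to the faces of the coordinate box: smaller rational boxes give bumps supported
   strictly inside. *)
pose e := Num.min (Num.min (cs p) (L - cs p)) (Num.min (Num.min (cr p) (delta - cr p)) (Num.min (p.1.2 + T) (- p.1.2))).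
have e0 : 0 < e by rewrite !lt_min; do !(apply/andP; split); lra.
have [[e1 e2] [e3 e4] [e5 e6]] : [/\ e <= cs p /\ e <= L - cs p, e <= cr p /\ e <= delta - cr p &
    e <= p.1.2 + T /\ e <= - p.1.2] by rewrite /e !ge_min !lexx !orbT.
have [q [qw qU [f1 f2] [f3 f4] [f5 f6]]] := box_nbhs e0 nU.
rewrite /= in f1 f2 f3 f4 f5 f6.
have tq : tp (box_bump q).
  by apply: tp_mono; apply: bump_in_bump; lra.
exists (pickle q); rewrite /bumps pickleK asboolT//; split.
  by case: qw => /= q1 q2 q3; rewrite box_bumpE//; apply: mulr_gt0; [apply: mulr_gt0|]; exact: bump_gt0.
move=> q' qD; rewrite box_bumpE// => h.
rewrite -(FE _ qD); apply: qU; split => /=; apply: contraTT h => h; rewrite (bump_eq0 h) ?mul0r ?mulr0 ?mul0r ltxx//.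
Qed.

Lemma tp_dense (u : R3 R -> R) : measurable_fun (D : set M) u ->
  (vol3 R).-integrable D (fun p => (u p ^+ 2)%:E) -> approximable (vol3 R) D tp u.
Proof.
move=> mu iu.
have mD := measurable_tube.
have Doo := tube_fin.
have mtp f : tp f -> measurable_fun (D : set M) f.
  by move=> /tp_tf; exact: (tf_measurable).
apply: (approximable_sqi mD mtp tp_add tp_scale tp0) => // E mE.
have hU U : open U -> approximable (vol3 R) D tp (\1_U).
  move=> oU; apply: (approximable_union mD Doo mtp tp_add tp_mul tp_scale tp0 (open_measurable3 oU) tp_bumps bumps_itv).
  by move=> p pD pU; exact: bumps_cover.
apply: (approximable_indic mD Doo mtp tp_add tp_scale tp0 (measurable3E R)) => //.
- by move=> A B; exact: openI.
- by have := hU setT openT; rewrite indicT.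
Qed.

(** The primitive that vanishes near [0] is symmetric about [L / 2], because its derivative is
    antisymmetric; so it also vanishes near [L]. *)
Lemma bump_in_odd_primitive (A : R -> R) : bump_in 0 L A ->
  exists2 G, bump_in 0 L G & forall s, derive1 G s = A s - A (L - s).
Proof.
move=> [sA [l l0 A0]]; pose a s := A s - A (L - s).
have sa : smooth1 a.
  apply: smooth1D => //; rewrite (_ : (fun s => _) = fun s => (-1) * A (L + (-1) * s)).
    by apply: smooth1M; [exact: smooth1_cst|exact: smooth1_affine].
  by apply/funext => s; rewrite !mulN1r.
have a0 s : s < l \/ L - l < s -> a s = 0.
  by move=> hs; rewrite /a !A0 ?subrr//; apply/negP => /andP[h1 h2]; lra.
have aN s : a (L - s) = - a s by rewrite /a (_ : L - (L - s) = s) ?opprB//; lra.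
have [F hF] := @antiderivative_from R a (-1) (@smooth1_continuous R a 0 sa).
(* The cut at [0] avoids the region where [F] is uncontrolled; the gluing is smooth because [F] is
   constant on [[0, l)]. *)
pose G s := if 0 < s then F s - F 0 else 0.
have G0 s : s < l -> G s = 0.
  rewrite /G => sl; case: ifP => // s0; apply/eqP; rewrite subr_eq0; apply/eqP.
  apply: (@derive_const R F 0 s); [|lra|lra].
  by move=> t ht; apply: is_derive_eq (hF t _) _; [lra|apply: a0; lra].
have dG (s : R) : is_derive s 1 G (a s).
  have [sl|sl] := ltP s l.
    rewrite a0; last by left.
    apply: near_eq_is_derive (is_deriveC s 0).
    by near=> t; rewrite G0//; near: t; exact: lt_nbhsl.
  apply: (@near_eq_is_derive _ _ _ (fun t => F t - F 0)).
    by near=> t; rewrite /G ifT//; near: t; apply: lt_nbhsr; lra.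
  have d1 := hF s ltac:(lra); apply: is_derive_eq (is_deriveD_fun d1 (is_deriveC s (- F 0))) _.
  by rewrite addr0.
have Gsym s : G (L - s) = G s.
  have dH (t : R) : is_derive t 1 (fun t => G (L - t) - G t) 0.
    have d1 : is_derive t 1 (fun t => L - t) (0 - 1) by derive_tac.
    have d2 := @is_derive_comp_fun R G (fun t => L - t) t _ _ (dG (L - t)) d1.
    apply: is_derive_eq (is_deriveD_fun d2 (is_deriveN_fun (dG t))) _.
    by rewrite aN; ring.
  have := @derive_const R _ (Num.min s (L / 2)) (Num.max s (L / 2)) (fun t _ => dH t) s (L / 2).
  rewrite !ge_min !le_max !lexx !orbT /= => /(_ isT isT).
  by rewrite (_ : L - L / 2 = L / 2) ?subrr; [move/eqP; rewrite subr_eq0 => /eqP|lra].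
exists G; last by move=> s; rewrite derive1E; have [_ ->] := dG s.
split; first exact: smooth1_antiderivative dG sa.
exists l => // s hs; have [sl|sl] := ltP s l; first exact: G0.
by rewrite -Gsym G0//; move: hs; rewrite add0r sl/= -ltNge; lra.
Unshelve. all: by end_near. Qed.

Lemma flip_coord p : D p -> [/\ D (flip p), cs (flip p) = L - cs p & cr (flip p) = cr p].
Proof.
move=> pD; have [hs hr hy eX eZ] := coordP pD.
have hs' : 0 <= cs p <= L by lra.
have x0 := symm symmetric hs'.
have x1 := reflect_x1 L_gt0 dx symmetric hs'; have z1 := reflect_z1 L_gt0 dz symmetric hs'.
have eX' : (flip p).1.1 = FX (L - cs p) (cr p).
  by rewrite /= eX /offX x0.1 z1; ring.
have eZ' : (flip p).2 = FZ (L - cs p) (cr p).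
  by rewrite /= eZ /offZ x0.2 x1; ring.
have hs2 : 0 < L - cs p < L by lra.
have [-> ->] := coord_uniq hs2 hr eX' eZ'; split => //.
by exists (L - cs p), (cr p); split.
Qed.

Lemma flipK (p : R3 R) : flip (flip p) = p.
Proof. by case: p => -[a b] c; rewrite /flip/= opprK. Qed.

Lemma flip_tube : @flip R @^-1` D = D.
Proof.
apply/seteqP; split => p /=; last by move=> /flip_coord[].
by move=> /flip_coord[]; rewrite flipK.
Qed.

(** Take the primitive in [s] of the antisymmetrized first factor. Differentiating along [tau]
    divides its [s]-derivative by [J], and the contribution of the factor in [r] is normal, hence
    drops out. *)
Lemma tp_odd f : tp f -> exists psi p0 p1 p2, [/\ tf psi, tf p0, tf p2,
  forall p, grad3 psi p (p0 p) (p1 p) (p2 p) &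
  forall p, D p -> (f p - f (flip p)) / J p = p0 p * xd 1 (cs p) + p2 p * zd 1 (cs p)].
Proof.
elim=> [A b c hA hb hc|f1 f2 _ [g [a0 [a1 [a2 [h1 h2 h3 h4 h5]]]]] _ [g' [b0 [b1 [b2 [k1 k2 k3 k4 k5]]]]]].
  have [G hG GE] := bump_in_odd_primitive hA.
  have tG := tf_mono 0 hG hb hc.
  have [p0 [p1 [p2 [t0 t1 t2 gp]]]] := tf_grad tG.
  exists (mono G b c 0), p0, p1, p2; split => // p pD.
  have [e0 _ e2] := grad3_uniq (gp p) (mono_grad 0 p hG hb hc).
  have [hs hr hy _ _] := coordP pD; have hs' : 0 <= cs p <= L by lra.
  have u := unit_speed hs'.
  have J0 := Jp_gt0 pD; have Jn : J p != 0 by rewrite gt_eqF.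
  have [fD fs fr] := flip_coord pD.
  rewrite e0 e2 !monoE// fs fr !GE /= !expr0 !divr1.
  move: (A _) (A (L - _)) (b _) (derive1 b _) (c _) (G _) => A1 A2 b1 b2 c1 G1.
  transitivity ((A1 - A2) * b1 * c1 / J p * (xd 1 (cs p) ^+ 2 + zd 1 (cs p) ^+ 2)).
    by rewrite u mulr1; field.
  by rewrite expr1 mulr0n; field.
exists (fun p => g p + g' p), (fun p => a0 p + b0 p), (fun p => a1 p + b1 p), (fun p => a2 p + b2 p).
split; [exact: tf_add|exact: tf_add|exact: tf_add|move=> p; exact: grad3D|].
move=> p pD; transitivity ((f1 p - f1 (flip p)) / J p + (f2 p - f2 (flip p)) / J p).
  by rewrite -mulrDl opprD addrACA.
by rewrite h5// k5//; ring.
Qed.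

(** * Approximation of odd functions and the dual bound *)

Variables m0 m1 : R.
Hypothesis m0_gt0 : 0 < m0.
Hypothesis J_bounds : forall s r : R, 0 <= s <= L -> 0 <= r <= delta -> m0 <= 1 + r * k s <= m1.

Let mD := measurable_tube.

Let cs_itv p : D p -> 0 <= cs p <= L.
Proof. by move=> /coordP[]; lra. Qed.

Let cr_itv p : D p -> 0 <= cr p <= delta.
Proof. by move=> /coordP[]; lra. Qed.

Let Jp_bounds p : D p -> m0 <= J p <= m1.
Proof. by move=> pD; apply: J_bounds; [exact: cs_itv|exact: cr_itv]. Qed.

Lemma measurable_J : measurable_fun (D : set M) (fun p => J p).
Proof.
apply: continuous_measurable3; first exact: tube_open.
move=> p pD; have gJ := grad3_J pD.
exact: grad3_continuous gJ.
Qed.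

Lemma tf_square_integrable f : tf f -> square_integrable D f.
Proof.
move=> tff; split; first exact: (tf_measurable tff).
have := tf_integrable (tf_mul tff tff).
by under [X in _.-integrable _ X]eq_fun do rewrite /= -expr2.
Qed.

Lemma square_integrable_mulJ u : square_integrable D u -> square_integrable D (fun p => u p * J p).
Proof.
move=> [mu iu]; have mv : measurable_fun (D : set M) (fun p => u p * J p).
  by apply: measurable_funM => //; exact: measurable_J.
split => //; apply: (le_integrable mD _ _ (integrableZl mD (m1 ^+ 2) iu)).
  by apply/measurable_EFinP; apply: measurable_funX.
move=> p pD; have hJ := Jp_bounds pD.
have h : (u p * J p) ^+ 2 <= m1 ^+ 2 * u p ^+ 2.
  rewrite exprMn mulrC ler_wpM2r ?sqr_ge0// ler_sqr ?nnegrE; move: m0_gt0 hJ; lra.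
by rewrite -EFinM /= lee_fin ger0_norm ?sqr_ge0// ger0_norm// mulr_ge0 ?sqr_ge0.
Qed.

(** Density is applied to [u * J], since [tp_odd] yields the odd part of the approximant divided by
    [J]. Taking the odd part does not increase the mean square error, as the reflection preserves
    volume. *)
Lemma odd_approx u (e : R) : square_integrable D u -> odd_in_x D u -> 0 < e ->
  exists psi p0 p1 p2, [/\ tf psi, tf p0, tf p2,
  forall p, grad3 psi p (p0 p) (p1 p) (p2 p) &
  \int[vol3 R]_(p in D) ((u p - (p0 p * xd 1 (cs p) + p2 p * zd 1 (cs p))) ^+ 2) < e].
Proof.
move=> su odd_u e0; have [mv iv] := square_integrable_mulJ su.
have [mu iu] := su.
(* The factor [m0 ^+ 2] pays for the division by [J] in [odd_part_sq]. *)
have e'0 : 0 < e * m0 ^+ 2 by rewrite mulr_gt0// exprn_gt0.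
have [f tpf hf] := tp_dense mv iv e'0.
have tpf2 : tp (fun p => f p * 2^-1) by exact: tp_scale.
have [psi [p0 [p1 [p2 [t1 t2 t3 gp hE]]]]] :=
  tp_odd tpf2.
exists psi, p0, p1, p2; split => //.
pose h p := p0 p * xd 1 (cs p) + p2 p * zd 1 (cs p).
have sx : smooth1 (xd 1) := @smooth1_xd 1; have sz : smooth1 (zd 1) := @smooth1_zd 1.
have tfh : tf h by exact: (tf_add (tf_mul_cs t2 sx) (tf_mul_cs t3 sz)).
have [mh ih] := tf_square_integrable tfh.
have mf : measurable_fun (D : set M) f.
  exact: (tf_measurable (tp_tf tpf)).
pose w (p : M) := ((u p * J p - f p) ^+ 2)%:E.
have mw : measurable_fun (D : set M) w by exact: measurable_sqB.
have w0 p : (0 <= w p)%E by rewrite lee_fin sqr_ge0.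
have fD : @flip R @^-1` D = D by exact: (flip_tube).
have mwf : measurable_fun (D : set M) (fun p => w (flip p)).
  apply: (measurable_comp (F := D : set M)) => //.
    by move=> _ [p pD <-]; rewrite -fD in pD.
  by apply: measurable_funTS; exact: measurable_flip.
have le1 : (\int[vol3 R]_(p in D) ((u p - h p) ^+ 2)%:E <=
    (m0 ^- 2)%:E * (\int[vol3 R]_(p in D) w p))%E.
  have -> : (\int[vol3 R]_(p in D) w p = \int[vol3 R]_(p in D) (2^-1%:E * w p + 2^-1%:E * w (flip p)))%E.
    rewrite ge0_integralD//; try by [move=> p _; rewrite mule_ge0// lee_fin invr_ge0|exact: measurable_funeM].
    rewrite !ge0_integralZl//; try by rewrite lee_fin invr_ge0.
    rewrite (integral_flip mD mw w0 fD) -ge0_muleDl ?lee_fin ?invr_ge0//.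
    by rewrite -EFinD (_ : 2^-1 + 2^-1 = 1 :> R) ?mul1e//; lra.
  rewrite -ge0_integralZl//; first last.
  - by rewrite lee_fin invr_ge0 exprn_ge0 ?ltW.
  - by move=> p _; rewrite adde_ge0// mule_ge0// lee_fin invr_ge0.
  - by apply: emeasurable_funD; exact: measurable_funeM.
  apply: ae_ge0_le_integral => //.
  - by move=> p _; rewrite lee_fin sqr_ge0.
  - exact: measurable_sqB.
  - move=> p _; apply: mule_ge0; first by rewrite lee_fin invr_ge0 exprn_ge0 ?ltW.
    by apply: adde_ge0; apply: mule_ge0 => //; rewrite lee_fin invr_ge0.
  - by apply: measurable_funeM; apply: emeasurable_funD; exact: measurable_funeM.
  have [N [mN N0 sN]] := odd_u; exists N; split => // p hp; apply: sN => up; apply: hp => pD.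
  have uE : u (flip p) = - u p := up pD.
  have hs' := cs_itv pD; have hJ := Jp_bounds pD.
  have [_ fs fr] := flip_coord pD.
  rewrite /w fs fr uE (kappa_reflect L_gt0 dx dz symmetric hs').
  rewrite (_ : (_ * (_ + _))%E = (m0 ^- 2 * (2^-1 * (u p * J p - f p) ^+ 2
    + 2^-1 * (- u p * J p - f (flip p)) ^+ 2))%:E)// lee_fin /h -hE//.
  by apply: odd_part_sq => //; case/andP: hJ.
have le2 : (\int[vol3 R]_(p in D) ((u p - h p) ^+ 2)%:E < e%:E)%E.
  apply: le_lt_trans le1 _; rewrite muleC -lte_pdivlMr ?invr_gt0 ?exprn_gt0//.
  by rewrite invrK -EFinM.
have fin : (\int[vol3 R]_(p in D) ((u p - h p) ^+ 2)%:E \is a fin_num)%E.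
  rewrite ge0_fin_numE; first by apply: lt_trans le2 _; rewrite ltry.
  by apply: integral_ge0 => p _; rewrite lee_fin sqr_ge0.
by rewrite -lte_fin /Rintegral fineK.
Qed.

Variable lambda : R.
Hypothesis lambda_gt0 : 0 < lambda.
Hypothesis lambda_le : forall s r : R, 0 <= s <= L -> 0 <= r <= delta ->
  lambda <= (pi / L) ^+ 2 / (1 + r * k s) ^+ 2.
Hypothesis cot_dk : forall s : R, 0 < s < L -> 0 <= cot_arc s * dk s.

Lemma odd_duality u G psi p0 p1 p2 : H1_with_gradient D u G -> tf psi -> tf p0 -> tf p2 ->
  (forall p, grad3 psi p (p0 p) (p1 p) (p2 p)) ->
  \int[vol3 R]_(p in D) (u p * (p0 p * xd 1 (cs p) + p2 p * zd 1 (cs p))) =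
  - \int[vol3 R]_(p in D) ((G ord0 p * xd 1 (cs p) + G ord_max p * zd 1 (cs p)) * psi p).
Proof.
move=> [su sG] tfp tf0 tf2 gp.
have sx : smooth1 (xd 1) := @smooth1_xd 1; have sz : smooth1 (zd 1) := @smooth1_zd 1.
have tx : tf (fun p => psi p * xd 1 (cs p)) by exact: tf_mul_cs.
have tz : tf (fun p => psi p * zd 1 (cs p)) by exact: tf_mul_cs.
have [sG0 w0] := sG ord0; have [sG2 w2] := sG ord_max.
have ex := w0 _ (tf_test_function tx).
have ez := w2 _ (tf_test_function tz).
have iM a b : square_integrable D a -> tf b -> (vol3 R).-integrable D (EFin \o (fun p => a p * b p)).
  by move=> sa tb; apply: integrable_sqM => //; exact: tf_square_integrable.
have tdx := tf_derive ord0 tx.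
have tdz := tf_derive ord_max tz.
(* The derivatives of [xd 1] and [zd 1] contribute [psi] times the divergence of [tau], which
   cancels. *)
transitivity (\int[vol3 R]_(p in D) (u p * 'D_(basis3 R ord0) (fun p => psi p * xd 1 (cs p)) p +
   u p * 'D_(basis3 R ord_max) (fun p => psi p * zd 1 (cs p)) p)).
  apply: eq_Rintegral => p; rewrite inE => pD.
  have gs := grad3_cs pD.
  have hs' := cs_itv pD.
  rewrite (grad3_derive ord0 (grad3M (gp p) (grad3_comp1 (dx 1 (cs p)) gs))).
  rewrite (grad3_derive ord_max (grad3M (gp p) (grad3_comp1 (dz 1 (cs p)) gs))).
  rewrite !(tnth_nth 0)/= (curve_x2 L_gt0 dx dz unit_speed hs') (curve_z2 L_gt0 dx dz unit_speed hs').
  by ring.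
rewrite RintegralD//; [|exact: iM|exact: iM].
rewrite ex ez -opprD; congr (- _).
rewrite -RintegralD//; [|exact: iM|exact: iM].
by apply: eq_Rintegral => p _; ring.
Qed.

(** Cauchy-Schwarz is used with weight [lambda]: the resulting [lambda] times the integral of
    [psi ^+ 2] is absorbed by that of [h ^+ 2] through [tangential_inequality]. So [psi] needs no
    bound uniform in the approximation. *)
Lemma odd_bound u G : H1_with_gradient D u G -> odd_in_x D u ->
  lambda * \int[vol3 R]_(p in D) (u p ^+ 2) <= \sum_(i < 3) \int[vol3 R]_(p in D) (G i p ^+ 2).
Proof.
move=> hu odd_u; have [su sG] := hu.
have [sG0 _] := sG ord0; have [sG2 _] := sG ord_max; have [sG1 _] := sG (lift ord0 ord0).
have iG i : 0 <= \int[vol3 R]_(p in D) (G i p ^+ 2) by apply: Rintegral_ge0 => p _; exact: sqr_ge0.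
have sx : smooth1 (xd 1) := @smooth1_xd 1; have sz : smooth1 (zd 1) := @smooth1_zd 1.
set E := \sum_(i < 3) _.
have EE : \int[vol3 R]_(p in D) (G ord0 p ^+ 2) + \int[vol3 R]_(p in D) (G ord_max p ^+ 2) <= E.
  rewrite /E !big_ord_recl big_ord0 addr0 lerD2l.
  rewrite (_ : lift ord0 (lift ord0 ord0) = ord_max); last exact/val_inj.
  by rewrite lerDr.
apply/ler_addgt0Pr => e e0.
have el0 : 0 < e / lambda by rewrite divr_gt0.
have [psi [p0 [p1 [p2 [t1 t2 t3 gp hlt]]]]] := odd_approx su odd_u el0.
pose h p := p0 p * xd 1 (cs p) + p2 p * zd 1 (cs p).
have tfh : tf h by exact: (tf_add (tf_mul_cs t2 sx) (tf_mul_cs t3 sz)).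
have sh := tf_square_integrable tfh; have sp := tf_square_integrable t1.
have h1 := tangential_inequality lambda_le cot_dk t1 t2 t3 gp (fun p => erefl (h p)).
have h2 := odd_duality hu t1 t2 t3 gp.
have iu2 := square_integrableE su; have ih2 := square_integrableE sh; have ip2 := square_integrableE sp.
have i02 := square_integrableE sG0; have i22 := square_integrableE sG2.
have iuh := integrable_sqM mD su sh.
have iZ (a : R) (f : R3 R -> R) : (vol3 R).-integrable D (EFin \o f) ->
    (vol3 R).-integrable D (EFin \o (fun p => a * f p)) by move=> i; exact: (integrableZl mD a i).
have iD (f f' : R3 R -> R) : (vol3 R).-integrable D (EFin \o f) -> (vol3 R).-integrable D (EFin \o f') ->
    (vol3 R).-integrable D (EFin \o (fun p => f p + f' p)) by move=> i i'; exact: (integrableD mD i i').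
have e1 : \int[vol3 R]_(p in D) ((u p - h p) ^+ 2) =
   \int[vol3 R]_(p in D) (u p ^+ 2) - 2 * \int[vol3 R]_(p in D) (u p * h p) + \int[vol3 R]_(p in D) (h p ^+ 2).
  transitivity (\int[vol3 R]_(p in D) (u p ^+ 2 + - 2 * (u p * h p) + h p ^+ 2)).
    by apply: eq_Rintegral => p _; ring.
  have i2 : (vol3 R).-integrable D (EFin \o (fun p => - 2 * (u p * h p))) by exact: iZ.
  rewrite RintegralD//; last exact: iD.
  by rewrite RintegralD// RintegralZl// mulNr.
pose g p := G ord0 p * xd 1 (cs p) + G ord_max p * zd 1 (cs p).
have tx : tf (fun p => psi p * xd 1 (cs p)) by exact: tf_mul_cs.
have tz : tf (fun p => psi p * zd 1 (cs p)) by exact: tf_mul_cs.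
have ig : (vol3 R).-integrable D (EFin \o (fun p => g p * psi p)).
  rewrite (_ : (fun p => _) = fun p => G ord0 p * (psi p * xd 1 (cs p)) + G ord_max p * (psi p * zd 1 (cs p))).
    by apply: iD; apply: integrable_sqM => //; exact: tf_square_integrable.
  by apply/funext => p; rewrite /g; ring.
have e2 : - 2 * \int[vol3 R]_(p in D) (g p * psi p) <= lambda^-1 * \int[vol3 R]_(p in D) (G ord0 p ^+ 2) +
    lambda^-1 * \int[vol3 R]_(p in D) (G ord_max p ^+ 2) + lambda * \int[vol3 R]_(p in D) (psi p ^+ 2).
  have j0 := iZ lambda^-1 _ i02; have j2 := iZ lambda^-1 _ i22; have jp := iZ lambda _ ip2.
  rewrite -!RintegralZl// -RintegralD// -RintegralD//; last exact: iD.
  apply: le_Rintegral => //; [exact: iZ|by apply: (iD _ _ _ jp); exact: iD|].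
  move=> p pD; have us := unit_speed (cs_itv pD); rewrite /g.
  move: (G ord0 p) (G ord_max p) (psi p) (xd 1 (cs p)) (zd 1 (cs p)) us => a b c x1 z1 us.
  have cauchy : (a * x1 + b * z1) ^+ 2 <= a ^+ 2 + b ^+ 2.
    rewrite -[leRHS]mulr1 -us -subr_ge0.
    by rewrite (_ : _ - _ = (a * z1 - b * x1) ^+ 2) ?sqr_ge0//; ring.
  have sq : 0 <= lambda^-1 * ((a * x1 + b * z1) + lambda * c) ^+ 2.
    by rewrite mulr_ge0 ?sqr_ge0// invr_ge0 ltW.
  have li : 0 <= lambda^-1 by rewrite invr_ge0 ltW.
  have ln : lambda != 0 by rewrite gt_eqF.
  have := ler_wpM2l li cauchy.
  have -> : lambda^-1 * (a * x1 + b * z1) ^+ 2 = lambda^-1 * ((a * x1 + b * z1) + lambda * c) ^+ 2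
     - 2 * ((a * x1 + b * z1) * c) - lambda * c ^+ 2 by field.
  move: sq; rewrite (mulrDr lambda^-1 (a ^+ 2)); lra.
rewrite e1 h2 -/g in hlt.
have hlt' : \int[vol3 R]_(p in D) (u p ^+ 2) < e / lambda - 2 * \int[vol3 R]_(p in D) (g p * psi p)
   - \int[vol3 R]_(p in D) (h p ^+ 2) by move: hlt; rewrite /g; lra.
rewrite mulrC -ler_pdivlMr// mulrDl; apply: ltW; apply: lt_le_trans hlt' _.
have li : 0 <= lambda^-1 by rewrite invr_ge0 ltW.
have := ler_wpM2l li EE; rewrite mulrDr (mulrC _ E).
by move: e2 h1; lra.
Qed.

End tube_coordinates.

(** * The eigenvalue bound *)

Section tube_eigenvalue.
Variables (R : realType) (L T delta : R) (xd zd : nat -> R -> R).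
Hypotheses (L_gt0 : 0 < L) (T_gt0 : 0 < T) (delta_gt0 : 0 < delta).
Hypothesis dx : forall n (s : R), is_derive s 1 (xd n) (xd n.+1 s).
Hypothesis dz : forall n (s : R), is_derive s 1 (zd n) (zd n.+1 s).
Hypothesis unit_speed : forall s : R, 0 <= s <= L -> xd 1 s ^+ 2 + zd 1 s ^+ 2 = 1.
Hypothesis simple : forall s t : R, 0 <= s <= L -> 0 <= t <= L -> s < t ->
  xd 0 s = xd 0 t -> zd 0 s = zd 0 t -> s = 0 /\ t = L.
Hypothesis nonclosed : xd 0 0 = xd 0 L -> zd 0 0 = zd 0 L -> False.
Hypothesis symmetric : forall s : R, 0 <= s <= L / 2 ->
  xd 0 (L - s) = - xd 0 s /\ zd 0 (L - s) = zd 0 s.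
Local Notation k := (kappa xd zd).
Local Notation dk := (dkappa xd zd).
Local Notation FX := (offX xd zd).
Local Notation FZ := (offZ xd zd).
Hypothesis concave : forall p s t : R, 0 <= p <= 1 -> 0 <= s <= L -> 0 <= t <= L ->
  p * k s + (1 - p) * k t <= k (p * s + (1 - p) * t).
Hypothesis Jdelta_gt0 : forall s : R, 0 <= s <= L -> 0 < 1 + delta * k s.
Local Notation D := (tube_set L T delta xd zd).
Hypothesis D_contractible : loops_contractible D.

Lemma J_lower_bound : exists2 m0, 0 < m0 &
  forall s r : R, 0 <= s <= L -> 0 <= r <= delta -> m0 <= 1 + r * k s.
Proof.
have cJ : {within `[0, L], continuous (fun s => 1 + delta * k s)}.
  apply: continuous_subspaceT => s; apply: cvgD; first exact: cvg_cst.
  by apply: cvgM; [exact: cvg_cst|exact: kappa_cont dx dz s].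
have [c hc hmin] := EVT_min (ltW L_gt0) cJ.
have hc' : 0 <= c <= L by move: hc; rewrite in_itv.
have c0 := Jdelta_gt0 hc'.
exists (Num.min 1 (1 + delta * k c)); first by rewrite lt_min ltr01.
move=> s r hs hr; have /hmin : s \in `[0, L] by rewrite in_itv.
set m := Num.min _ _; move=> h.
have [m1 m2] : m <= 1 /\ m <= 1 + delta * k c by rewrite /m !ge_min !lexx orbT.
have [q [q0 q1 rE]] : exists q : R, [/\ 0 <= q, q <= 1 & r = q * delta].
  have d0 : delta != 0 by rewrite gt_eqF.
  exists (r / delta); split; last by rewrite divfK.
  - by rewrite divr_ge0//; [lra|exact: ltW].
  - by rewrite ler_pdivrMr// mul1r; lra.
rewrite rE; move: (k s) (k c) h m2 => a b h m2; nra.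
Qed.

(** The straight segment between two coordinate pairs with the same image becomes a closed loop in
    [D], placed at height [- (T / 2)]; contracting it supplies the polar angle. *)
Lemma offset_inj s1 r1 s2 r2 : 0 < s1 < L -> 0 < r1 < delta -> 0 < s2 < L -> 0 < r2 < delta ->
  FX s1 r1 = FX s2 r2 -> FZ s1 r1 = FZ s2 r2 -> s1 = s2 /\ r1 = r2.
Proof.
apply: (offset_injective L_gt0 delta_gt0 dx dz unit_speed simple nonclosed symmetric concave Jdelta_gt0).
move=> px pz out {}s1 {}r1 {}s2 {}r2 hs1 hr1 hs2 hr2 eX eZ.
pose c (t : R) : R3 R := ((FX (s1 + t * (s2 - s1)) (r1 + t * (r2 - r1)), - (T / 2)),
  FZ (s1 + t * (s2 - s1)) (r1 + t * (r2 - r1))).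
have cl (a b : R) : continuous (fun t : R => a + t * (b - a)).
  by move=> t; apply: cvgD; [exact: cvg_cst|apply: cvgM; [exact: cvg_id|exact: cvg_cst]].
have cf (f : nat -> R -> R) n : (forall n (s : R), is_derive s 1 (f n) (f n.+1 s)) ->
    continuous (fun t : R => f n (s1 + t * (s2 - s1))).
  move=> df t; apply: (@continuous_comp _ _ _ (fun t : R => s1 + t * (s2 - s1)) (f n)); first exact: cl.
  exact: is_derive_continuous (df n _).
apply: (@loop_winding R D c px pz D_contractible).
- apply: continuous_subspaceT; apply: continuous_pair; first apply: continuous_pair.
  + move=> t; apply: cvgD; first exact: (cf xd 0%N dx).
    by apply: cvgM; [exact: cl|exact: (cf zd 1%N dz)].
  + by move=> t; exact: cvg_cst.
  + move=> t; apply: cvgB; first exact: (cf zd 0%N dz).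
    by apply: cvgM; [exact: cl|exact: (cf xd 1%N dx)].
- move=> t; rewrite in_itv/= => ht.
  exists (s1 + t * (s2 - s1)), (r1 + t * (r2 - r1)); split => //=.
  + exact: segment_itvoo.
  + exact: segment_itvoo.
  + by move: T_gt0; lra.
- by rewrite /c !mul0r !addr0 !mul1r !(addrC _ (_ - _)) !subrK eX eZ.
- by move=> p [s [r [hs hr _ -> ->]]]; exact: out.
Qed.

Lemma cot_dkappa_ge0 (s : R) : 0 < s < L -> 0 <= cot_arc L s * dk s.
Proof.
move=> hs; have s0 := sin_arc_gt0 L_gt0 hs; rewrite /cot_arc.
have pL : 0 < pi / L by rewrite divr_gt0// pi_gt0.
have Ln : L != 0 by rewrite gt_eqF.
have half : pi / L * (L / 2) = pi / 2 :> R by field.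
have full : pi / L * L = pi :> R by field.
have [h|h|->] := ltgtP s (L / 2).
- have c0 : 0 < cos (pi / L * s).
    apply: cos_gt0_pihalf; rewrite -half ltr_pM2l// h andbT.
    by apply: lt_trans (_ : 0 < _); [rewrite oppr_lt0 half divr_gt0// pi_gt0|rewrite mulr_gt0//; lra].
  have d0 : 0 <= dk s by apply: (dkappa_ge0 L_gt0 dx dz symmetric concave); lra.
  by apply: mulr_ge0 => //; apply: divr_ge0; [apply: mulr_ge0|]; exact: ltW.
- have c0 : cos (pi / L * s) < 0.
    rewrite -[X in cos X](subrK pi) cosDpi oppr_lt0; apply: cos_gt0_pihalf.
    have h1 : pi / 2 < pi / L * s by rewrite -half ltr_pM2l.
    have h2 : pi / L * s < pi by rewrite -[ltRHS]full ltr_pM2l//; case/andP: hs.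
    by have := pi_gt0 R; move: (pi / L * s) h1 h2 => a; lra.
  have d0 : dk s <= 0 by apply: (dkappa_le0 L_gt0 dx dz symmetric concave); lra.
  rewrite mulr_le0// pmulr_lle0 ?invr_gt0// pmulr_rle0// ltW//.
- by rewrite half cos_pihalf mulr0 !mul0r.
Qed.

Lemma odd_eigenvalue_ge (B mu : R) (u : R3 R -> R) : 0 < B ->
  (forall s r : R, 0 <= s <= L -> 0 <= r <= delta -> B <= ((1 + r * k s) ^+ 2)^-1) ->
  neumann_eigenfunction D mu u -> odd_in_x D u -> B * (pi ^+ 2 / L ^+ 2) <= mu.
Proof.
move=> B0 hB [nz [G [hu eig]]] odd_u.
have [m0 m00 hm0] := J_lower_bound.
have J0 (s r : R) : 0 <= s <= L -> 0 <= r <= delta -> 0 < 1 + r * k s.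
  by move=> hs hr; apply: lt_le_trans m00 (hm0 _ _ hs hr).
(* The lower bound [B] on [J ^- 2] bounds [J ^+ 2] by [B^-1], and [j <= 1 + j ^+ 2] gives the upper
   bound on [J]. *)
have Jb (s r : R) : 0 <= s <= L -> 0 <= r <= delta -> m0 <= 1 + r * k s <= 1 + B^-1.
  move=> hs hr; rewrite hm0//=; have := hB _ _ hs hr; have := J0 _ _ hs hr.
  move: (1 + r * k s) => j j0 hj.
  have : j ^+ 2 <= B^-1 by rewrite -[leLHS]invrK lef_pV2 ?posrE ?invr_gt0 ?exprn_gt0.
  have := sqr_ge0 (j - 1); nra.
have l0 : 0 < B * (pi ^+ 2 / L ^+ 2) by rewrite mulr_gt0// divr_gt0 ?exprn_gt0 ?pi_gt0.
have l1 (s r : R) : 0 <= s <= L -> 0 <= r <= delta ->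
    B * (pi ^+ 2 / L ^+ 2) <= (pi / L) ^+ 2 / (1 + r * k s) ^+ 2.
  move=> hs hr; rewrite expr_div_n mulrC ler_wpM2l ?hB//.
  by rewrite divr_ge0 ?sqr_ge0.
have := odd_bound L_gt0 dx dz unit_speed symmetric J0 offset_inj m00 Jb l0 l1 cot_dkappa_ge0 hu odd_u.
have [[mu_ iu] _] := hu.
(* The weak equation tested against the eigenfunction itself. *)
have E : \sum_(i < 3) \int[vol3 R]_(p in D) (G i p ^+ 2) = mu * \int[vol3 R]_(p in D) (u p ^+ 2).
  transitivity (\sum_(i < 3) \int[vol3 R]_(p in D) (G i p * G i p)).
    by apply: eq_bigr => i _; apply: eq_Rintegral => p _; rewrite expr2.
  by rewrite (eig u G hu); congr (_ * _); apply: eq_Rintegral => p _; rewrite expr2.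
rewrite E ler_pM2r// lt_neqAle Rintegral_ge0 ?andbT; last by move=> p _; exact: sqr_ge0.
have mD := @measurable_tube R L T delta xd zd L_gt0 dx dz unit_speed J0 offset_inj.
apply/eqP => int0; apply: nz.
have i0 : (\int[vol3 R]_(p in D) ((u p ^+ 2)%:E) = 0)%E.
  by rewrite -[LHS]fineK; [congr EFin; exact: esym int0|exact: integrable_fin_num iu].
have : (\int[vol3 R]_(p in D) `|(u p ^+ 2)%:E| = 0)%E.
  by rewrite -[RHS]i0; apply: eq_integral => p _; rewrite gee0_abs// lee_fin sqr_ge0.
have mu2 : measurable_fun (D : set (measurableTypeR R * measurableTypeR R * measurableTypeR R)) (fun p => (u p ^+ 2)%:E : \bar R).
  by apply/measurable_EFinP; apply: measurable_funX.
move=> /(ae_eq_integral_abs _ mD mu2)[N [mN N0 sN]].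
exists N; split => // p hp; apply: sN => h; apply: hp => pD.
by have [/eqP] := h pD; rewrite sqrf_eq0 => /eqP.
Qed.

End tube_eigenvalue.

(** * From the hypotheses of the theorem to those of the sections *)

Lemma concave_ineq (R : realType) (L : R) (k : R -> R) :
  convex_function (`[0, L] : set R^o) (fun s => - k s) ->
  forall p s t : R, 0 <= p <= 1 -> 0 <= s <= L -> 0 <= t <= L ->
  p * k s + (1 - p) * k t <= k (p * s + (1 - p) * t).
Proof.
move=> cvx p s t /andP[p0 p1] hs ht.
have := cvx (Itv01 p0 p1) s t; rewrite !inE /= !in_itv/= => /(_ hs ht).
rewrite !convRE /= /unstable.onem; lra.
Qed.

Lemma tube_setE (R : realType) (x z : R -> R) (L T delta : R) : smooth1 x -> smooth1 z ->
  (forall s, s \in `[0, L] -> norm3 (derive1 (alpha x z) s) = 1) ->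
  tube x z L T delta = tube_set L T delta (fun n => derive1n n x) (fun n => derive1n n z).
Proof.
move=> sx sz arc.
have dx (s : R) : derivable x s 1 := sx 0%N s.
have dz (s : R) : derivable z s 1 := sz 0%N s.
have pE (s t r : R) : 0 < s < L -> phi x z s t + r *: nu x z s t =
    (x s + r * derive1 z s, - t, z s - r * derive1 x s).
  move=> hs; rewrite phiE nuE//; last by apply: arc; rewrite in_itv/=; lra.
  by congr (_, _, _); rewrite /= /GRing.scale/= ?mulr0 ?addr0// mulrN.
apply/seteqP; split => p.
  move=> [s [t [r []]]]; rewrite !in_itv/= => hs ht hr ->; rewrite pE//.
  by exists s, r; split => //=; lra.
move=> [s [r [hs hr hy eX eZ]]]; exists s, (- p.1.2), r; rewrite !in_itv/=; split => //; first lra.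
by rewrite pE// opprK; case: p {hy} eX eZ => -[a b] c /= -> ->.
Qed.

Unset Implicit Arguments.

Theorem theorem4p1 (R : realType) (L T delta : R) (x z : R -> R)
    (L_gt0 : 0 < L) (T_gt0 : 0 < T) (delta_gt0 : 0 < delta)
    (x_smooth : smooth1 x) (z_smooth : smooth1 z)
    (alpha_simple : forall s s', s \in `[0, L] -> s' \in `[0, L] -> s < s' ->
       alpha x z s = alpha x z s' -> s = 0 /\ s' = L)
    (alpha_nonclosed : alpha x z 0 <> alpha x z L)
    (alpha_arclength : forall s, s \in `[0, L] ->
       norm3 (derive1 (alpha x z) s) = 1)
    (alpha_symmetric : forall s, s \in `[0, L / 2] ->
       x (L - s) = - x s /\ z (L - s) = z s)
    (curvature_concave :
       convex_function (`[0, L] : set R^o) (fun s => - curvature x z s))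
    (curvature_delta : forall s, s \in `[0, L] ->
       0 < 1 + delta * curvature x z s)
    (D_simply_connected : simply_connected (tube x z L T delta))
    (mu1odd : R)
    (mu1odd_min : is_minimum (odd_neumann_spectrum (tube x z L T delta)) mu1odd)
    (B : R)
    (B_min : is_minimum
       [set b | exists r s, [/\ r \in `[0, delta], s \in `[0, L] &
          b = ((1 + r * curvature x z s) ^+ 2)^-1]] B) :
  B * (pi ^+ 2 / L ^+ 2) <= mu1odd.
Proof.
pose xd n := derive1n n x; pose zd n := derive1n n z.
have dx n (s : R) : is_derive s 1 (xd n) (xd n.+1 s) by exact: smooth1_is_derive.
have dz n (s : R) : is_derive s 1 (zd n) (zd n.+1 s) by exact: smooth1_is_derive.
have kE : curvature x z = kappa xd zd by [].
have sub (a s : R) : 0 <= s <= a -> s \in `[0, a] by rewrite in_itv.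
have unit_speed (s : R) : 0 <= s <= L -> xd 1 s ^+ 2 + zd 1 s ^+ 2 = 1.
  move=> hs; have := alpha_arclength s (sub _ _ hs).
  rewrite derive1_alpha; [|exact: (x_smooth 0%N)|exact: (z_smooth 0%N)].
  rewrite /norm3 /dot3/= mulr0 addr0 => /(congr1 (fun a => a ^+ 2)).
  by rewrite sqr_sqrtr ?addr_ge0 -?expr2 ?sqr_ge0// expr1n.
have simple (s t : R) : 0 <= s <= L -> 0 <= t <= L -> s < t ->
    xd 0 s = xd 0 t -> zd 0 s = zd 0 t -> s = 0 /\ t = L.
  move=> hs ht st eX eZ; apply: alpha_simple; [exact: sub|exact: sub|exact: st|].
  by rewrite /alpha; congr (_, _, _).
have nonclosed : xd 0 0 = xd 0 L -> zd 0 0 = zd 0 L -> False.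
  by move=> eX eZ; apply: alpha_nonclosed; rewrite /alpha; congr (_, _, _).
have symmetric (s : R) : 0 <= s <= L / 2 -> xd 0 (L - s) = - xd 0 s /\ zd 0 (L - s) = zd 0 s.
  by move=> hs; exact: alpha_symmetric (sub _ _ hs).
have Jdelta (s : R) : 0 <= s <= L -> 0 < 1 + delta * kappa xd zd s.
  by move=> hs; exact: curvature_delta (sub _ _ hs).
have concave := concave_ineq curvature_concave; rewrite kE in concave.
have DE := tube_setE T delta x_smooth z_smooth alpha_arclength.
have [_ contr] := D_simply_connected; rewrite DE in contr.
have [[_ [u [eigen odd_u]]] _] := mu1odd_min; rewrite DE in eigen odd_u.
have [m0 m00 hm0] := J_lower_bound L_gt0 delta_gt0 dx dz Jdelta.
have [[r [s [hr hs BE]]] hB] := B_min; rewrite !in_itv/= in hr hs.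
apply: (odd_eigenvalue_ge L_gt0 T_gt0 delta_gt0 dx dz unit_speed simple nonclosed symmetric
  concave Jdelta contr _ _ eigen odd_u).
  rewrite BE invr_gt0 exprn_gt0//; exact: lt_le_trans m00 (hm0 _ _ hs hr).
move=> s' r' hs' hr'; rewrite -kE.
have : exists r0 s0 : R, [/\ r0 \in `[0, delta], s0 \in `[0, L] &
    ((1 + r' * curvature x z s') ^+ 2)^-1 = ((1 + r0 * curvature x z s0) ^+ 2)^-1].
  by exists r', s'; exact: And3 (sub _ _ hr') (sub _ _ hs') (erefl _).
exact: hB.
Qed.
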